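(* For every $1<p<\infty$ there exists a constant $C_p<\infty$, depending only on $p$, such that for every UMD Banach space $X$ with $\mathrm{UMD}_p$ constant $\beta_{p,X}$, every generating sequence $\mathbf m=(m_k)_{k\ge 0}$ of integers $m_k\ge 2$ (not assumed bounded), and every $f\in L^p(G_{\mathbf m};X)$, $$\sup_{n\ge 1}\|S_nf\|_{L^p(G_{\mathbf m};X)}\le C_p\,\beta_{p,X}^4\,\|f\|_{L^p(G_{\mathbf m};X)},$$ where $S_n$ denotes the $n$-th Vilenkin partial-sum operator on $G_{\mathbf m}$.
   Context: All Banach spaces are complex; $\mathbb N=\{0,1,2,\dots\}$. Vilenkin group and system. For a generating sequence $\mathbf m=(m_k)_{k\ge0}$ of integers $m_k\ge2$, $G_{\mathbf m}:=\prod_{k\ge0}\mathbb Z_{m_k}$ with normalized Haar measure $\mu$. Put $M_0:=1$, $M_{k+1}:=m_kM_k$. Every $n\in\mathbb N$ has a unique expansion $n=\sum_{k\ge0}n_kM_k$ with $0\le n_k<m_k$ and only finitely many nonzero digits. For $x=(x_k)_{k\ge0}\in G_{\mathbf m}$ let $r_k(x):=e^{2\pi i x_k/m_k}$ and $\psi_n(x):=\prod_{k\ge0}r_k(x)^{n_k}$. For $f\in L^p(G_{\mathbf m};X)$ let $\widehat f(n):=\int_{G_{\mathbf m}}f\,\overline{\psi_n}\,d\mu$ and, for $n\ge 1$, $S_nf:=\sum_{0\le j<n}\widehat f(j)\psi_j$. UMD. For $1<p<\infty$, $X$ has the $\mathrm{UMD}_p$ property if there is $C<\infty$ such that $\|\sum_{k=1}^n\theta_kd_k\|_{L^p(\Omega;X)}\le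 C\|\sum_{k=1}^nd_k\|_{L^p(\Omega;X)}$ for every filtered probability space, every finite $X$-valued ($L^p$) martingale difference sequence $(d_k)_{k=1}^n$ and all signs $\theta_k\in\{-1,1\}$; the infimum of such $C$ is $\beta_{p,X}$. This property does not depend on $p\in(1,\infty)$, and $X$ is called UMD if it has it for one (equivalently every) $p$. *)

(* Defs.v *)
From HB Require Import structures.
From mathcomp Require Import all_boot all_order all_algebra.
From mathcomp Require Import complex.
From mathcomp Require Import all_classical all_reals all_analysis.

Set Implicit Arguments.
Unset Strict Implicit.
Unset Printing Implicit Defensive.

Import Order.TTheory GRing.Theory Num.Theory.
Import numFieldNormedType.Exports.

Local Open Scope classical_set_scope.
Local Open Scope complex_scope.
Local Open Scope ring_scope.

(* The norm of a complex normed space takes its values in R[i], on the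
   nonnegative real axis; [rnorm] reads it as an element of R. *)
Definition rnorm (R : realType) (X : completeNormedModType R[i]) (x : X) : R :=
  complex.Re `|x|.

Section bochner.
Context (R : realType) (X : completeNormedModType R[i]).
Context (d : measure_display) (T : measurableType d) (P : probability T R).
Implicit Types (F G : set (set T)) (f g s : T -> X) (p : R).

Definition simple_fun F s : Prop :=
  finite_set (range s) /\ forall v, F (s @^-1` [set v]).

(* Measurability is meant up to P-null sets: f agrees P-a.e. with a pointwise
   limit of F-simple functions. *)
Definition strongly_measurable F f : Prop :=
  exists s : nat -> T -> X, (forall n, simple_fun F (s n)) /\
    {ae P, forall x, s ^~ x @ \oo --> f x}.

Definition simple_integral s : X :=
  \sum_(v \in range s) (fine (P (s @^-1` [set v])))%:C *: v.

Definition is_bochner_integral f (v : X) : Prop :=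
  strongly_measurable measurable f /\
  exists s : nat -> T -> X,
    [/\ forall n, simple_fun measurable (s n),
        (\int[P]_x (rnorm (f x - s n x))%:E)%E @[n --> \oo] --> 0%E &
        simple_integral (s n) @[n --> \oo] --> v].

Definition bochner_integrable f : Prop := exists v, is_bochner_integral f v.

Definition bochner_integral f : X := xget 0 [set v | is_bochner_integral f v].

Definition bochner_integral_on (A : set T) f : X :=
  bochner_integral (fun x => if x \in A then f x else 0).

Definition Lp_norm p f : \bar R := Lnorm P p%:E (fun x => (rnorm (f x))%:E).

(* f (or rather its P-a.e. class) belongs to L^p(T, F, P; X) *)
Definition in_Lp F p f : Prop :=
  strongly_measurable F f /\ (Lp_norm p f < +oo)%E.

(* g is a version of E[f | G] *)
Definition is_cond_expectation G f g : Prop :=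
  [/\ bochner_integrable f, strongly_measurable G g, bochner_integrable g &
      forall A, G A -> bochner_integral_on A g = bochner_integral_on A f].

Definition filtration (F : nat -> set (set T)) : Prop :=
  [/\ forall k, sigma_algebra setT (F k),
      forall k, F k `<=` measurable &
      forall k, F k `<=` F k.+1].

(* L^p martingale difference sequence (D k), 1 <= k <= n, with respect to
   F 0, ..., F n; the values of D outside 1 <= k <= n are irrelevant. *)
Definition martingale_difference (F : nat -> set (set T)) p (n : nat)
    (D : nat -> T -> X) : Prop :=
  forall k, (1 <= k <= n)%N ->
    in_Lp (F k) p (D k) /\ is_cond_expectation (F k.-1) (D k) (fun=> 0).

End bochner.

Section umd.
Context (R : realType) (X : completeNormedModType R[i]).

(* [0 <= C] only matters for X = 0, where every real number would otherwise
   be an admissible constant. *)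
Definition UMD_bound (p C : R) : Prop :=
  0 <= C /\
  forall (d : measure_display) (T : measurableType d) (P : probability T R)
    (F : nat -> set (set T)) (n : nat) (D : nat -> T -> X) (theta : nat -> R),
    filtration F -> martingale_difference P F p n D ->
    (forall k, theta k = 1 \/ theta k = -1) ->
    (Lp_norm P p (fun x => (\sum_(1 <= k < n.+1) (theta k)%:C *: D k x)%R)
     <= C%:E * Lp_norm P p (fun x => (\sum_(1 <= k < n.+1) D k x)%R))%E.

Definition has_UMD (p : R) : Prop := exists C, UMD_bound p C.

(* beta_{p,X}; it is +oo when X fails UMD_p *)
Definition UMD_constant (p : R) : \bar R :=
  ereal_inf [set C%:E | C in UMD_bound p].

Definition UMD : Prop := exists p : R, 1 < p /\ has_UMD p.

End umd.

(* Since 'Z_n is Z/nZ only for 1 < n, the results about [vilenkin m] assume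
   [forall k, (2 <= m k)%N]. *)
Definition vilenkin (m : nat -> nat) : Type := forall k, 'Z_(m k).

Section vilenkin_structure.
Variable m : nat -> nat.

Definition vadd (a x : vilenkin m) : vilenkin m := fun k => a k + x k.

(* G_m is a countable product of finite discrete groups, so its Borel
   sigma-algebra is the one generated by the coordinate cylinders. *)
Definition coordinate_cylinder : set (set (vilenkin m)) :=
  [set A | exists k (a : 'Z_(m k)), A = [set x | x k = a]].

HB.instance Definition _ := gen_eqMixin (vilenkin m).
HB.instance Definition _ := gen_choiceMixin (vilenkin m).
HB.instance Definition _ := isPointed.Build (vilenkin m) (fun k => 0).
HB.instance Definition _ := Measurable.copy (vilenkin m)
  (g_sigma_algebraType coordinate_cylinder).

End vilenkin_structure.

Definition normalized_haar (R : realType) (m : nat -> nat)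
    (mu : probability (vilenkin m) R) : Prop :=
  forall (a : vilenkin m) (A : set (vilenkin m)), measurable A ->
    mu [set vadd a x | x in A] = mu A.

Definition radix (m : nat -> nat) (k : nat) : nat := (\prod_(j < k) m j)%N.

Definition digit (m : nat -> nat) (n k : nat) : nat :=
  ((n %/ radix m k) %% m k)%N.

(* The defining properties of the mixed-radix digits; those of index at least
   n vanish, so that products over all k may be cut off at k < n. *)
Lemma digitP (m : nat -> nat) (n : nat) : (forall k, 2 <= m k)%N ->
  [/\ forall k, (digit m n k < m k)%N,
      forall k, (n <= k)%N -> digit m n k = 0%N &
      n = (\sum_(k < n) digit m n k * radix m k)%N].
Proof.
move=> m2; have lt_radix k : (k < radix m k)%N.
  elim: k => [|k IH]; first by rewrite /radix big_ord0.
  rewrite /radix big_ord_recr /= -/(radix m k).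
  apply: (@leq_trans (radix m k * 2)%N); last by rewrite leq_mul2l m2 orbT.
  by rewrite muln2 -addnn -addn1 leq_add// (leq_ltn_trans _ IH).
have m0 k : (0 < m k)%N by apply: leq_trans (m2 k).
split=> [k|k nk|]; first by rewrite /digit ltn_mod.
  by rewrite /digit divn_small ?mod0n// (leq_ltn_trans nk).
have H K : (n %% radix m K = \sum_(k < K) digit m n k * radix m k)%N.
  elim: K => [|K IH]; first by rewrite big_ord0 /radix big_ord0 modn1.
  rewrite big_ord_recr /= -IH /radix big_ord_recr /= -/(radix m K) /digit.
  have r0 : (0 < radix m K)%N by apply: leq_ltn_trans (lt_radix K).
  rewrite {1}(divn_eq n (radix m K)) {1}(divn_eq (n %/ radix m K) (m K)).
  rewrite mulnDl -mulnA (mulnC (m K)) -addnA modnMDl modn_small 1?addnC//.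
  apply: (@leq_trans ((n %/ radix m K %% m K).+1 * radix m K)%N).
    by rewrite mulSn ltn_add2r ltn_mod.
  by rewrite mulnC leq_mul2l ltn_mod m0 orbT.
by rewrite -H modn_small.
Qed.

Section vilenkin_system.
Context (R : realType) (m : nat -> nat).

Definition rademacher (k : nat) (x : vilenkin m) : R[i] :=
  let t : R := 2 * pi * (x k : nat)%:R / (m k)%:R in cos t +i* sin t.

Definition vilenkin_fun (n : nat) (x : vilenkin m) : R[i] :=
  \prod_(k < n) rademacher k x ^+ digit m n k.

Context (X : completeNormedModType R[i]) (mu : probability (vilenkin m) R).

Definition fourier_coef (f : vilenkin m -> X) (n : nat) : X :=
  bochner_integral mu (fun x => (vilenkin_fun n x)^* *: f x).

Definition partial_sum (n : nat) (f : vilenkin m -> X) : vilenkin m -> X :=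
  fun x => \sum_(j < n) vilenkin_fun j x *: fourier_coef f j.

End vilenkin_system.

(* Main.v *)
Require Import Defs.
From HB Require Import structures.
From mathcomp Require Import all_boot all_order all_algebra.
From mathcomp Require Import complex.
From mathcomp Require Import all_classical all_reals all_analysis.
From mathcomp Require Import measurable_realfun.
From mathcomp Require Import ring lra zify.

(* After multiplication by the conjugate of psi_n, grouping the integers below n
   by their highest digit that differs from that of n turns S_n into a sum
   \sum_k P_k d_k: the d_k are the martingale differences, along the coordinates,
   of f times the conjugate of psi_n, and P_k projects the k-th coordinate on
   n_k consecutive frequencies of Z/m_k. Decoupling the two martingales
   (UMD twice) leaves Rademacher sums of P_k acting on independent coordinates.
   Up to kernels with uniformly bounded l1-norm, P_k is a combination of
   modulations of the discrete Hilbert kernel 1/j on Z/m_k. All the Z/m_k embed,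
   as step functions, in one Z/N with N divisible by all the m_k; on Z/N a
   kernel within bounded l1-distance of 2/j is an average of translated and
   dilated dyadic shifts, each of which UMD bounds by beta^2, uniformly in N.
   This gives beta * beta^2 * beta. *)

Set Implicit Arguments.
Unset Strict Implicit.
Unset Printing Implicit Defensive.

Import Order.TTheory GRing.Theory Num.Theory.
Import numFieldNormedType.Exports.

Local Open Scope classical_set_scope.
Local Open Scope complex_scope.
Local Open Scope ring_scope.

(** * Finite-dimensional L^p norms *)

(** The obstacle is uniformity in [m]. A bound for the k-th projection that grows with [m k] is
    useless, and projections on different coordinates must be treated together, which a priori asks
    for R-boundedness rather than boundedness. One operator settles both: [kap_op] taken with the
    element (1,...,1) of the group (Z/N)^K acts on all coordinates at once, so a plain L^p bound on
    a finite abelian group is already a bound for Rademacher sums. The kernel 2/j need only be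
    reached up to an l1 error, because convex combinations of translations, bounded multipliers and
    l1-small kernels are harmless for Rademacher sums. The averaged kernel differs from 2/j near the
    origin; cells of length at least [4 * Q], with [Q] the smallest dilation, confine this range to
    the first cell, where linear interpolation damps it. Decoupling costs one UMD constant in each
    direction: every increment splits into a part symmetric and a part antisymmetric in the two
    copies, and flipping the sign of the second exchanges the copies. Everything happens on finite
    sets; of [f] only its finitely many cell averages are used. *)

Section cabs.
Context (R : realType).
Implicit Types (a b : R[i]) (r : R).

Definition cabs a : R := complex.Re `|a|.

Lemma normc_cabs a : `|a| = (cabs a)%:C.
Proof.
have := normr_ge0 a; rewrite /cabs lecE /= => /andP[/eqP h _].
by apply/eqP; rewrite eq_complex /= -h !eqxx.
Qed.

Lemma cabs_ge0 a : 0 <= cabs a.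
Proof. by have := normr_ge0 a; rewrite normc_cabs lecR. Qed.

Lemma cabs_real r : cabs r%:C = `|r|.
Proof. by rewrite /cabs normc_def /= expr0n addr0 sqrtr_sqr. Qed.

Lemma cabs0 : cabs 0 = 0.
Proof. by rewrite /cabs normr0. Qed.

Lemma cabs1 : cabs 1 = 1.
Proof. by rewrite /cabs normr1. Qed.

Lemma cabsN a : cabs (- a) = cabs a.
Proof. by rewrite /cabs normrN. Qed.

Lemma cabsM a b : cabs (a * b) = cabs a * cabs b.
Proof. by apply/complexI; rewrite rmorphM -!normc_cabs normrM. Qed.

Lemma cabsV a : cabs a^-1 = (cabs a)^-1.
Proof. by apply/complexI; rewrite fmorphV -!normc_cabs normfV. Qed.

Lemma cabs_eq0 a : (cabs a == 0) = (a == 0).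
Proof. by rewrite -(inj_eq (@complexI R)) -normc_cabs normr_eq0. Qed.

Lemma ler_cabsD a b : cabs (a + b) <= cabs a + cabs b.
Proof. by have := ler_normD a b; rewrite !normc_cabs -rmorphD /= lecR. Qed.

Lemma ler_cabsB a b : cabs (a - b) <= cabs a + cabs b.
Proof. by rewrite -(cabsN b) ler_cabsD. Qed.

Lemma Re_le_cabs a : `|complex.Re a| <= cabs a.
Proof.
case: a => u v; rewrite /cabs normc_def /= -sqrtr_sqr ler_wsqrtr// lerDl.
exact: sqr_ge0.
Qed.

Lemma Im_le_cabs a : `|complex.Im a| <= cabs a.
Proof.
case: a => u v; rewrite /cabs normc_def /= -sqrtr_sqr ler_wsqrtr// lerDr.
exact: sqr_ge0.
Qed.

End cabs.

Section rnorm.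
Context (R : realType) (X : completeNormedModType R[i]).
Implicit Types (x y : X) (a : R[i]) (r : R).

Lemma normr_rnorm x : `|x| = (rnorm x)%:C.
Proof.
have := normr_ge0 x; rewrite /rnorm lecE /= => /andP[/eqP h _].
by apply/eqP; rewrite eq_complex /= -h !eqxx.
Qed.

Lemma rnorm_ge0 x : 0 <= rnorm x.
Proof. by have := normr_ge0 x; rewrite normr_rnorm lecR. Qed.

Lemma rnorm0 : rnorm (0 : X) = 0.
Proof. by rewrite /rnorm normr0. Qed.

Lemma rnorm0_eq0 x : rnorm x = 0 -> x = 0.
Proof. by move=> h; apply/normr0_eq0; rewrite normr_rnorm h. Qed.

Lemma ler_rnormD x y : rnorm (x + y) <= rnorm x + rnorm y.
Proof.
by have := ler_normD x y; rewrite !normr_rnorm -rmorphD /= lecR.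
Qed.

Lemma rnormN x : rnorm (- x) = rnorm x.
Proof. by rewrite /rnorm normrN. Qed.

Lemma ler_rnormB x y : rnorm (x - y) <= rnorm x + rnorm y.
Proof. by rewrite -(rnormN y) ler_rnormD. Qed.

Lemma rnormZ a x : rnorm (a *: x) = cabs a * rnorm x.
Proof.
rewrite /rnorm normrZ (normr_rnorm x) /cabs.
by case: `|a| => u v /=; rewrite mulr0 subr0.
Qed.

Lemma rnormZr r x : rnorm (r%:C *: x) = `|r| * rnorm x.
Proof. by rewrite rnormZ cabs_real. Qed.

Lemma rnorm_sum (I : Type) (s : seq I) (P : pred I) (F : I -> X) :
  rnorm (\sum_(i <- s | P i) F i) <= \sum_(i <- s | P i) rnorm (F i).
Proof.
elim/big_rec2: _ => [|i y x _ h]; first by rewrite rnorm0.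
by rewrite (le_trans (ler_rnormD _ _))// lerD2l.
Qed.

End rnorm.

Lemma powR_le_convex (R : realType) (p w x y : R) : 1 <= p ->
  0 <= w <= 1 -> 0 <= x -> 0 <= y ->
  (w * x + (1 - w) * y) `^ p <= w * x `^ p + (1 - w) * y `^ p.
Proof.
move=> p1 /andP[w0 w1] x0 y0.
have h := @convex_powR R p p1 (@Itv01 R w w0 w1) x y.
have := h _ _; rewrite !convRE /=; apply; rewrite inE /= in_itv /= andbT//.
Qed.

Lemma sum_pair (V : nmodType) (T1 T2 : finType) (F : T1 * T2 -> V) :
  \sum_t F t = \sum_t2 \sum_t1 F (t1, t2).
Proof.
rewrite exchange_big pair_bigA /=; apply: eq_bigr => -[] //.
Qed.

Section lpn.
Context (R : realType) (X : completeNormedModType R[i]) (p : R).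
Hypothesis p1 : 1 < p.
Let p0 : 0 < p. Proof. exact: lt_trans p1. Qed.
Let pn0 : p != 0. Proof. by rewrite gt_eqF. Qed.

(** The measure is counting measure, not the uniform probability. Adding an idle variable therefore
    costs the power of a cardinal seen in [lpn_fst]; these powers cancel between the two sides of
    each estimate. *)
Definition lpn (T : finType) (F : T -> X) : R :=
  (\sum_t (rnorm (F t) `^ p)) `^ p^-1.

Lemma lpn_ge0 (T : finType) (F : T -> X) : 0 <= lpn F.
Proof. exact: powR_ge0. Qed.

Let sum_ge0 (T : finType) (F : T -> X) : 0 <= \sum_t (rnorm (F t) `^ p).
Proof. by apply: sumr_ge0 => t _; exact: powR_ge0. Qed.

Lemma lpn_powR (T : finType) (F : T -> X) :
  lpn F `^ p = \sum_t (rnorm (F t) `^ p).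
Proof. by rewrite /lpn -powRrM mulVf// powRr1. Qed.

Lemma lpn_leP (T : finType) (F : T -> X) (a : R) : 0 <= a ->
  (lpn F <= a) = (\sum_t (rnorm (F t) `^ p) <= a `^ p).
Proof.
move=> a0; rewrite -lpn_powR; apply/idP/idP => h.
  by apply: ge0_ler_powR; rewrite ?nnegrE ?lpn_ge0// ltW.
have : (lpn F `^ p) `^ p^-1 <= (a `^ p) `^ p^-1.
  by apply: ge0_ler_powR; rewrite ?nnegrE ?powR_ge0 ?invr_ge0// ltW.
by rewrite -(powRrM (lpn F)) -(powRrM a) !mulfV// !powRr1 ?lpn_ge0.
Qed.

Lemma lpn_mono (T T' : finType) (F : T -> X) (G : T' -> X) :
  \sum_t (rnorm (F t) `^ p) <= \sum_t (rnorm (G t) `^ p) -> lpn F <= lpn G.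
Proof. by move=> h; rewrite lpn_leP ?lpn_ge0// lpn_powR. Qed.

Lemma lpn_le_pw (T : finType) (F G : T -> X) :
  (forall t, rnorm (F t) <= rnorm (G t)) -> lpn F <= lpn G.
Proof.
move=> h; apply: lpn_mono; apply: ler_sum => t _.
by apply: ge0_ler_powR; rewrite ?nnegrE ?rnorm_ge0// ltW.
Qed.

Lemma eq_lpn (T : finType) (F G : T -> X) : F =1 G -> lpn F = lpn G.
Proof. by move=> h; rewrite /lpn; congr (_ `^ _); apply: eq_bigr => t _; rewrite h. Qed.

Lemma eq_lpn_le (T : finType) (F G : T -> X) : F =1 G -> lpn F <= lpn G.
Proof. by move=> h; rewrite (eq_lpn h). Qed.

Lemma lpnZ (T : finType) (F : T -> X) (a : R[i]) :
  lpn (fun t => a *: F t) = cabs a * lpn F.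
Proof.
have a0 := cabs_ge0 a.
rewrite /lpn.
under eq_bigr do rewrite rnormZ powRM ?rnorm_ge0//.
rewrite -mulr_sumr powRM ?powR_ge0//.
by rewrite -powRrM mulfV// powRr1.
Qed.

Lemma lpnZr (T : finType) (F : T -> X) (r : R) :
  lpn (fun t => r%:C *: F t) = `|r| * lpn F.
Proof. by rewrite lpnZ cabs_real. Qed.

Lemma lpn0 (T : finType) : lpn (fun _ : T => 0 : X) = 0.
Proof.
by rewrite /lpn big1 ?powR0 ?invr_eq0// => t _; rewrite rnorm0 powR0.
Qed.

(** Minkowski from the convexity of the p-th power: for [a] and [b] strictly above the two norms,
    the sum is [a + b] times a convex combination, of weight [a / (a + b)], of the normalised
    functions. The strict bounds avoid dividing by a zero norm. *)
Lemma lpnD (T : finType) (F G : T -> X) :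
  lpn (fun t => F t + G t) <= lpn F + lpn G.
Proof.
suff key a b : lpn F < a -> lpn G < b -> lpn (fun t => F t + G t) <= a + b.
  apply/ler_addgt0Pr => e e0; rewrite (splitr e) addrACA.
  by apply: key; rewrite ltrDl divr_gt0.
move=> Fa Gb.
have a0 : 0 < a by rewrite (le_lt_trans _ Fa)// lpn_ge0.
have b0 : 0 < b by rewrite (le_lt_trans _ Gb)// lpn_ge0.
have ab0 : 0 < a + b by rewrite addr_gt0.
have abn0 : a + b != 0 by rewrite gt_eqF.
have an0 : a != 0 by rewrite gt_eqF.
have bn0 : b != 0 by rewrite gt_eqF.
rewrite lpn_leP ?(ltW ab0)//.
set w := a / (a + b).
have w0 : 0 <= w by rewrite divr_ge0// ltW.
have w1 : w <= 1 by rewrite ler_pdivrMr// mul1r lerDl ltW.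
have w'E : 1 - w = b / (a + b) by rewrite /w; field.
apply: (@le_trans _ _ (\sum_t ((a + b) `^ p *
   (w * (rnorm (F t) `^ p / a `^ p) + (1 - w) * (rnorm (G t) `^ p / b `^ p))))).
  apply: ler_sum => t _.
  have -> : rnorm (F t) `^ p / a `^ p = (rnorm (F t) / a) `^ p.
    by rewrite powRM ?rnorm_ge0 ?invr_ge0 ?(ltW a0)// -[a^-1]powR_inv1 ?(ltW a0)// -powRrM mulN1r powRN.
  have -> : rnorm (G t) `^ p / b `^ p = (rnorm (G t) / b) `^ p.
    by rewrite powRM ?rnorm_ge0 ?invr_ge0 ?(ltW b0)// -[b^-1]powR_inv1 ?(ltW b0)// -powRrM mulN1r powRN.
  apply: le_trans (ler_wpM2l (powR_ge0 _ _) (powR_le_convex (ltW p1) _ _ _)); last 3 first.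
  - by rewrite w0.
  - by rewrite divr_ge0 ?rnorm_ge0// ltW.
  - by rewrite divr_ge0 ?rnorm_ge0// ltW.
  have w'0 : 0 <= 1 - w by rewrite w'E divr_ge0// ltW.
  have e0 : 0 <= rnorm (F t) / a by rewrite divr_ge0 ?rnorm_ge0// ltW.
  have e1 : 0 <= rnorm (G t) / b by rewrite divr_ge0 ?rnorm_ge0// ltW.
  rewrite -powRM ?(ltW ab0)//; last by apply: addr_ge0; apply: mulr_ge0.
  have -> : (a + b) * (w * (rnorm (F t) / a) + (1 - w) * (rnorm (G t) / b))
     = rnorm (F t) + rnorm (G t) by rewrite w'E /w; field; rewrite an0 bn0 abn0.
  by apply: ge0_ler_powR; rewrite ?nnegrE ?rnorm_ge0 ?addr_ge0 ?rnorm_ge0 ?ler_rnormD// ltW.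
rewrite -mulr_sumr big_split /= -!mulr_sumr -!mulr_suml -!lpn_powR.
rewrite ler_piMr ?powR_ge0//.
have h (c x : R) : 0 <= x -> 0 < c -> x < c -> x `^ p / c `^ p <= 1.
  move=> x0 c0 xc; rewrite ler_pdivrMr ?powR_gt0// mul1r.
  by apply: ge0_ler_powR; rewrite ?nnegrE ?x0 ?ltW.
rewrite [leRHS](_ : 1 = w * 1 + (1 - w) * 1); last by ring.
by apply: lerD; apply: ler_wpM2l; rewrite ?subr_ge0//; apply: h; rewrite ?lpn_ge0.
Qed.

Lemma lpn_sum (T : finType) (I : Type) (s : seq I) (P : pred I) (F : I -> T -> X) :
  lpn (fun t => \sum_(i <- s | P i) F i t) <= \sum_(i <- s | P i) lpn (F i).
Proof.
elim: s => [|i s IH].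
  by rewrite big_nil (eq_lpn (G := fun=> 0)) ?lpn0// => t; rewrite big_nil.
rewrite big_cons; case: ifP => Pi.
  rewrite (eq_lpn (G := fun t => F i t + \sum_(i <- s | P i) F i t)).
    by apply: le_trans (lpnD _ _) _; rewrite lerD2l.
  by move=> t; rewrite big_cons Pi.
rewrite (eq_lpn (G := fun t => \sum_(i <- s | P i) F i t))// => t.
by rewrite big_cons Pi.
Qed.

Lemma lpnB (T : finType) (F G : T -> X) :
  lpn (fun t => F t - G t) <= lpn F + lpn G.
Proof.
apply: le_trans (lpnD F (fun t => - G t)) _; rewrite lerD2l.
by apply: lpn_le_pw => t; rewrite rnormN.
Qed.

Lemma lpn_reindex (T T' : finType) (h : T' -> T) (F : T -> X) :
  bijective h -> lpn (fun t => F (h t)) = lpn F.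
Proof.
move=> hb; rewrite /lpn; congr (_ `^ _).
by rewrite [RHS](reindex h)//; exact: onW_bij.
Qed.

Lemma lpn_reindexT (T : finType) (h : T -> T) (F : T -> X) :
  injective h -> lpn (fun t => F (h t)) = lpn F.
Proof. by move=> hi; apply: lpn_reindex; exact: injF_bij. Qed.

(* Fubini: a bound for a.e. section is a bound on the product. *)
Lemma lpn_pair_le (T1 T2 U1 : finType) (F : T1 * T2 -> X) (G : U1 * T2 -> X) (b : R) :
  0 <= b -> (forall t2, lpn (fun t1 => F (t1, t2)) <= b * lpn (fun t1 => G (t1, t2))) ->
  lpn F <= b * lpn G.
Proof.
move=> b0 h; rewrite lpn_leP ?mulr_ge0 ?lpn_ge0// powRM ?lpn_ge0// lpn_powR.
rewrite !sum_pair mulr_sumr; apply: ler_sum => t2 _.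
by have := h t2; rewrite lpn_leP ?mulr_ge0 ?lpn_ge0// powRM ?lpn_ge0// lpn_powR.
Qed.

Lemma lpn_fst (T1 T2 : finType) (F : T1 -> X) :
  lpn (fun t : T1 * T2 => F t.1) = (#|T2|%:R `^ p^-1) * lpn F.
Proof.
rewrite /lpn sum_pair /= sumr_const -[X in X `^ _]mulr_natl.
by rewrite powRM ?ler0n ?sum_ge0.
Qed.

End lpn.

Lemma sum_pred1_uniq (V : nmodType) (Y : eqType) (r : seq Y) (y : Y) (F : Y -> V) :
  uniq r -> y \in r -> \sum_(v <- r | y == v) F v = F y.
Proof.
move=> ur yr; rewrite -big_filter.
rewrite (eq_filter (a2 := pred1 y)); last by move=> v; rewrite /= eq_sym.
by rewrite filter_pred1_uniq// big_seq1.
Qed.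

(** * Bochner integrals against finite partitions *)

Section simple_functions.
Context (R : realType) (X : completeNormedModType R[i]).
Context (d : measure_display) (T : measurableType d) (P : probability T R).
Implicit Types (I J : finType).

Definition fin_measurable I (tau : T -> I) := forall i, measurable (tau @^-1` [set i]).

Lemma fin_measurable_pred I (tau : T -> I) (Q : pred I) : fin_measurable tau ->
  measurable [set x | Q (tau x)].
Proof.
move=> mtau; rewrite (_ : [set x | _] = \big[setU/set0]_(i | Q i) (tau @^-1` [set i])).
  by apply: bigsetU_measurable => i _; exact: mtau.
apply/seteqP; split => [x /= Qx|x].
  by rewrite (bigD1 (tau x))//=; left.
by elim/big_rec: _ => [//|i A Qi IH [/= e|/IH//]]; rewrite /= e.
Qed.

Lemma fin_measurable_pair I J (tau : T -> I) (ups : T -> J) :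
  fin_measurable tau -> fin_measurable ups ->
  fin_measurable (fun x => (tau x, ups x)).
Proof.
move=> mt mu [i j].
rewrite (_ : _ @^-1` _ = (tau @^-1` [set i]) `&` (ups @^-1` [set j])).
  by apply: measurableI.
by apply/seteqP; split => x /= [-> ->].
Qed.

Lemma integral_fin I (tau : T -> I) (h : I -> R) : fin_measurable tau ->
  (forall i, 0 <= h i) ->
  (\int[P]_x (h (tau x))%:E = \sum_i (h i)%:E * P (tau @^-1` [set i]))%E.
Proof.
move=> mtau h0.
transitivity (\int[P]_x (\sum_i (h i)%:E * (\1_(tau @^-1` [set i]) x)%:E))%E.
  apply: eq_integral => x _; rewrite (bigD1 (tau x))//= big1 ?adde0.
    by rewrite indicE mem_set//= mule1.
  move=> i ni; rewrite indicE memNset ?mule0//= => /= e.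
  by rewrite e eqxx in ni.
rewrite ge0_integral_sum//.
- apply: eq_bigr => i _; rewrite ge0_integralZl//.
  + by rewrite integral_indic// setIT.
  + by apply/measurable_realfun.measurable_EFinP; exact: measurable_indic.
  + by rewrite lee_fin.
- move=> i; apply: emeasurable_funM => //.
  by apply/measurable_realfun.measurable_EFinP; exact: measurable_indic.
- by move=> i x _; rewrite mule_ge0// lee_fin.
Qed.

Definition fp I (tau : T -> I) (i : I) : R := fine (P (tau @^-1` [set i])).

Lemma fpE I (tau : T -> I) (i : I) : fin_measurable tau ->
  P (tau @^-1` [set i]) = (fp tau i)%:E.
Proof. by move=> mt; rewrite fineK// fin_num_measure. Qed.

Lemma fp_ge0 I (tau : T -> I) (i : I) : 0 <= fp tau i.
Proof. exact: fine_ge0. Qed.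

Lemma fp_pred I (tau : T -> I) (Q : pred I) : fin_measurable tau ->
  fine (P [set x | Q (tau x)]) = \sum_(i | Q i) fp tau i.
Proof.
move=> mt; rewrite -[[set x | _]]setTI setIC -integral_indic//; last first.
  exact: fin_measurable_pred.
rewrite (eq_integral (fun x => ((Q (tau x))%:R : R)%:E)); last first.
  move=> x _; rewrite indicE; congr (_%:R%:E).
  by case: (boolP (Q (tau x))) => h; [rewrite mem_set|rewrite memNset//; exact/negP].
rewrite (integral_fin (h := fun i => (Q i)%:R))//.
under eq_bigr do rewrite fpE// -EFinM.
rewrite sumEFin /= [RHS]big_mkcond; apply: eq_bigr => i _.
by case: (Q i); rewrite ?mul1r ?mul0r.
Qed.

(** In the form [phi \o tau], two simple functions live on the common partition [(tau, ups)], and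
    integrals become finite sums over labels, where linearity is immediate. *)
Lemma simple_fun_fin (F : set (set T)) (s : T -> X) : (forall A, F A -> measurable A) ->
  simple_fun F s ->
  exists I (tau : T -> I) (phi : I -> X), fin_measurable tau /\ s = phi \o tau.
Proof.
move=> FM [fs ms].
pose r := finmap.enum_fset (fset_set (range s)).
have h x : s x \in r by rewrite in_fset_set// mem_set//; exists x.
exists (seq_sub r), (fun x => SeqSub (h x)), (@ssval _ r); split => // i.
rewrite (_ : _ @^-1` _ = s @^-1` [set ssval i]); first exact/FM/ms.
apply/seteqP; split => x /=; first by move=> <-.
by move=> e; apply/val_inj.
Qed.

Lemma fin_simple_fun I (tau : T -> I) (phi : I -> X) : fin_measurable tau ->
  simple_fun measurable (phi \o tau).
Proof.
move=> mt; split.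
  apply: (@sub_finite_set _ _ (phi @` setT)).
    by move=> y [x _ <-]; exists (tau x).
  by apply: finite_image; exact: finite_finset.
move=> v; rewrite (_ : _ @^-1` _ = [set x | (fun i => `[< phi i = v >]) (tau x)]).
  exact: (fin_measurable_pred (fun i => `[< phi i = v >]) mt).
by apply/seteqP; split => x /asboolP.
Qed.

Lemma simple_integral_fin I (tau : T -> I) (phi : I -> X) : fin_measurable tau ->
  simple_integral P (phi \o tau) = \sum_i (fp tau i)%:C *: phi i.
Proof.
move=> mt; rewrite /simple_integral.
pose r := undup (map phi (enum I)).
have PE v : fine (P ((phi \o tau) @^-1` [set v])) = \sum_(i | phi i == v) fp tau i.
  rewrite -fp_pred//; congr (fine (P _)).
  by apply/seteqP; split => x /= /eqP.
rewrite (@fsbig_widen _ _ _ _ _ [set` r])//=; first last.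
- move=> v [_ /= nv]; rewrite (_ : _ @^-1` _ = set0) ?measure0 ?scale0r//.
  by apply/seteqP; split => // x /= e; apply: nv; exists x.
- move=> v [x _ <-] /=; rewrite mem_undup; apply: map_f; exact: mem_enum.
rewrite -fsbig_seq ?undup_uniq//.
under eq_bigr do rewrite PE rmorph_sum scaler_suml.
rewrite (exchange_big_dep predT)//=; apply: eq_bigr => i _.
rewrite sum_pred1_uniq ?undup_uniq// mem_undup; apply: map_f; exact: mem_enum.
Qed.

Lemma simple_integral_normE (s : T -> X) : simple_fun measurable s ->
  ((rnorm (simple_integral P s))%:E <= \int[P]_x (rnorm (s x))%:E)%E.
Proof.
move=> /simple_fun_fin[]// I [tau [phi [mt ->]]].
rewrite simple_integral_fin// (integral_fin (h := fun i => rnorm (phi i)))//; last first.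
  by move=> i; exact: rnorm_ge0.
rewrite [leRHS](eq_bigr (fun i => (rnorm (phi i) * fp tau i)%:E)); last first.
  by move=> i _; rewrite fpE.
rewrite sumEFin lee_fin; apply: le_trans (rnorm_sum _ _ _) _.
by apply: ler_sum => i _; rewrite rnormZr ger0_norm ?fp_ge0// mulrC.
Qed.

Lemma simple_fun2 (s s' : T -> X) (g : X -> X -> X) : simple_fun measurable s ->
  simple_fun measurable s' -> simple_fun measurable (fun x => g (s x) (s' x)).
Proof.
move=> /simple_fun_fin[]// I [tau [phi [mt ->]]].
move=> /simple_fun_fin[]// J [ups [psi [mu ->]]].
exact: (fin_simple_fun (fun ij => g (phi ij.1) (psi ij.2)) (fin_measurable_pair mt mu)).
Qed.

Lemma simple_fun_fin2 I (tau : T -> I) (s : T -> X) (g : I -> X -> X) :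
  fin_measurable tau -> simple_fun measurable s ->
  simple_fun measurable (fun x => g (tau x) (s x)).
Proof.
move=> mt /simple_fun_fin[]// J [ups [psi [mu ->]]].
exact: (fin_simple_fun (fun ij => g ij.1 (psi ij.2)) (fin_measurable_pair mt mu)).
Qed.

Lemma simple_integralD (s s' : T -> X) : simple_fun measurable s ->
  simple_fun measurable s' ->
  simple_integral P (fun x => s x + s' x) = simple_integral P s + simple_integral P s'.
Proof.
move=> /simple_fun_fin[]// I [tau [phi [mt ->]]].
move=> /simple_fun_fin[]// J [ups [psi [mu ->]]].
have m := fin_measurable_pair mt mu.
rewrite (simple_integral_fin (fun ij => phi ij.1 + psi ij.2) m).
rewrite (simple_integral_fin (fun ij => phi ij.1) m).
rewrite (simple_integral_fin (fun ij => psi ij.2) m).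
by rewrite -big_split; apply: eq_bigr => ij _; rewrite scalerDr.
Qed.

Lemma simple_integralZ (a : R[i]) (s : T -> X) : simple_fun measurable s ->
  simple_integral P (fun x => a *: s x) = a *: simple_integral P s.
Proof.
move=> /simple_fun_fin[]// I [tau [phi [mt ->]]].
rewrite (simple_integral_fin (fun i => a *: phi i) mt) simple_integral_fin//.
by rewrite scaler_sumr; apply: eq_bigr => i _; rewrite !scalerA mulrC.
Qed.

Lemma simple_integral_sum (J : Type) (r : seq J) (s : J -> T -> X) :
  (forall j, simple_fun measurable (s j)) ->
  simple_fun measurable (fun x => \sum_(j <- r) s j x) /\
  simple_integral P (fun x => \sum_(j <- r) s j x) = \sum_(j <- r) simple_integral P (s j).
Proof.
have m1 : fin_measurable (fun _ : T => tt).
  by move=> i; rewrite (_ : _ @^-1` _ = setT)//; apply/seteqP; split => // x _ /=; case: i.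
move=> ms; elim: r => [|j r [IH1 IH2]].
  rewrite (_ : (fun x => _) = (fun=> 0 : X) \o (fun _ : T => tt)); last first.
    by apply/funext => x; rewrite big_nil.
  split; first exact: fin_simple_fun.
  by rewrite simple_integral_fin// big_nil big1// => i _; rewrite scaler0.
rewrite (_ : (fun x => _) = (fun x => s j x + \sum_(j <- r) s j x)); last first.
  by apply/funext => x; rewrite big_cons.
split; first exact: simple_fun2 (ms j) IH1.
by rewrite simple_integralD// IH2 big_cons.
Qed.

End simple_functions.

(** * Integrals of functions that are measurable only up to a null set *)

Section null_sets.
Context (R : realType) (d : measure_display) (T : measurableType d) (P : probability T R).
Local Open Scope ereal_scope.

Lemma ge0_le_integral_nomeas (g h : T -> \bar R) : (forall x, 0 <= g x) ->
  (forall x, g x <= h x) -> \int[P]_x g x <= \int[P]_x h x.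
Proof.
move=> g0 gh; have h0 x : 0 <= h x by exact: le_trans (gh x).
rewrite !ge0_integralTE//; apply: ereal_sup_le => _ /= [k kg <-].
exists k => // x; exact: le_trans (kg x) (gh x).
Qed.

Import HBNNSimple.

(** Measurability is asked of [h] only, since [g] will be the norm of a strongly measurable
    function, which agrees with a measurable one merely off a null set. The integral of [g] is a
    supremum over simple functions below it, and each of these is measurable, so it can be cut off
    on [N]. *)
Lemma ge0_le_integral_off (N : set T) (g h : T -> \bar R) : measurable N ->
  P N = 0 -> (forall x, 0 <= g x) -> (forall x, 0 <= h x) ->
  measurable_fun setT h -> (forall x, ~ N x -> g x <= h x) ->
  \int[P]_x g x <= \int[P]_x h x.
Proof.
move=> mN N0 g0 h0 mh gh.
rewrite ge0_integralTE//; apply: ge_ereal_sup => _ /= [k kg <-].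
rewrite -integralT_nnsfun.
rewrite (ge0_ae_eq_integral (g := fun x => (k x)%:E * (\1_(~` N) x)%:E))//.
- apply: ge0_le_integral => //.
  + by move=> x _; rewrite mule_ge0// lee_fin.
  + apply: emeasurable_funM; first exact/measurable_EFinP.
    by apply/measurable_EFinP; apply: measurable_indic; exact: measurableC.
  + move=> x _; rewrite indicE; case: (boolP (x \in ~` N)) => [/set_mem xN|_].
      by rewrite mule1; exact: le_trans (kg x) (gh x xN).
    by rewrite mule0.
- exact/measurable_EFinP.
- apply: emeasurable_funM; first exact/measurable_EFinP.
  by apply/measurable_EFinP; apply: measurable_indic; exact: measurableC.
- by move=> x _; rewrite lee_fin.
- by move=> x _; rewrite mule_ge0// lee_fin.
- exists N; split => // x /= /not_implyP[_]; apply: contra_notP => xN.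
  by rewrite indicE mem_set// mule1.
Qed.

Lemma ge0_eq_integral_off (N : set T) (g h : T -> \bar R) : measurable N ->
  P N = 0 -> (forall x, 0 <= g x) -> (forall x, 0 <= h x) ->
  measurable_fun setT h -> (forall x, ~ N x -> g x = h x) ->
  \int[P]_x g x = \int[P]_x h x.
Proof.
move=> mN N0 g0 h0 mh gh; apply/eqP; rewrite eq_le; apply/andP; split.
  by apply: (ge0_le_integral_off mN) => // x /gh ->.
rewrite (ge0_ae_eq_integral (g := fun x => h x * (\1_(~` N) x)%:E))//.
- apply: ge0_le_integral_nomeas => x; first by rewrite mule_ge0// lee_fin.
  rewrite indicE; case: (boolP (x \in ~` N)) => [/set_mem xN|_].
    by rewrite mule1 gh.
  by rewrite mule0.
- apply: emeasurable_funM => //.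
  by apply/measurable_EFinP; apply: measurable_indic; exact: measurableC.
- by move=> x _; rewrite mule_ge0// lee_fin.
- exists N; split => // x /= /not_implyP[_]; apply: contra_notP => xN.
  by rewrite indicE mem_set// mule1.
Qed.

End null_sets.

Section rnorm_cvg.
Context (R : realType) (X : completeNormedModType R[i]).

Lemma cvg_rnormP (u : nat -> X) (l : X) :
  u @ \oo --> l <-> (forall e : R, 0 < e -> \forall n \near \oo, rnorm (l - u n) < e).
Proof.
split => [/cvgrPdist_lt h e e0|h].
  have /h : 0 < e%:C :> R[i] by rewrite ltcR.
  by apply: filterS => n; rewrite normr_rnorm ltcR.
apply/cvgrPdist_lt => e e0.
have re : e = (complex.Re e)%:C.
  by move: e0; case: e => a b; rewrite ltcE /= => /andP[/eqP ->].
have /h : 0 < complex.Re e by move: e0; rewrite re ltcR.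
by apply: filterS => n; rewrite normr_rnorm [in X in _ -> X]re ltcR.
Qed.

Lemma cvg_rnormB (u : nat -> X) (l c : X) :
  u @ \oo --> l -> rnorm (u n - c) @[n --> \oo] --> rnorm (l - c).
Proof.
move=> /cvg_rnormP h; apply/cvgrPdist_lt => e /h.
apply: filterS => n; apply: le_lt_trans.
have h1 := ler_rnormD (l - u n) (u n - c).
have h2 := ler_rnormD (u n - l) (l - c).
rewrite !addrA !subrK in h1 h2.
have h3 : rnorm (u n - l) = rnorm (l - u n) by rewrite -rnormN opprB.
by rewrite ler_norml; apply/andP; split; lra.
Qed.

End rnorm_cvg.

Section bochner_theory.
Context (R : realType) (X : completeNormedModType R[i]).
Context (d : measure_display) (T : measurableType d) (P : probability T R).
Implicit Types (f g : T -> X).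

(* The exact pointwise limit [g] replaces [f] off a null set. *)
Definition sm_version f N g (s : nat -> T -> X) :=
  [/\ measurable N, P N = 0%E, forall x, ~ N x -> f x = g x,
      forall n, simple_fun measurable (s n) & forall x, s ^~ x @ \oo --> g x].

Lemma sm_versionP f : strongly_measurable P measurable f ->
  exists N g s, sm_version f N g s.
Proof.
move=> [s [ms [N [mN N0 sN]]]].
pose b x := `[< N x >].
have mb : fin_measurable (b : T -> bool).
  case=> /=; [rewrite (_ : _ @^-1` _ = N)//|rewrite (_ : _ @^-1` _ = ~` N)].
  - by apply/seteqP; split => x /=; [move/asboolP|move=> ?; apply/asboolP].
  - exact: measurableC.
  - by apply/seteqP; split => x /=; [move/asboolPn|move=> ?; apply/asboolPn].
exists N, (fun x => if b x then 0 else f x), (fun n x => if b x then 0 else s n x).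
split=> //.
- by move=> x xN; case: ifPn => // /asboolP.
- by move=> n; exact: (simple_fun_fin2 (fun (c : bool) v => if c then 0 else v) mb (ms n)).
- move=> x; rewrite /b; case: asboolP => xN; first exact: cvg_cst.
  by apply: contrapT => h; apply: xN; apply: sN.
Qed.

Lemma measurable_rnorm_simple (s : T -> X) : simple_fun measurable s ->
  measurable_fun setT (fun x => rnorm (s x)).
Proof.
move=> /simple_fun_fin[]// I [tau [phi [mt ->]]] _ Y mY.
rewrite setTI (_ : _ @^-1` _ = [set x | (fun i => `[< Y (rnorm (phi i)) >]) (tau x)]).
  exact: (fin_measurable_pred (fun i => `[< Y (rnorm (phi i)) >]) mt).
by apply/seteqP; split => x /asboolP.
Qed.

Lemma measurable_rnorm_lim (g : T -> X) (s : nat -> T -> X) (c : T -> X) :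
  (forall n, simple_fun measurable (s n)) -> (forall x, s ^~ x @ \oo --> g x) ->
  simple_fun measurable c -> measurable_fun setT (fun x => rnorm (g x - c x)).
Proof.
move=> ms sg mc; apply: (@measurable_fun_cvg _ _ _ _ (fun n x => rnorm (s n x - c x))).
  by move=> n; apply: measurable_rnorm_simple; exact: (simple_fun2 (fun u v => u - v) (ms n) mc).
by move=> x _; exact: cvg_rnormB.
Qed.

(** Source of both halves of the theory: the simple integrals of an L^1 approximation are Cauchy, so
    the integral exists, and two approximations have the same limit, so it is unique. *)
Lemma simple_integral_dist f (s s' : T -> X) : strongly_measurable P measurable f ->
  simple_fun measurable s -> simple_fun measurable s' ->
  ((rnorm (simple_integral P s - simple_integral P s'))%:E <=
   \int[P]_x (rnorm (f x - s x))%:E + \int[P]_x (rnorm (f x - s' x))%:E)%E.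
Proof.
move=> /sm_versionP[N [g [u [mN N0 fg mu ug]]]] ms ms'.
have mg c : simple_fun measurable c -> measurable_fun setT (fun x => (rnorm (g x - c x))%:E).
  by move=> mc; apply/measurable_EFinP; exact: measurable_rnorm_lim mu ug mc.
have fgE c : simple_fun measurable c ->
    (\int[P]_x (rnorm (f x - c x))%:E = \int[P]_x (rnorm (g x - c x))%:E)%E.
  move=> mc; apply: (ge0_eq_integral_off mN) => //.
  - by move=> x; rewrite lee_fin rnorm_ge0.
  - by move=> x; rewrite lee_fin rnorm_ge0.
  - exact: mg.
  - by move=> x /fg ->.
rewrite !fgE// -ge0_integralD//; try exact: mg; try by move=> *; rewrite lee_fin rnorm_ge0.
rewrite -scaleN1r -simple_integralZ// -simple_integralD//; last first.
  exact: (simple_fun2 (fun u _ => (-1) *: u) ms' ms').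
apply: le_trans (simple_integral_normE _ _) _.
  exact: (simple_fun2 (fun u v => u + (-1) *: v) ms ms').
apply: ge0_le_integral_nomeas => x; first by rewrite lee_fin rnorm_ge0.
rewrite -EFinD lee_fin scaleN1r.
have -> : s x - s' x = (g x - s' x) - (g x - s x) by rewrite opprB [RHS]addrC addrA subrK.
by rewrite [leRHS]addrC ler_rnormB.
Qed.

Definition L1_approx f (s : nat -> T -> X) :=
  (forall n, simple_fun measurable (s n)) /\
  (\int[P]_x (rnorm (f x - s n x))%:E)%E @[n --> \oo] --> 0%E.

Lemma cvge0_small (a : nat -> \bar R) (e : R) : a @ \oo --> 0%E -> 0 < e ->
  \forall n \near \oo, (a n < e%:E)%E.
Proof.
move=> h e0; apply: (h [set y | (y < e%:E)%E]); apply: open_nbhs_nbhs; split.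
  exact: open_ereal_lt_ereal.
by rewrite /= lte_fin.
Qed.

Lemma cvge0_sandwich (a b : nat -> \bar R) : (forall n, 0 <= a n <= b n)%E ->
  b @ \oo --> 0%E -> a @ \oo --> 0%E.
Proof.
move=> ab b0; apply: (@squeeze_cvge _ _ _ _ (fun=> 0%E) _ b) => //.
  by apply: nearW => n; exact: ab.
exact: cvg_cst.
Qed.

Lemma L1_approx_cvg f (s s' : nat -> T -> X) (v : X) :
  strongly_measurable P measurable f -> L1_approx f s -> L1_approx f s' ->
  simple_integral P (s n) @[n --> \oo] --> v ->
  simple_integral P (s' n) @[n --> \oo] --> v.
Proof.
move=> mf [ms s0] [ms' s'0] /cvg_rnormP sv; apply/cvg_rnormP => e e0.
have e3 : 0 < e / 3 by rewrite divr_gt0.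
near=> n.
have h1 : rnorm (v - simple_integral P (s n)) < e / 3 by near: n; exact: sv.
have h2 : (\int[P]_x (rnorm (f x - s n x))%:E < (e / 3)%:E)%E.
  by near: n; exact: cvge0_small s0 e3.
have h3 : (\int[P]_x (rnorm (f x - s' n x))%:E < (e / 3)%:E)%E.
  by near: n; exact: cvge0_small s'0 e3.
have : (rnorm (simple_integral P (s n) - simple_integral P (s' n)) < e / 3 + e / 3)%R.
  rewrite -lte_fin EFinD; apply: le_lt_trans (simple_integral_dist mf (ms n) (ms' n)) _.
  exact: lteD.
have := ler_rnormD (v - simple_integral P (s n))
  (simple_integral P (s n) - simple_integral P (s' n)).
rewrite addrA subrK; lra.
Unshelve. all: end_near. Qed.

Lemma bochner_approx f v (s : nat -> T -> X) : is_bochner_integral P f v ->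
  L1_approx f s -> simple_integral P (s n) @[n --> \oo] --> v.
Proof.
by move=> [mf [s' [ms' s'0 s'v]]] hs; apply: (L1_approx_cvg mf _ hs s'v).
Qed.

Lemma is_bochner_unique f v w : is_bochner_integral P f v ->
  is_bochner_integral P f w -> v = w.
Proof.
move=> hv [mf [s [ms s0 sw]]]; have hs : L1_approx f s by split.
have sv := bochner_approx hv hs.
exact: (cvg_unique (@norm_hausdorff _ _) sv sw).
Qed.

Lemma bochner_integralE f v : is_bochner_integral P f v -> bochner_integral P f = v.
Proof.
move=> hv; rewrite /bochner_integral.
by case: xgetP => [w _ hw|/(_ v)//]; exact: is_bochner_unique hv.
Qed.

Lemma simple_strongly_measurable (F : set (set T)) (s : T -> X) : simple_fun F s ->
  strongly_measurable P F s.
Proof.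
move=> ms; exists (fun=> s); split => //; apply: aeW => x; exact: cvg_cst.
Qed.

Lemma is_bochner_simple (s : T -> X) : simple_fun measurable s ->
  is_bochner_integral P s (simple_integral P s).
Proof.
move=> ms; split; first exact: simple_strongly_measurable.
exists (fun=> s); split => //; last exact: cvg_cst.
rewrite (_ : (fun n => _) = (fun=> 0%E)); first exact: cvg_cst.
apply/funext => n; rewrite integral0_eq// => x _.
by rewrite subrr rnorm0.
Qed.

Lemma L1_approx_exists f : strongly_measurable P measurable f ->
  (\int[P]_x (rnorm (f x))%:E < +oo)%E -> exists s, L1_approx f s.
Proof.
move=> /sm_versionP[N [g [u [mN N0 fg mu ug]]]] foo.
have m0 : simple_fun measurable (fun _ : T => 0 : X).
  apply: (@fin_simple_fun _ _ _ _ _ (fun _ : T => tt) (fun=> 0)) => -[].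
  by rewrite (_ : _ @^-1` _ = setT)//; apply/seteqP; split.
have mg : measurable_fun setT (fun x => rnorm (g x)).
  apply: (eq_measurable_fun (fun x => rnorm (g x - 0))).
    by move=> x _; rewrite subr0.
  exact: measurable_rnorm_lim mu ug m0.
(* Approximants larger than twice the limit are replaced by 0. This never increases the distance to
   [g x], and it provides the integrable majorant [3 * rnorm (g x)] for dominated convergence. *)
pose b n x := rnorm (u n x) <= 2 * rnorm (g x).
have mb n : fin_measurable (b n : T -> bool).
  have mbt : measurable [set x | b n x].
    have -> : [set x | b n x] = setT `&` [set x | (rnorm (u n x) <= 2 * rnorm (g x))%R].
      by rewrite setTI.
    apply: measurable_fun_le => //; first exact: measurable_rnorm_simple.
    exact: measurable_funM.
  case=> /=.
    by rewrite (_ : _ @^-1` _ = [set x | b n x])//; apply/seteqP; split.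
  rewrite (_ : _ @^-1` _ = ~` [set x | b n x]); first exact: measurableC.
  by apply/seteqP; split => x /=; [move=> ->|move/negP/negbTE].
pose s n x := if b n x then u n x else 0.
have ms n : simple_fun measurable (s n).
  exact: (simple_fun_fin2 (fun (c : bool) v => if c then v else 0) (mb n) (mu n)).
exists s; split => //.
have fgE n : (\int[P]_x (rnorm (f x - s n x))%:E = \int[P]_x (rnorm (g x - s n x))%:E)%E.
  apply: (ge0_eq_integral_off mN) => //.
  - by move=> x; rewrite lee_fin rnorm_ge0.
  - by move=> x; rewrite lee_fin rnorm_ge0.
  - by apply/measurable_EFinP; exact: measurable_rnorm_lim mu ug (ms n).
  - by move=> x /fg ->.
under eq_fun do rewrite fgE.
have goo : (\int[P]_x (rnorm (g x))%:E < +oo)%E.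
  rewrite -(ge0_eq_integral_off mN (g := fun x => (rnorm (f x))%:E))//.
  - by move=> x; rewrite lee_fin rnorm_ge0.
  - by move=> x; rewrite lee_fin rnorm_ge0.
  - exact/measurable_EFinP.
  - by move=> x /fg ->.
have sb n x : rnorm (g x - s n x) <= rnorm (g x - u n x).
  rewrite /s; case: ifPn => //; rewrite /b -ltNge subr0 => h.
  have := ler_rnormD (u n x - g x) (g x); rewrite subrK -(rnormN (u n x - g x)) opprB; lra.
suff : (\int[P]_x (rnorm (g x - s n x))%:E)%E @[n --> \oo] --> (\int[P]_(x in setT) 0)%E.
  by rewrite integral0.
apply: (@dominated_cvg _ _ _ P setT measurableT _ _ (fun x => (3 * rnorm (g x))%:E)) => //.
- by move=> n; apply/measurable_EFinP; exact: measurable_rnorm_lim mu ug (ms n).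
- move=> x _; apply: (cvge0_sandwich (b := fun n => (rnorm (u n x - g x))%:E)).
    move=> n; rewrite !lee_fin rnorm_ge0 /=.
    by rewrite -(rnormN (u n x - g x)) opprB; exact: sb.
  apply/cvg_EFin; first by apply: nearW.
  have := @cvg_rnormB _ _ (u ^~ x) (g x) (g x) (ug x).
  by rewrite subrr rnorm0.
- apply/integrableP; split.
    by apply/measurable_EFinP; exact: measurable_funM.
  under eq_integral do rewrite gee0_abs ?lee_fin ?mulr_ge0 ?rnorm_ge0// EFinM.
  rewrite ge0_integralZl//; last 2 first.
  + exact/measurable_EFinP.
  + by move=> x _; rewrite lee_fin rnorm_ge0.
  by rewrite lte_mul_pinfty.
- move=> n x _; rewrite gee0_abs ?lee_fin ?rnorm_ge0// /s.
  case: ifPn => [|_]; last by rewrite subr0; have := rnorm_ge0 (g x); lra.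
  rewrite /b; have := ler_rnormB (g x) (u n x); lra.
Qed.

Lemma L1_approx_lim f s : strongly_measurable P measurable f -> L1_approx f s ->
  exists v, is_bochner_integral P f v /\ simple_integral P (s n) @[n --> \oo] --> v.
Proof.
move=> mf hs; have [ms s0] := hs.
suff /cvg_ex[v hv] : cvg (simple_integral P (s n) @[n --> \oo]).
  by exists v; split => //; split => //; exists s; split.
apply: cauchy_cvg; apply: cauchy_exP => e e0.
have re : e = (complex.Re e)%:C.
  by move: e0; case: e => a b; rewrite ltcE /= => /andP[/eqP ->].
have e20 : 0 < complex.Re e / 2 by rewrite divr_gt0//; move: e0; rewrite re ltcR.
have [N _ hN] := cvge0_small s0 e20.
exists (simple_integral P (s N)); exists N => // n /= Nn.
rewrite /= -ball_normE /= normr_rnorm re ltcR (splitr (complex.Re e)) -lte_fin EFinD.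
apply: le_lt_trans (simple_integral_dist mf (ms N) (ms n)) _.
by apply: lteD; apply: hN => /=.
Qed.

End bochner_theory.

Lemma cvg_bigsum (K : numFieldType) (V : normedModType K) (I : Type) (r : seq I)
    (u : I -> nat -> V) (l : I -> V) : (forall i, u i @ \oo --> l i) ->
  \sum_(i <- r) u i n @[n --> \oo] --> \sum_(i <- r) l i.
Proof.
move=> h; elim: r => [|i r IH].
  by rewrite big_nil; under eq_fun do rewrite big_nil; exact: cvg_cst.
by rewrite big_cons; under eq_fun do rewrite big_cons; exact: cvgD.
Qed.

(** * Cell integrals of an L^p function *)

Section bochner_Lp.
Context (R : realType) (X : completeNormedModType R[i]).
Context (d : measure_display) (T : measurableType d) (P : probability T R).
Implicit Types (f g : T -> X).

Lemma const0_simple : simple_fun measurable (fun _ : T => 0 : X).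
Proof.
apply: (@fin_simple_fun _ _ _ _ _ (fun _ : T => tt) (fun=> 0)) => -[].
by rewrite (_ : _ @^-1` _ = setT)//; apply/seteqP; split.
Qed.

Lemma sm_rnorm f : strongly_measurable P measurable f ->
  exists N (h : T -> R), [/\ measurable N, P N = 0%E, measurable_fun setT h,
    forall x, 0 <= h x & forall x, ~ N x -> rnorm (f x) = h x].
Proof.
move=> /sm_versionP[N [g [u [mN N0 fg mu ug]]]].
exists N, (fun x => rnorm (g x)); split => //.
- apply: (eq_measurable_fun (fun x => rnorm (g x - 0))).
    by move=> x _; rewrite subr0.
  exact: measurable_rnorm_lim mu ug const0_simple.
- by move=> x; exact: rnorm_ge0.
- by move=> x /fg ->.
Qed.

Lemma strongly_measurableZ (I : finType) (tau : T -> I) (w : I -> R[i]) f :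
  fin_measurable tau -> strongly_measurable P measurable f ->
  strongly_measurable P measurable (fun x => w (tau x) *: f x).
Proof.
move=> mt [s [ms sf]]; exists (fun n x => w (tau x) *: s n x); split.
  by move=> n; exact: (simple_fun_fin2 (fun i v => w i *: v) mt (ms n)).
by move: sf; apply: filterS => x; exact: cvgZr.
Qed.

Lemma bochner_norm f v : is_bochner_integral P f v ->
  ((rnorm v)%:E <= \int[P]_x (rnorm (f x))%:E)%E.
Proof.
move=> [mf [s [ms s0 /cvg_rnormP sv]]]; apply/lee_addgt0Pr => e e0.
have e2 : 0 < e / 2 by rewrite divr_gt0.
have [n [h1 h2]] : exists n, rnorm (v - simple_integral P (s n)) < e / 2 /\
    (\int[P]_x (rnorm (f x - s n x))%:E < (e / 2)%:E)%E.
  have [n _ hn] := filterI (sv _ e2) (cvge0_small s0 e2).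
  by exists n; apply: hn => /=.
have [N [h [mN N0 mh h0 fh]]] := sm_rnorm mf.
have [N' [g [u [mN' N0' fg mu ug]]]] := sm_versionP mf.
have mgs : measurable_fun setT (fun x => rnorm (g x - s n x)).
  exact: measurable_rnorm_lim mu ug (ms n).
have -> : (\int[P]_x (rnorm (f x))%:E = \int[P]_x (h x)%:E)%E.
  apply: (ge0_eq_integral_off mN N0) => //.
  - by move=> x; rewrite lee_fin rnorm_ge0.
  - exact/measurable_EFinP.
  - by move=> x /fh ->.
have h3 : (\int[P]_x (rnorm (g x - s n x))%:E < (e / 2)%:E)%E.
  rewrite -(ge0_eq_integral_off mN' (g := fun x => (rnorm (f x - s n x))%:E))//.
  - by move=> x; rewrite lee_fin rnorm_ge0.
  - by move=> x; rewrite lee_fin rnorm_ge0.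
  - exact/measurable_EFinP.
  - by move=> x /fg ->.
have h4 : ((rnorm (simple_integral P (s n)))%:E <=
    \int[P]_x (h x)%:E + \int[P]_x (rnorm (g x - s n x))%:E)%E.
  apply: le_trans (simple_integral_normE _ (ms n)) _.
  rewrite -ge0_integralD//; last 4 first.
  - by move=> x _; rewrite lee_fin.
  - exact/measurable_EFinP.
  - by move=> x _; rewrite lee_fin rnorm_ge0.
  - exact/measurable_EFinP.
  apply: (ge0_le_integral_off (measurableU _ _ mN mN')).
  - by rewrite measureU0.
  - by move=> x; rewrite lee_fin rnorm_ge0.
  - by move=> x; rewrite -EFinD lee_fin addr_ge0// rnorm_ge0.
  - by apply: emeasurable_funD; exact/measurable_EFinP.
  - move=> x xN; rewrite -EFinD lee_fin -fh; last by move=> ?; apply: xN; left.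
    rewrite fg; last by move=> ?; apply: xN; right.
    have := ler_rnormB (g x) (g x - s n x).
    by rewrite opprB addrCA subrr addr0.
apply: (@le_trans _ _ ((e / 2)%:E + (\int[P]_x (h x)%:E + (e / 2)%:E))%E).
  apply: (@le_trans _ _ ((e / 2)%:E + (rnorm (simple_integral P (s n)))%:E)%E).
    rewrite -EFinD lee_fin.
    have := ler_rnormD (v - simple_integral P (s n)) (simple_integral P (s n)).
    by rewrite subrK; lra.
  apply: leeD => //; apply: le_trans h4 _; apply: leeD => //; exact: ltW.
by rewrite addeCA -EFinD -splitr.
Qed.

Lemma sum_deltaZ (I : finType) (i : I) (F : I -> X) : \sum_j ((j == i)%:R : R[i]) *: F j = F i.
Proof.
rewrite (bigD1 i)//= eqxx scale1r big1 ?addr0// => j ji.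
by rewrite (negbTE ji) scale0r.
Qed.

(** [V i] is the integral of [f] over the cell [tau = i]. One approximating sequence serves all
    weights, so the same family [V] works for every [w]; later these vectors are all that the
    Fourier coefficients see of [f]. *)
Lemma bochner_weights (I : finType) (tau : T -> I) f : fin_measurable tau ->
  strongly_measurable P measurable f -> (\int[P]_x (rnorm (f x))%:E < +oo)%E ->
  exists V : I -> X, forall w : I -> R[i],
    is_bochner_integral P (fun x => w (tau x) *: f x) (\sum_i w i *: V i).
Proof.
move=> mt mf foo; have [s hs] := L1_approx_exists mf foo; have [ms s0] := hs.
have msw (w : I -> R[i]) n : simple_fun measurable (fun x => w (tau x) *: s n x).
  exact: (simple_fun_fin2 (fun i v => w i *: v) mt (ms n)).
have hsw (w : I -> R[i]) : L1_approx P (fun x => w (tau x) *: f x) (fun n x => w (tau x) *: s n x).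
  split=> //.
  pose C := \sum_i cabs (w i).
  have C0 : 0 <= C by apply: sumr_ge0 => i _; exact: cabs_ge0.
  have Cw i : cabs (w i) <= C.
    by rewrite /C (bigD1 i)//= lerDl sumr_ge0// => j _; exact: cabs_ge0.
  apply: (cvge0_sandwich (b := fun n => (C%:E * \int[P]_x (rnorm (f x - s n x))%:E)%E)).
    move=> n; apply/andP; split.
      by apply: integral_ge0 => x _; rewrite lee_fin rnorm_ge0.
    have [N' [g [u [mN' N0' fg mu ug]]]] := sm_versionP mf.
    have mgs : measurable_fun setT (fun x => rnorm (g x - s n x)).
      exact: measurable_rnorm_lim mu ug (ms n).
    rewrite (ge0_eq_integral_off mN' N0' (g := fun x => (rnorm (f x - s n x))%:E)
      (h := fun x => (rnorm (g x - s n x))%:E)); first last.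
    - by move=> x /fg ->.
    - exact/measurable_EFinP.
    - by move=> x; rewrite lee_fin rnorm_ge0.
    - by move=> x; rewrite lee_fin rnorm_ge0.
    rewrite -ge0_integralZl//; first last.
    - by move=> x _; rewrite lee_fin rnorm_ge0.
    - exact/measurable_EFinP.
    apply: (ge0_le_integral_off mN' N0').
    - by move=> x; rewrite lee_fin rnorm_ge0.
    - by move=> x; rewrite -EFinM lee_fin mulr_ge0// rnorm_ge0.
    - by apply: emeasurable_funM => //; exact/measurable_EFinP.
    - move=> x /fg <-; rewrite -EFinM lee_fin -scalerBr rnormZ.
      by apply: ler_wpM2r; rewrite ?rnorm_ge0.
  by rewrite -(mule0 C%:E); apply: cvgeZl.
have lim1 i := L1_approx_lim (strongly_measurableZ (fun j => (j == i)%:R) mt mf)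
   (hsw (fun j => (j == i)%:R)).
pose V i := projT1 (cid (lim1 i)).
have VP i : simple_integral P (fun x => ((tau x == i)%:R : R[i]) *: s n x) @[n --> \oo] --> V i.
  by rewrite /V; case: cid => v [].
exists V => w; have [v [hv sv]] := L1_approx_lim (strongly_measurableZ w mt mf) (hsw w).
suff sV : simple_integral P (fun x => w (tau x) *: s n x) @[n --> \oo] --> \sum_i w i *: V i.
  by rewrite -(cvg_unique (@norm_hausdorff _ _) sv sV).
rewrite (_ : (fun n => _) = (fun n => \sum_i w i *:
    simple_integral P (fun x => ((tau x == i)%:R : R[i]) *: s n x))).
  by apply: cvg_bigsum => i; apply: cvgZr; exact: VP.
apply/funext => n.
have msi i : simple_fun measurable (fun x => w i *: (((tau x == i)%:R : R[i]) *: s n x)).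
  exact: (simple_fun_fin2 (fun j v => w i *: (((j == i)%:R : R[i]) *: v)) mt (ms n)).
have [_ e] := simple_integral_sum P (index_enum I) msi.
transitivity (simple_integral P (fun x => \sum_i w i *: (((tau x == i)%:R : R[i]) *: s n x))).
  congr (simple_integral P _); apply/funext => x.
  rewrite (bigD1 (tau x))//= eqxx scale1r big1 ?addr0// => i ni.
  by rewrite eq_sym (negbTE ni) scale0r scaler0.
rewrite e; apply: eq_bigr => i _; rewrite simple_integralZ//.
exact: (msw (fun j => (j == i)%:R)).
Qed.

Variable p : R.
Hypothesis p1 : 1 < p.
Let p0 : 0 < p. Proof. exact: lt_trans p1. Qed.
Let pn0 : p != 0. Proof. by rewrite gt_eqF. Qed.

Lemma Lp_norm_powE f : (Lp_norm P p f `^ p = \int[P]_x (rnorm (f x) `^ p)%:E)%E.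
Proof.
rewrite /Lp_norm (poweR_Lnorm _ _ pn0); apply: eq_integral => x _.
by rewrite gee0_abs ?lee_fin ?rnorm_ge0// poweR_EFin.
Qed.

Lemma Lp_norm_ge0 f : (0 <= Lp_norm P p f)%E.
Proof. exact: Lnorm_ge0. Qed.

Lemma Lp_norm_fin (I : finType) (tau : T -> I) (phi : I -> X) : fin_measurable tau ->
  Lp_norm P p (phi \o tau) = ((\sum_i fp P tau i * rnorm (phi i) `^ p) `^ p^-1)%:E.
Proof.
move=> mt; rewrite /Lp_norm unlock.
rewrite (eq_integral (fun x => (rnorm (phi (tau x)) `^ p)%:E)); last first.
  by move=> x _; rewrite gee0_abs ?lee_fin ?rnorm_ge0// poweR_EFin.
rewrite (integral_fin P (h := fun i => rnorm (phi i) `^ p) mt); last first.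
  by move=> i; exact: powR_ge0.
rewrite (eq_bigr (fun i => (fp P tau i * rnorm (phi i) `^ p)%:E)).
  by rewrite sumEFin poweR_EFin.
by move=> i _; rewrite fpE// -EFinM mulrC.
Qed.

Lemma Lp_pow_fin f : in_Lp P measurable p f ->
  (\int[P]_x (rnorm (f x) `^ p)%:E < +oo)%E.
Proof. by move=> [mf foo]; rewrite -Lp_norm_powE; exact: poweR_lty. Qed.

Lemma measurable_powR_comp (h : T -> R) (q : R) : measurable_fun setT h ->
  measurable_fun setT (fun x => h x `^ q).
Proof. by move=> mh; exact: (measurableT_comp (measurable_powR q)). Qed.

Lemma hoelder_quotient (v a w r : R) : r * p = p - 1 -> 0 <= v -> 0 <= a -> 0 <= w ->
  v <= a `^ p^-1 * w `^ r -> v `^ p / w `^ (p - 1) <= a.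
Proof.
move=> rp v0 a0 w0 h; have p10 : p - 1 != 0 by rewrite gt_eqF// subr_gt0.
have [->|wn0] := eqVneq w 0; first by rewrite powR0// invr0 mulr0.
rewrite ler_pdivrMr ?powR_gt0 ?lt_neqAle ?w0 ?andbT 1?eq_sym//.
apply: (@le_trans _ _ ((a `^ p^-1 * w `^ r) `^ p)).
  by apply: ge0_ler_powR; rewrite ?nnegrE ?(ltW p0)// mulr_ge0// powR_ge0.
by rewrite powRM ?powR_ge0// -!powRrM mulVf// powRr1// rp.
Qed.

(** Hölder on each cell. The summand is the mass of the cell times the p-th power of the norm of the
    mean of [f] there, so this is L^p contractivity of conditional expectation. A cell of mass 0
    contributes 0, as the inverse of 0 is 0. *)
Lemma bochner_weights_Lp (I : finType) (tau : T -> I) f : fin_measurable tau ->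
  in_Lp P measurable p f ->
  exists V : I -> X,
    (forall w : I -> R[i],
      is_bochner_integral P (fun x => w (tau x) *: f x) (\sum_i w i *: V i)) /\
    \sum_i rnorm (V i) `^ p / fp P tau i `^ (p - 1) <= fine (Lp_norm P p f) `^ p.
Proof.
move=> mt Lf; have mf := Lf.1.
have [N [h [mN N0 mh h0 fh]]] := sm_rnorm mf.
have mhp : measurable_fun setT (fun x => (h x `^ p)%:E).
  by apply/measurable_EFinP; exact: measurable_powR_comp.
have mhE : measurable_fun setT (fun x => (h x)%:E) by exact/measurable_EFinP.
have hpE : (\int[P]_x (rnorm (f x) `^ p)%:E = \int[P]_x (h x `^ p)%:E)%E.
  apply: (ge0_eq_integral_off mN N0) => //.
  - by move=> x; rewrite lee_fin powR_ge0.
  - by move=> x; rewrite lee_fin powR_ge0.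
  - by move=> x /fh ->.
have hpoo : (\int[P]_x (h x `^ p)%:E < +oo)%E by rewrite -hpE; exact: Lp_pow_fin.
have foo : (\int[P]_x (rnorm (f x))%:E < +oo)%E.
  apply: (@le_lt_trans _ _ (\int[P]_x (1 + (h x `^ p)%:E))%E).
    apply: (ge0_le_integral_off mN N0).
    - by move=> x; rewrite lee_fin rnorm_ge0.
    - by move=> x; rewrite -EFinD lee_fin addr_ge0// powR_ge0.
    - by apply: emeasurable_funD.
    - move=> x /fh ->; rewrite -EFinD lee_fin.
      have [h1|h1] := leP (h x) 1; first by rewrite (le_trans h1)// lerDl powR_ge0.
      apply: (@le_trans _ _ (h x `^ p)); last by rewrite lerDr.
      by rewrite -{1}(powRr1 (h0 x)) ler_powR ?ltW.
  rewrite ge0_integralD//; last by move=> x _; rewrite lee_fin powR_ge0.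
  rewrite integral_cst// mul1e; apply: lte_add_pinfty => //.
  by rewrite (le_lt_trans (probability_le1 _ _))// ltry.
have [V hV] := bochner_weights mt mf foo.
exists V; split => //.
pose A i := fine (\int[P]_x (((tau x == i)%:R * h x `^ p)%R)%:E).
have m1 i : measurable_fun setT (fun x => ((tau x == i)%:R : R)).
  rewrite (_ : (fun x => _) = \1_(tau @^-1` [set i])); first exact: measurable_indic.
  apply/funext => x; rewrite indicE; congr (_%:R).
  by case: eqP => [e|e]; [rewrite mem_set|rewrite memNset].
have m2 i : measurable_fun setT (fun x => ((tau x == i)%:R * h x)).
  exact: measurable_funM.
have AE i : (\int[P]_x (((tau x == i)%:R * h x `^ p)%R)%:E = (A i)%:E)%E.
  rewrite fineK// ge0_fin_numE; last first.
    by apply: integral_ge0 => x _; rewrite lee_fin mulr_ge0// powR_ge0.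
  apply: le_lt_trans hpoo; apply: ge0_le_integral_nomeas => x; rewrite lee_fin.
    by rewrite mulr_ge0// powR_ge0.
  by case: eqP => _; rewrite ?mul1r ?mul0r ?powR_ge0.
have A0 i : 0 <= A i.
  by apply: fine_ge0; apply: integral_ge0 => x _; rewrite lee_fin mulr_ge0// powR_ge0.
have key i : rnorm (V i) `^ p / fp P tau i `^ (p - 1) <= A i.
  have Vi : is_bochner_integral P (fun x => ((tau x == i)%:R : R[i]) *: f x) (V i).
    by have := hV (fun j => (j == i)%:R); rewrite sum_deltaZ.
  pose q := p / (p - 1).
  have p10 : 0 < p - 1 by rewrite subr_gt0.
  have p1n0 : p - 1 != 0 by rewrite gt_eqF.
  have q0 : 0 < q by rewrite divr_gt0.
  have pq : p^-1 + q^-1 = 1 by rewrite /q invf_div; field.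
  have b1 : (((rnorm (V i))%:E : \bar R) <= (A i `^ p^-1 * fp P tau i `^ q^-1)%:E)%E.
    apply: le_trans (bochner_norm Vi) _.
    apply: (@le_trans _ _ (\int[P]_x ((tau x == i)%:R * h x * (tau x == i)%:R)%:E)%E).
      apply: (ge0_le_integral_off mN N0).
      - by move=> x; rewrite lee_fin rnorm_ge0.
      - by move=> x; rewrite lee_fin !mulr_ge0.
      - by apply/measurable_EFinP; exact: measurable_funM.
      - move=> x /fh fx; rewrite lee_fin; case: eqP => _.
          by rewrite scale1r mulr1 mul1r fx.
        by rewrite scale0r rnorm0 mulr0.
    have := hoelder P (m2 i) (m1 i) p0 q0 pq.
    rewrite Lnorm1 (eq_integral (fun x => ((tau x == i)%:R * h x * (tau x == i)%:R)%:E)); last first.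
      by move=> x _; rewrite /= ger0_norm// !mulr_ge0.
    move=> /le_trans; apply.
    rewrite unlock.
    rewrite (eq_integral (fun x => (((tau x == i)%:R * h x `^ p)%R)%:E)); last first.
      move=> x _; rewrite gee0_abs ?lee_fin ?mulr_ge0//= powRM//.
      by case: eqP => _; rewrite ?powR1 ?powR0.
    rewrite AE poweR_EFin.
    rewrite (eq_integral (fun x => (\1_(tau @^-1` [set i]) x)%:E)); last first.
      move=> x _; rewrite gee0_abs ?lee_fin//= indicE.
      case: eqP => [e|e]; first by rewrite mem_set// powR1.
      by rewrite memNset// powR0// gt_eqF.
    have -> : (\int[P]_x (\1_(tau @^-1` [set i]) x)%:E = (fp P tau i)%:E)%E.
      by rewrite integral_indic// setIT; exact: fpE.
    by rewrite poweR_EFin -EFinM.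
  rewrite lee_fin in b1; apply: (hoelder_quotient _ (rnorm_ge0 _) (A0 i) (fp_ge0 P tau i) b1).
  by rewrite /q invf_div; field.
apply: (@le_trans _ _ (\sum_i A i)); first by apply: ler_sum => i _; exact: key.
have : ((\sum_i A i)%:E = \int[P]_x (h x `^ p)%:E)%E.
  rewrite -sumEFin -(eq_bigr _ (fun i _ => AE i)) -ge0_integral_sum//.
  - apply: eq_integral => x _; rewrite sumEFin; congr (_%:E).
    rewrite (bigD1 (tau x))//= eqxx mul1r big1 ?addr0// => i ni.
    by rewrite eq_sym (negbTE ni) mul0r.
  - move=> i; apply/measurable_EFinP; apply: measurable_funM => //.
    exact: measurable_powR_comp.
  - by move=> i x _; rewrite lee_fin mulr_ge0// powR_ge0.
rewrite -hpE -Lp_norm_powE.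
have Ln : Lp_norm P p f \is a fin_num by rewrite ge0_fin_numE ?Lp_norm_ge0//; exact: Lf.2.
by rewrite -(fineK Ln) poweR_EFin => -[->].
Qed.

End bochner_Lp.

(** * Martingale transforms on finite probability spaces *)

Section uniform.
Context (R : realType) (n : nat).

(** Uniform probability on 0, ..., n. The carrier is [nat] because all its subsets are measurable,
    so a finite set can be transported to it by any enumeration. *)
Definition unif : set nat -> \bar R :=
  msum (fun k => mscale (n.+1%:R^-1 : R)%:nng \d_k) n.+1.

HB.instance Definition _ := Measure.on unif.

Let unif_setT : unif setT = 1%E.
Proof.
rewrite /unif /msum /=.
under eq_bigr do rewrite /mscale /= diracT mule1.
rewrite sumEFin sumr_const card_ord -mulr_natr mulVf//.
Qed.

HB.instance Definition _ := @Measure_isProbability.Build _ _ R unif unif_setT.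

Lemma unifE (A : set nat) : unif A = (n.+1%:R^-1 * (\sum_(k < n.+1) ((k : nat) \in A)%:R))%:E.
Proof.
rewrite /unif /msum /= mulr_sumr -sumEFin; apply: eq_bigr => k _.
by rewrite /mscale /= diracE EFinM.
Qed.

End uniform.

Section fin_umd.
Context (R : realType) (X : completeNormedModType R[i]) (p : R) (b : R).
Hypothesis p1 : 1 < p.
Hypothesis hb : UMD_bound X p b.

(** Vanishing conditional expectation given the classes of [e], in a form that is easy to witness:
    permutations preserving every class, along which the values of [D] add up to 0. *)
Definition cancels (T : finType) (e : rel T) (D : T -> X) : Prop :=
  exists (I : finType) (sigma : I -> T -> T), [/\ (0 < #|I|)%N,
    forall i, injective (sigma i), forall i t, e t (sigma i t) &
    forall t, \sum_i D (sigma i t) = 0].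

Lemma cancels_sum (T : finType) (e : rel T) (D : T -> X) (A : pred T) :
  cancels e D -> (forall s t, e s t -> A s = A t) ->
  \sum_(t | A t) D t = 0.
Proof.
move=> [I [sigma [I0 isig esig s0]]] eA; apply/eqP.
have : (#|I|%:R : R[i]) *: (\sum_(t | A t) D t) = 0.
  transitivity (\sum_(i : I) \sum_(t | A t) D (sigma i t)).
    rewrite scaler_nat -sumr_const; apply: eq_bigr => i _.
    rewrite [LHS](reindex_inj (isig i)) /=; apply: eq_bigl => t.
    by rewrite -(eA _ _ (esig i t)).
  by rewrite exchange_big big1.
move/eqP; rewrite scaler_eq0 => /orP[|//].
by rewrite pnatr_eq0 -leqn0 leqNgt I0.
Qed.

(** A filtration of a finite uniform space is a sequence of finer and finer equivalence relations:
    the k-th sigma-algebra consists of the sets saturated under [e k]. An enumeration of [T] carries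
    this to [unif], where the hypothesis on [X] applies. *)
Lemma fin_umd (T : finType) (t0 : T) (n : nat) (e : nat -> rel T)
    (D : nat -> T -> X) (theta : nat -> R) :
  (forall k, equivalence_rel (e k)) -> (forall k s t, e k.+1 s t -> e k s t) ->
  (forall k s t, (k < n)%N -> e k.+1 s t -> D k s = D k t) ->
  (forall k, (k < n)%N -> cancels (e k) (D k)) ->
  (forall k, theta k = 1 \/ theta k = -1) ->
  lpn p (fun t => \sum_(k < n) (theta k)%:C *: D k t) <=
  b * lpn p (fun t => \sum_(k < n) D k t).
Proof.
move=> eqe ne De cD ht.
have erefl_ k t : e k t t by case: (eqe k t t t).
have esymk k s t : e k s t -> e k t s.
  by move=> st; rewrite -(eqe k s t s).2//.
have etrans k s t u : e k s t -> e k t u -> e k s u.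
  by move=> st tu; rewrite (eqe k s t u).2.
have T0 : (0 < #|T|)%N by apply/card_gt0P; exists t0.
pose N := #|T|.-1; have NE : N.+1 = #|T| by rewrite prednK.
(* Beyond the enumeration [dec] returns [t0]; those integers carry no mass. *)
pose dec (j : nat) := nth t0 (enum T) j.
pose P := [the probability _ R of unif R N].
have mdec : fin_measurable dec by [].
have decK t : dec (index t (enum T)) = t by rewrite /dec nth_index// mem_enum.
have fpdec t : fp P dec t = N.+1%:R^-1.
  rewrite /fp /= unifE /= (bigD1 (Ordinal (_ : index t (enum T) < N.+1)%N))//=.
    by rewrite NE cardE index_mem mem_enum.
  move=> h; rewrite mem_set//= big1 ?addr0 ?mulr1// => k nk.
  rewrite memNset//= => kt; move/negP: nk; apply; apply/eqP/val_inj => /=.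
  by rewrite -kt /dec index_uniq ?enum_uniq// -cardE -NE.
pose F k : set (set nat) := [set A | forall i j, e k (dec i) (dec j) -> A i -> A j].
(* In [martingale_difference] the differences are numbered from 1, here from 0. *)
pose D' k j := D k.-1 (dec j).
pose c := (N.+1%:R^-1 : R) `^ p^-1.
have c0 : 0 < c by rewrite powR_gt0// invr_gt0.
have LE (phi : T -> X) : Lp_norm P p (phi \o dec) = (c * lpn p phi)%:E.
  rewrite (Lp_norm_fin P p _ mdec); congr (_%:E).
  under eq_bigr do rewrite fpdec.
  rewrite -mulr_sumr powRM//.
  by apply: sumr_ge0 => t _; exact: powR_ge0.
have Fconst k : simple_fun (F k) (fun _ : nat => 0 : X).
  split; first by apply: (@sub_finite_set _ _ [set 0]) => // y [].
  by move=> v i j _ /=.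
have intE (phi : T -> X) : \sum_t phi t = 0 -> bochner_integral P (phi \o dec) = 0.
  move=> h; rewrite (bochner_integralE (is_bochner_simple P (fin_simple_fun phi mdec))).
  rewrite simple_integral_fin//; under eq_bigr do rewrite fpdec.
  by rewrite -scaler_sumr h scaler0.
have hF : filtration F.
  split => [k|k A _ //|k A hA i j /ne]; last exact: hA.
  split => [i j //|A hA i j eij [_ nA]|A hA i j eij [q _ Aq]].
  - by split => // Aj; apply: nA; apply: (hA j) => //; exact: esymk.
  - by exists q => //; exact: hA Aq.
have hM : martingale_difference P F p n D'.
  move=> k /andP[k1 kn].
  have kn' : (k.-1 < n)%N by rewrite prednK.
  split.
    split; last by rewrite (LE (D k.-1)) ltry.
    apply: simple_strongly_measurable; split.
      exact: (fin_simple_fun (D k.-1) mdec).1.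
    move=> v i j eij /= <-; rewrite /D'; apply: esym.
    by apply: De => //; rewrite prednK.
  split.
  - by eexists; apply: (is_bochner_simple P (fin_simple_fun (D k.-1) mdec)).
  - exact: simple_strongly_measurable.
  - eexists; exact: (is_bochner_simple P (fin_simple_fun (fun=> 0) mdec)).
  move=> A FA; pose B t := index t (enum T) \in A.
  have BA j : (j \in A) = B (dec j).
    apply/idP/idP => [/set_mem Aj|/set_mem Bj]; apply/mem_set.
      by apply: FA Aj; rewrite decK.
    by apply: FA Bj; rewrite decK.
  rewrite /bochner_integral_on.
  transitivity (0 : X).
    rewrite -[RHS](intE (fun=> 0)); last by rewrite big1.
    by congr (bochner_integral P _); apply/funext => x /=; case: ifP.
  apply: esym; rewrite -[RHS](intE (fun t => if B t then D k.-1 t else 0)).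
    by congr (bochner_integral P _); apply/funext => x /=; rewrite BA.
  rewrite -big_mkcond /=; apply: (cancels_sum (cD _ kn')) => s t est.
  apply/idP/idP => /set_mem h; apply/mem_set; apply: FA h; rewrite !decK//.
  exact: esymk.
have := hb.2 _ _ P F n D' (fun k => theta k.-1) hF hM (fun k => ht k.-1).
have e1 : (fun x => (\sum_(1 <= k < n.+1) (theta k.-1)%:C *: D' k x)) =
    (fun t => \sum_(k < n) (theta k)%:C *: D k t) \o dec.
  by apply/funext => x; rewrite /= big_add1 /= big_mkord.
have e2 : (fun x => (\sum_(1 <= k < n.+1) D' k x)) = (fun t => \sum_(k < n) D k t) \o dec.
  by apply/funext => x; rewrite /= big_add1 /= big_mkord.
rewrite e1 e2 !LE -EFinM lee_fin mulrCA.
by rewrite ler_pM2l.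
Qed.

End fin_umd.

(** * Decoupling *)

Section decoupling.
Context (R : realType) (X : completeNormedModType R[i]) (p : R) (b : R).
Hypothesis p1 : 1 < p.
Hypothesis hb : UMD_bound X p b.

(** Signs square to 1: the signed differences are again martingale differences, and the same
    transform turns them back. *)
Lemma fin_umd_rev (T : finType) (t0 : T) (n : nat) (e : nat -> rel T)
    (D : nat -> T -> X) (theta : nat -> R) :
  (forall k, equivalence_rel (e k)) -> (forall k s t, e k.+1 s t -> e k s t) ->
  (forall k s t, (k < n)%N -> e k.+1 s t -> D k s = D k t) ->
  (forall k, (k < n)%N -> cancels (e k) (D k)) ->
  (forall k, theta k = 1 \/ theta k = -1) ->
  lpn p (fun t => \sum_(k < n) D k t) <=
  b * lpn p (fun t => \sum_(k < n) (theta k)%:C *: D k t).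
Proof.
move=> eqe ne De cD ht.
have := @fin_umd _ _ _ _ hb T t0 n e (fun k t => (theta k)%:C *: D k t) theta eqe ne.
rewrite (_ : lpn p _ = lpn p (fun t => \sum_(k < n) D k t)); last first.
  apply: eq_lpn => t; apply: eq_bigr => k _; rewrite scalerA -rmorphM /=.
  by case: (ht k) => ->; rewrite ?mulrNN mulr1 scale1r.
apply => //.
- by move=> k s t kn /(De _ _ _ kn) ->.
- move=> k /cD[I [sigma [I0 isig esig s0]]]; exists I, sigma; split => // t.
  by rewrite -scaler_sumr s0 scaler0.
Qed.

Context (A : finZmodType) (K : nat).
Local Notation V := {ffun 'I_K -> A}.

Definition repl (x y : V) (k : nat) : V := [ffun l : 'I_K => if l == k :> nat then y l else x l].
Definition shift (x : V) (k : nat) (c : A) : V :=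
  [ffun l : 'I_K => if l == k :> nat then x l + c else x l].

Lemma shift_inj k c : injective (fun x => shift x k c).
Proof.
move=> x y /ffunP h; apply/ffunP => l; have := h l; rewrite !ffunE.
by case: ifP => // _ /addIr.
Qed.

Context (D : nat -> V -> X).
Hypothesis hD1 : forall k (x x' : V), (k < K)%N ->
  (forall l : 'I_K, (l <= k)%N -> x l = x' l) -> D k x = D k x'.
Hypothesis hD2 : forall k x, (k < K)%N -> \sum_c D k (shift x k c) = 0.

(** What is known at time [j]. At time 2k: the pairs (x_l, y_l) with l < k. At time 2k+1: in
    addition the unordered pair {x_k, y_k}, without telling which entry belongs to which copy. *)
Let key (j : nat) (t : V * V) : {ffun 'I_K -> option ((A * A) + {set A})} :=
  [ffun l : 'I_K => if (l < j./2)%N then Some (inl (t.1 l, t.2 l))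
    else if odd j && (l == j./2 :> nat) then Some (inr [set t.1 l; t.2 l]%SET) else None].

Let e j : rel (V * V) := fun s t => key j s == key j t.

Let half_C : R[i] := (2^-1 : R)%:C.
(** [u] and [v] are the symmetric and antisymmetric parts under exchange of x_k and y_k. The
    unordered pair determines [u], and the exchange changes the sign of [v], so u_0, v_0, u_1, v_1,
    ... are martingale differences for [key]. Their sum [u + v] is [D k] at x, and [u - v] is [D k]
    with x_k replaced by y_k. *)
Let u k (t : V * V) := half_C *: (D k t.1 + D k (repl t.1 t.2 k)).
Let v k (t : V * V) := half_C *: (D k t.1 - D k (repl t.1 t.2 k)).
Let d j (t : V * V) := if odd j then v j./2 t else u j./2 t.

Let uv k t : u k t + v k t = D k t.1.
Proof.
rewrite /u /v -scalerDr addrACA subrr addr0 -mulr2n -scaler_nat scalerA.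
by rewrite (_ : half_C * 2 = 1) ?scale1r// /half_C -[2]/(2%:R) -(rmorph_nat (real_complex R)) -rmorphM/= mulVf.
Qed.

Let umv k t : u k t - v k t = D k (repl t.1 t.2 k).
Proof.
rewrite /u /v -scalerBr opprB addrACA addrC addrA subrK -mulr2n -scaler_nat scalerA.
by rewrite (_ : half_C * 2 = 1) ?scale1r// /half_C -[2]/(2%:R) -(rmorph_nat (real_complex R)) -rmorphM/= mulVf.
Qed.

Let e_eq j : equivalence_rel (e j).
Proof. by move=> s t w; split; [exact: eqxx|move/eqP; rewrite /e => ->]. Qed.

Let keyP j s t : key j s = key j t -> forall l : 'I_K, (l < j./2)%N ->
  s.1 l = t.1 l /\ s.2 l = t.2 l.
Proof. by move=> /ffunP h l lj; have := h l; rewrite !ffunE lj => -[-> ->]. Qed.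

Let set2P (a a' c c' : A) : [set a; a']%SET = [set c; c']%SET ->
  (a = c /\ a' = c') \/ (a = c' /\ a' = c).
Proof.
move=> /setP h.
have ha := h a; have ha' := h a'; have hc := h c; have hc' := h c'.
rewrite !inE !eqxx ?orbT /= in ha ha' hc hc'.
move/esym: ha => /orP[]/eqP ea; subst a; move/esym: ha' => /orP[]/eqP ea'; subst a'.
- by left; split => //; move: hc'; rewrite !orbb => /eqP.
- by left.
- by right.
- by right; split => //; move: hc; rewrite !orbb => /eqP.
Qed.

Let e_ne j s t : e j.+1 s t -> e j s t.
Proof.
have hS : j.+1./2 = (odd j + j./2)%N := uphalf_half j.
rewrite /e => /eqP h; apply/eqP/ffunP => l; rewrite !ffunE.
case: (ltnP l j./2) => lj.
  have := keyP h (l := l); rewrite hS => /(_ (leq_trans lj (leq_addl _ _))).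
  by move=> [-> ->].
case: ifP => // /andP[oj /eqP lE].
have := keyP h (l := l); rewrite hS oj lE add1n ltnS leqnn.
by move=> /(_ isT)[-> ->].
Qed.

Let d_inv j s t : (j < K.*2)%N -> e j.+1 s t -> d j s = d j t.
Proof.
move=> jK /eqP h; rewrite /d.
have kK : (j./2 < K)%N by rewrite ltn_half_double.
have hS : j.+1./2 = (odd j + j./2)%N := uphalf_half j.
have hk := keyP h; rewrite hS in hk.
have {}h := h; case: ifP => oj; rewrite oj ?add1n ?add0n in hk.
  congr (_ *: (_ - _)); apply: hD1 => // l lj.
    by case: (hk l).
  by case: (hk l) => //; rewrite !ffunE => -> ->.
rewrite /u; congr (_ *: _).
have := congr1 (fun f : {ffun _ -> _} => f (Ordinal kK)) h.
rewrite !ffunE hS /= oj add0n ltnn eqxx /= => -[/set2P[[h1 h2]|[h1 h2]]].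
  congr (_ + _); apply: hD1 => // l; rewrite leq_eqVlt => /orP[/eqP lE|lj].
  - by rewrite (_ : l = Ordinal kK)//; exact/val_inj.
  - by case: (hk l).
  - by rewrite !ffunE lE eqxx (_ : l = Ordinal kK)//; exact/val_inj.
  - by rewrite !ffunE ltn_eqF//; case: (hk l).
rewrite addrC; congr (_ + _); apply: hD1 => // l; rewrite leq_eqVlt => /orP[/eqP lE|lj].
- by rewrite !ffunE lE eqxx (_ : l = Ordinal kK)//; exact/val_inj.
- by rewrite !ffunE ltn_eqF//; case: (hk l).
- by rewrite !ffunE lE eqxx (_ : l = Ordinal kK)//; exact/val_inj.
- by rewrite !ffunE ltn_eqF//; case: (hk l).
Qed.

Let d_cancels j : (j < K.*2)%N -> cancels (e j) (d j).
Proof.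
move=> jK; have kK : (j./2 < K)%N by rewrite ltn_half_double.
rewrite /d; case: (boolP (odd j)) => oj.
  (* Exchanging the k-th coordinates keeps the unordered pair and negates [v]. *)
  exists bool, (fun c t => if c then (repl t.1 t.2 j./2, repl t.2 t.1 j./2) else t).
  have rr (x y : V) : repl (repl x y j./2) (repl y x j./2) j./2 = x.
    by apply/ffunP => l; rewrite !ffunE; case: ifP => // ->.
  split.
  - by rewrite card_bool.
  - case => // -[x y] [x' y'] /= [] h1 h2.
    by rewrite -(rr x y) h1 h2 rr -{1}(rr y x) h1 h2 rr.
  - case => [] [x y]; last exact: eqxx.
    apply/eqP/ffunP => l; rewrite !ffunE /= oj /=.
    case: ltnP => lj; first by rewrite ltn_eqF.
    by case: eqP => // _; rewrite finset.setUC.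
  - move=> [x y]; rewrite big_bool /= /v /= rr -scalerDr.
    by rewrite addrA subrK subrr scaler0.
(* Both k-th coordinates are translated independently; each of the two terms of [u] then sums to
   0. *)
exists (A * A)%type, (fun c t => (shift t.1 j./2 c.1, shift t.2 j./2 c.2)); split.
- by rewrite card_prod muln_gt0; apply/andP; split; apply/card_gt0P; exists 0.
- by move=> c [x y] [x' y'] /= [] /shift_inj -> /shift_inj ->.
- move=> [c c'] [x y]; apply/eqP/ffunP => l; rewrite !ffunE /= (negbTE oj) /=.
  by case: ltnP => // lj; rewrite ltn_eqF.
- move=> [x y]; rewrite /u -scaler_sumr big_split /=.
  rewrite !sum_pair /= big1 ?add0r; last by move=> c' _; exact: hD2.
  rewrite exchange_big /= big1 ?scaler0// => c _.
  rewrite -[RHS](@hD2 j./2 (repl x y j./2) kK); apply: eq_bigr => c' _.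
  by apply: hD1 => // l lj; rewrite !ffunE; case: (nat_of_ord l == j./2).
Qed.

Let sum_double (F : nat -> X) : \sum_(j < K.*2) F j = \sum_(k < K) (F k.*2 + F k.*2.+1).
Proof.
elim: (K) => [|n IH]; first by rewrite !big_ord0.
by rewrite doubleS !big_ord_recr /= IH addrA.
Qed.

Context (eps : nat -> R).
Hypothesis heps : forall k, eps k = 1 \/ eps k = -1.

(** The sign is opposite on [u] and on [v], so the transform sends the sum of the [D k] at x to the
    signed sum of the decoupled terms. *)
Let theta j := if odd j then - eps j./2 else eps j./2.
Let htheta j : theta j = 1 \/ theta j = -1.
Proof.
by rewrite /theta; case: (heps j./2) => ->; case: (odd j); rewrite ?opprK; tauto.
Qed.

Let sum_theta t : \sum_(j < K.*2) (theta j)%:C *: d j t =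
  \sum_(k < K) (eps k)%:C *: D k (repl t.1 t.2 k).
Proof.
rewrite (sum_double (fun j => (theta j)%:C *: d j t)); apply: eq_bigr => k _.
rewrite /theta /d /= !odd_double /= uphalf_double doubleK.
by rewrite rmorphN scaleNr -scalerBr umv.
Qed.

Let sum_d t : \sum_(j < K.*2) d j t = \sum_(k < K) D k t.1.
Proof.
rewrite (sum_double (d^~ t)); apply: eq_bigr => k _.
by rewrite /d /= !odd_double /= uphalf_double doubleK uv.
Qed.

Let C : R := #|{: V}|%:R `^ p^-1.

Lemma decouple_le :
  lpn p (fun t : V * V => \sum_(k < K) (eps k)%:C *: D k (repl t.1 t.2 k)) <=
  b * (C * lpn p (fun x => \sum_(k < K) D k x)).
Proof.
rewrite -lpn_fst//.
have := @fin_umd _ _ _ _ hb {: V * V} (0 : V, 0 : V) K.*2 e d theta e_eq e_ne d_inv d_cancels htheta.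
rewrite (eq_lpn _ sum_theta) => /le_trans; apply.
by rewrite (eq_lpn _ sum_d).
Qed.

Lemma recouple_le :
  C * lpn p (fun x => \sum_(k < K) D k x) <=
  b * lpn p (fun t : V * V => \sum_(k < K) (eps k)%:C *: D k (repl t.1 t.2 k)).
Proof.
rewrite -lpn_fst//.
have := @fin_umd_rev {: V * V} (0 : V, 0 : V) K.*2 e d theta e_eq e_ne d_inv d_cancels htheta.
by rewrite (eq_lpn _ sum_theta) (eq_lpn _ sum_d).
Qed.

End decoupling.

(** * Dyadic shifts *)

Lemma sum_mul_nat (V : nmodType) (m q : nat) (f : nat -> V) :
  \sum_(u < m * q) f u = \sum_(i < m) \sum_(u < q) f (i * q + u)%N.
Proof.
elim: m => [|m IH]; first by rewrite mul0n !big_ord0.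
rewrite mulSnr big_split_ord /= IH big_ord_recr /=; congr (_ + _).
Qed.

Section flip.
Variable B : nat.
Hypothesis B0 : (0 < B)%N.

(** Exchanges the two halves of every block of length [2 * B]; this is the permutation that
    witnesses [cancels] at that scale. *)
Definition flip (u : nat) : nat := if odd (u %/ B) then (u - B)%N else (u + B)%N.

Lemma flip_div u : (flip u %/ B)%N = if odd (u %/ B) then (u %/ B).-1 else (u %/ B).+1.
Proof.
rewrite /flip; case: ifP => o.
  by rewrite -{1}(mul1n B) divnBMl subn1.
by rewrite -{1}(mul1n B) divnDMl// addn1.
Qed.

Lemma flip_odd u : odd (flip u %/ B) = ~~ odd (u %/ B).
Proof.
rewrite flip_div; case: ifP => o /=; last by rewrite o.
by move: o; case: (u %/ B)%N => //= k /negbTE.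
Qed.

Lemma flip_half u : (flip u %/ (B * 2) = u %/ (B * 2))%N.
Proof.
rewrite !divnMA flip_div !divn2; case: ifP => o.
  by case: (u %/ B)%N o => //= k ok; rewrite uphalf_half (negbTE ok).
by rewrite /= uphalf_half o.
Qed.

Lemma flip_div_half u : ((flip u %/ B)./2 = (u %/ B)./2)%N.
Proof. by rewrite -!divn2 -!divnMA flip_half. Qed.

Lemma flipK : involutive flip.
Proof.
move=> u; have o := flip_odd u; rewrite {1}/flip o /flip.
case: (boolP (odd (u %/ B))) => ou /=; last by rewrite addnK.
rewrite subnK// leqNgt; apply/negP => uB.
by rewrite divn_small in ou.
Qed.

Lemma flip_lt L u : ((B * 2) %| L)%N -> (u < L)%N -> (flip u < L)%N.
Proof.
move=> /dvdnP[c ->]; rewrite -!ltn_divLR ?muln_gt0 ?B0//.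
by rewrite flip_half.
Qed.

End flip.

Section signs.
Variable R : realType.

Definition sgb (c : bool) : R := if c then -1 else 1.

Lemma sgb2 c : sgb c = 1 \/ sgb c = -1.
Proof. by case: c; [right|left]. Qed.

Lemma sgb_addb c c' : sgb (c (+) c') = sgb c * sgb c'.
Proof. by case: c c' => [] []; rewrite /sgb /=; lra. Qed.

End signs.

Section blocks.
Variables (V : nmodType) (F : nat -> V).

Definition blk (B w : nat) : V := \sum_(v < B) F (B * w + v)%N.

Lemma blk2 B a : blk (B * 2) a = blk B (a.*2) + blk B (a.*2.+1).
Proof.
rewrite /blk muln2 -addnn big_split_ord /=; congr (_ + _); apply: eq_bigr => v _.
  by rewrite addnn -muln2 -mulnA mul2n.
by congr (F _); rewrite addnn -!muln2; lia.
Qed.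

End blocks.

Section dyadic.
Context (R : realType) (X : completeNormedModType R[i]) (p : R) (b : R).
Hypothesis p1 : 1 < p.
Hypothesis hb : UMD_bound X p b.
Let b0 : 0 <= b. Proof. exact: hb.1. Qed.

Context (q n : nat).
Hypothesis q0 : (0 < q)%N.
Let L := (q * 2 ^ n.+1)%N.
Local Notation T := 'I_L.

Let Qp l : (0 < q * 2 ^ l)%N. Proof. by rewrite muln_gt0 q0 expn_gt0. Qed.

Variable F : nat -> X.

(* Martingale difference of [F] between blocks of length [4 * Q] and [2 * Q],
   where [Q = q * 2 ^ l], and its image under the dyadic shift. *)
Definition mdiff (l u : nat) : X :=
  let B := (q * 2 ^ l.+1)%N in let w := (u %/ B)%N in
  (sgb R (odd w) * (B * 2)%:R^-1)%:C *: (blk F B (w./2.*2) - blk F B (w./2.*2.+1)).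

Definition mshift (l u : nat) : X := (sgb R (odd (u %/ (q * 2 ^ l))))%:C *: mdiff l u.

Lemma mdiff_w l u u' : (u %/ (q * 2 ^ l.+1) = u' %/ (q * 2 ^ l.+1))%N ->
  mdiff l u = mdiff l u'.
Proof. by rewrite /mdiff => ->. Qed.

Lemma mdiff_flip l u : mdiff l (flip (q * 2 ^ l.+1) u) = - mdiff l u.
Proof.
rewrite /mdiff flip_odd// flip_div_half//.
by rewrite -scaleNr -rmorphN /=; congr (_%:C *: _); case: (odd _); rewrite /sgb /=; ring.
Qed.

Lemma mshift_flip l u : mshift l (flip (q * 2 ^ l) u) = - mshift l u.
Proof.
rewrite /mshift flip_odd// (mdiff_w (u' := u)).
  by rewrite -scaleNr -rmorphN /=; congr (_%:C *: _); case: (odd _); rewrite /sgb /= ?opprK.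
by have := flip_half (Qp l) u; rewrite -mulnA -expnSr.
Qed.

Definition avgb (B u : nat) : X := (B%:R^-1)%:C *: blk F B (u %/ B).

Lemma mdiff_avgb l u : mdiff l u = avgb (q * 2 ^ l.+1) u - avgb (q * 2 ^ l.+2) u.
Proof.
have -> : (q * 2 ^ l.+2 = (q * 2 ^ l.+1) * 2)%N by rewrite expnSr mulnA.
rewrite /mdiff /avgb; have := Qp l.+1; move: (q * 2 ^ l.+1)%N => B B0.
rewrite blk2 divnMA divn2; set w := (u %/ B)%N.
have Bn0 : B%:R != 0 :> R by rewrite pnatr_eq0 -lt0n.
have e : (B%:R^-1 : R) = (B * 2)%:R^-1 + (B * 2)%:R^-1.
  by rewrite natrM; field.
rewrite {1}e rmorphD scalerDl.
have -> : w = (odd w + w./2.*2)%N by rewrite odd_double_half.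
case: (odd w); rewrite /sgb /= ?add0n ?add1n /= ?doubleK ?uphalf_double ?odd_double /=;
  rewrite ?doubleK ?uphalf_double.
  rewrite mulN1r rmorphN scaleNr scalerBr opprB scalerDr.
  by rewrite opprD addrACA subrr addr0.
rewrite mul1r scalerBr scalerDr.
by rewrite opprD addrACA subrr add0r.
Qed.

Let rotb (B j : nat) (u : nat) : nat := (B * (u %/ B) + ((u %% B) + j) %% B)%N.

(** A block average is the mean of the [B] cyclic rotations inside the blocks, and these are
    permutations of [T]. *)
Lemma lpn_avgb B : (0 < B)%N -> (B %| L)%N ->
  lpn p (fun u : T => avgb B u) <= lpn p (fun u : T => F u).
Proof.
move=> B0 BL.
have rotb_div j u : (rotb B j u %/ B = u %/ B)%N.
  by rewrite /rotb mulnC divnMDl// (divn_small (ltn_pmod _ B0)) addn0.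
have rot_lt j u : (u < L)%N -> (rotb B j u < L)%N.
  move: BL => /dvdnP[c ->]; rewrite -!ltn_divLR// => uc.
  by rewrite rotb_div.
pose rot j (u : T) : T := Ordinal (rot_lt j u (ltn_ord u)).
have rot_inj j : injective (rot j).
  move=> u v /(congr1 val) /= h; apply/val_inj => /=.
  have h1 := congr1 (divn^~ B) h; have h2 := congr1 (modn^~ B) h.
  rewrite /= !rotb_div in h1.
  rewrite /= /rotb !(mulnC B) !modnMDl !modn_mod in h2.
  rewrite (divn_eq u B) (divn_eq v B) h1; congr (_ + _)%N.
  have : (u %% B = v %% B %[mod B])%N.
    by apply/eqP; rewrite -(eqn_modDr j); apply/eqP.
  by rewrite !modn_mod.
have Bn0 : B%:R != 0 :> R by rewrite pnatr_eq0 -lt0n.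
rewrite (eq_lpn p (G := fun u : T => (B%:R^-1)%:C *: \sum_(j < B) F (rot j u))); last first.
  move=> u; rewrite /avgb /blk; congr (_ *: _).
  have B0' : (0 < B)%N by [].
  pose r (j : 'I_B) : 'I_B := Ordinal (ltn_pmod (u %% B + j) B0').
  have rinj : injective r.
    move=> i j /(congr1 val) /= h; apply/val_inj => /=.
    have : (i = j %[mod B])%N by apply/eqP; rewrite -(eqn_modDl (u %% B)); apply/eqP.
    by rewrite !modn_small.
  by rewrite (reindex_inj rinj).
rewrite lpnZr// ger0_norm ?invr_ge0//.
rewrite ler_pdivrMl ?ltr0n//.
apply: le_trans (lpn_sum p1 _ _ _) _.
rewrite (eq_bigr (fun=> lpn p (fun u : T => F u))); last first.
  by move=> j _; exact: (lpn_reindexT p (fun u : T => F u) (rot_inj j)).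
by rewrite sumr_const card_ord mulr_natl.
Qed.

Lemma sum_mdiff (u : nat) : \sum_(l < n) mdiff l u = avgb (q * 2) u - avgb L u.
Proof.
rewrite -(big_mkord xpredT (fun l => mdiff l u)).
under eq_bigr do rewrite mdiff_avgb -opprB.
rewrite sumrN (telescope_sumr (fun l => avgb (q * 2 ^ l.+1) u))//.
by rewrite opprB expn1.
Qed.

Lemma lpn_sum_mdiff : lpn p (fun u : T => \sum_(l < n) mdiff l u) <= 2 * lpn p (fun u : T => F u).
Proof.
rewrite (eq_lpn _ (fun u : T => sum_mdiff u)).
apply: le_trans (lpnB p1 _ _) _; rewrite mulr2n mulrDl !mul1r; apply: lerD.
  apply: lpn_avgb; first by rewrite muln_gt0 q0.
  by rewrite /L expnS mulnA dvdn_mulr.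
by apply: lpn_avgb => //; exact: Qp.
Qed.

Let E := {ffun 'I_n -> bool}.
Definition sg (eps : {ffun 'I_n -> bool}) (l : nat) : R :=
  sgb R (if insub l is Some i then eps i else false).

Let sg1 eps l : sg eps l = 1 \/ sg eps l = -1.
Proof. exact: sgb2. Qed.

Let sum_rev (G : nat -> X) : \sum_(k < n) G (n - k.+1)%N = \sum_(l < n) G l.
Proof. by rewrite (reindex_inj rev_ord_inj) /=; apply: eq_bigr => k _; rewrite subnSK// subKn// ltnW. Qed.

Section level.
Variables (c : nat) (G : nat -> nat -> X).
Hypothesis c1 : (c <= 1)%N.
Hypothesis Gw : forall l u u', (u %/ (q * 2 ^ (l + c)) = u' %/ (q * 2 ^ (l + c)))%N -> G l u = G l u'.
Hypothesis Gflip : forall l u, G l (flip (q * 2 ^ (l + c)) u) = - G l u.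

(** Levels [l] run from fine to coarse and a filtration from coarse to fine, hence the reversed
    index. The offset is [c = 1] for [mdiff] and [c = 0] for [mshift], whose sign alternates one
    scale lower. *)
Let e k : rel T := fun s t => (s %/ (q * 2 ^ (n + c - k)) == t %/ (q * 2 ^ (n + c - k)))%N.

Let e_eq k : equivalence_rel (e k).
Proof. by move=> s t w; split; [exact: eqxx|move/eqP; rewrite /e => ->]. Qed.

Let e_ne k s t : e k.+1 s t -> e k s t.
Proof.
rewrite /e subnS => /eqP h; apply/eqP.
case: (n + c - k)%N h => // j /= h.
by rewrite expnSr !mulnA !(divnMA _ _ 2) h.
Qed.

Let Dk k (u : T) := G (n - k.+1) u.

Let D_inv k s t : (k < n)%N -> e k.+1 s t -> Dk k s = Dk k t.
Proof.
move=> kn /eqP h; apply: Gw; move: h.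
by have -> : (n + c - k.+1 = n - k.+1 + c)%N by lia.
Qed.

Let D_cancels k : (k < n)%N -> cancels (e k) (Dk k).
Proof.
move=> kn; set B := (q * 2 ^ (n - k.+1 + c))%N.
have B0 : (0 < B)%N by exact: Qp.
have BL : (B * 2 %| L)%N.
  rewrite /B /L -mulnA -expnSr dvdn_pmul2l//; apply: dvdn_exp2l; lia.
pose fl (u : T) : T := Ordinal (flip_lt B0 BL (ltn_ord u)).
exists bool, (fun i u => if i then fl u else u); split.
- by rewrite card_bool.
- case => // u v /(congr1 val) /= /(can_inj (flipK B0)); exact: val_inj.
- case => u; last exact: eqxx.
  apply/eqP; rewrite (_ : (q * 2 ^ (n + c - k)) = B * 2)%N; first by rewrite (flip_half B0).
  by rewrite /B -mulnA -expnSr; congr (_ * 2 ^ _)%N; lia.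
- by move=> u; rewrite big_bool /= /Dk /= Gflip addNr.
Qed.

Let T0 : T := Ordinal (Qp n.+1).

Lemma level_umd eps :
  lpn p (fun u : T => \sum_(l < n) (sg eps l)%:C *: G l u) <=
  b * lpn p (fun u : T => \sum_(l < n) G l u).
Proof.
have := fin_umd hb T0 e_eq e_ne D_inv D_cancels (fun k => sg1 eps (n - k.+1)).
rewrite (eq_lpn p (G := fun u : T => \sum_(l < n) (sg eps l)%:C *: G l u)); last first.
  by move=> u; exact: (sum_rev (fun l => (sg eps l)%:C *: G l u)).
rewrite (eq_lpn p (F := fun u : T => \sum_(k < n) Dk k u) (G := fun u : T => \sum_(l < n) G l u))//.
by move=> u; exact: (sum_rev (fun l => G l u)).
Qed.

Lemma level_umd_rev eps :
  lpn p (fun u : T => \sum_(l < n) G l u) <=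
  b * lpn p (fun u : T => \sum_(l < n) (sg eps l)%:C *: G l u).
Proof.
have := fin_umd_rev hb T0 e_eq e_ne D_inv D_cancels (fun k => sg1 eps (n - k.+1)).
rewrite (eq_lpn p (F := fun u : T => \sum_(k < n) _ *: Dk k u) (G := fun u : T => \sum_(l < n) (sg eps l)%:C *: G l u)); last first.
  by move=> u; exact: (sum_rev (fun l => (sg eps l)%:C *: G l u)).
rewrite (eq_lpn p (F := fun u : T => \sum_(k < n) Dk k u) (G := fun u : T => \sum_(l < n) G l u))//.
by move=> u; exact: (sum_rev (fun l => G l u)).
Qed.

End level.

Let mshift_w l u u' : (u %/ (q * 2 ^ (l + 0)) = u' %/ (q * 2 ^ (l + 0)))%N ->
  mshift l u = mshift l u'.
Proof.
rewrite addn0 => h; rewrite /mshift h; congr (_ *: _); apply: mdiff_w.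
by rewrite expnSr !mulnA !(divnMA _ _ 2) h.
Qed.

(** UMD puts random signs in front of the levels. Since [mshift] differs from [mdiff] by a sign
    depending on level and position, a change of variables in the random signs turns one sum into
    the other, and a second use of UMD removes the signs. The factor 2 is that of
    [lpn_sum_mdiff]. *)
Lemma lpn_mshift : lpn p (fun u : T => \sum_(l < n) mshift l u) <=
  2 * b ^+ 2 * lpn p (fun u : T => F u).
Proof.
pose c := #|{: E}|%:R `^ p^-1 : R.
have c0 : 0 < c by rewrite powR_gt0// ltr0n; apply/card_gt0P; exists [ffun=> true].
pose FS (t : T * E) := \sum_(l < n) (sg t.2 l)%:C *: mshift l t.1.
pose FD (t : T * E) := \sum_(l < n) (sg t.2 l)%:C *: mdiff l t.1.
have h1 : c * lpn p (fun u : T => \sum_(l < n) mshift l u) <= b * lpn p FS.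
  rewrite /c -(lpn_fst p E); apply: (lpn_pair_le p1 b0) => eps.
  have fl l u : mshift l (flip (q * 2 ^ (l + 0)) u) = - mshift l u.
    by rewrite addn0 mshift_flip.
  exact: (@level_umd_rev 0 mshift isT mshift_w fl eps).
have h2 : lpn p FS = lpn p FD.
  pose h (t : T * E) : T * E := (t.1, [ffun i : 'I_n => t.2 i (+) odd (t.1 %/ (q * 2 ^ i))]).
  have hK : involutive h.
    by move=> [u eps]; congr (_, _); apply/ffunP => i; rewrite !ffunE -addbA addbb addbF.
  rewrite -(lpn_reindexT p FD (can_inj hK)); apply: eq_lpn => -[u eps].
  apply: eq_bigr => l _; rewrite /mshift scalerA -rmorphM /=; congr (_%:C *: _).
  by rewrite /sg valK ffunE sgb_addb.
have h3 : lpn p FD <= b * (c * lpn p (fun u : T => \sum_(l < n) mdiff l u)).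
  have -> : c * lpn p (fun u : T => \sum_(l < n) mdiff l u) =
     lpn p (fun t : T * E => \sum_(l < n) mdiff l t.1).
    by rewrite (lpn_fst p E (fun u : T => \sum_(l < n) mdiff l u)).
  apply: (lpn_pair_le p1 b0) => eps.
  have fl l u : mdiff l (flip (q * 2 ^ (l + 1)) u) = - mdiff l u.
    by rewrite addn1 mdiff_flip.
  have dw l u u' : (u %/ (q * 2 ^ (l + 1)) = u' %/ (q * 2 ^ (l + 1)))%N ->
    mdiff l u = mdiff l u' by rewrite addn1; exact: mdiff_w.
  exact: (@level_umd 1 mdiff isT dw fl eps).
rewrite -(ler_pM2l c0); apply: le_trans h1 _; rewrite h2.
apply: le_trans (ler_wpM2l b0 h3) _.
have -> : b * (b * (c * lpn p (fun u : T => \sum_(l < n) mdiff l u))) =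
  (c * b ^+ 2) * lpn p (fun u : T => \sum_(l < n) mdiff l u) by ring.
have -> : c * (2 * b ^+ 2 * lpn p (fun u : T => F u)) =
  (c * b ^+ 2) * (2 * lpn p (fun u : T => F u)) by ring.
apply: ler_wpM2l; last exact: lpn_sum_mdiff.
by apply: mulr_ge0; [exact: ltW|exact: exprn_ge0].
Qed.

End dyadic.

(** The two truncated differences add up to the distance of [m] and [c]. For [Q <= c] this is the
    number of pairs [u, v < Q] with [c + v - u = m], that is, the correlation of two intervals of
    length [Q]. *)
Definition tent (Q c m : nat) : nat := (Q - ((m - c) + (c - m)))%N.

Lemma sum_natdelta (V : nmodType) (M c : nat) (f : nat -> V) : (c < M)%N ->
  \sum_(m < M) f m *+ (m == c :> nat) = f c.
Proof.
move=> cM; rewrite (bigD1 (Ordinal cM))//= eqxx mulr1n big1 ?addr0// => m nm.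
case: eqP => [e|_]; last by rewrite mulr0n.
by move/eqP: nm => []; exact: val_inj.
Qed.

Lemma sum_tent (V : nmodType) (M Q c : nat) (f : nat -> V) : (Q <= c)%N -> (c + Q <= M)%N ->
  \sum_(u < Q) \sum_(v < Q) f (c + v - u)%N = \sum_(m < M) f m *+ tent Q c m.
Proof.
(* Increasing [Q] by one adds one pair for each [m] at distance at most the old [Q] from [c]; [win]
   sums over this window. *)
have win k : (k <= c)%N -> (c + k < M)%N ->
  \sum_(m < M) f m *+ ((m - c) + (c - m) <= k)%N =
  f c + \sum_(i < k) f (c - i.+1)%N + \sum_(i < k) f (c + i.+1)%N.
  elim: k => [|k IH] kc kM.
    rewrite !big_ord0 !addr0 -(sum_natdelta f (M := M) (c := c)); last by lia.
    by apply: eq_bigr => m _; congr (_ *+ nat_of_bool _); lia.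
  rewrite !big_ord_recr /=.
  have e1 : f (c - k.+1)%N = \sum_(m < M) f m *+ (m == (c - k.+1)%N :> nat).
    by rewrite sum_natdelta//; lia.
  have e2 : f (c + k.+1)%N = \sum_(m < M) f m *+ (m == (c + k.+1)%N :> nat).
    by rewrite sum_natdelta.
  rewrite (addrA (f c)) addrACA -IH; [|lia|lia].
  rewrite e1 e2 -!big_split /=; apply: eq_bigr => m _.
  rewrite -!mulrnDr; congr (_ *+ _).
  case: leqP; case: leqP; case: eqP; case: eqP => /=; lia.
elim: Q => [|Q IH] Qc QM.
  by rewrite big_ord0 big1// => m _; rewrite /tent sub0n mulr0n.
rewrite big_ord_recr /=.
under eq_bigr do rewrite big_ord_recr /=.
rewrite big_split /= IH; [|lia|lia].
rewrite big_ord_recr /= addnK.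
have -> : \sum_(i < Q) f (c + Q - i)%N = \sum_(j < Q) f (c + j.+1)%N.
  rewrite (reindex_inj rev_ord_inj) /=.
  by apply: eq_bigr => j _; congr (f _); have := ltn_ord j; lia.
have -> : \sum_(i < Q) f (c + i - Q)%N = \sum_(j < Q) f (c - j.+1)%N.
  rewrite (reindex_inj rev_ord_inj) /=.
  by apply: eq_bigr => j _; congr (f _); have := ltn_ord j; lia.
have w := win Q (ltnW Qc) ltac:(lia).
rewrite -addrA [X in _ + X](_ : _ = f c + \sum_(i < Q) f (c - i.+1)%N + \sum_(i < Q) f (c + i.+1)%N).
  rewrite -w -big_split /=; apply: eq_bigr => m _.
  by rewrite -mulrnDr; congr (_ *+ _); rewrite /tent; case: leqP => /=; lia.
by rewrite [LHS]addrC [X in X + _]addrC.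
Qed.

Section zmod_identities.
Variable V : zmodType.
Implicit Types a b c d e : V.

Lemma subr_add_subr a b c d : a - b + (c - d) = a + c - (b + d).
Proof. by rewrite addrACA -opprD. Qed.

Lemma shift_sum1 a b c d e : a + b - (c + d) - (e + a - (b + c)) = b + b - (d + e).
Proof.
rewrite opprB subr_add_subr.
rewrite [X in X - _](AC (2*2) ((2*3)*(1*4))) [X in _ - X](AC (2*2) ((2*3)*(4*1))) /=.
by rewrite (addrC (d + e)) addrKA.
Qed.

Lemma shift_sum2 a b c d e : e + d - (c + a) - (d + c - (a + b)) = e + b - (c + c).
Proof.
rewrite opprB subr_add_subr.
rewrite [X in X - _](AC (2*2) ((1*4)*(2*3))) [X in _ - X](AC (2*2) ((1*4)*(3*2))) /=.
by rewrite (addrC (c + c)) addrKA.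
Qed.

Lemma zmod_sum3 b c d e :
  b + b - (d + c) + (e + b - (c + c)) = b + (b + b) - (c + (c + c)) - (d - e).
Proof.
rewrite (opprB d) !subr_add_subr; congr (_ - _).
  by rewrite (AC (2*2) ((1*(2*4))*3)).
by rewrite (AC (2*2) ((2*(3*4))*1)).
Qed.

End zmod_identities.

Lemma tent_comb (R : realType) (X : lmodType R[i]) (k : R) (x y : X) (i j : nat) :
  k%:C *: (3 *: (x *+ i - y *+ i) - (x *+ j - y *+ j)) =
  ((3 * i%:R - j%:R) * k)%:C *: (x - y).
Proof.
rewrite -!mulrnBl; move: (x - y) => z.
rewrite -(scaler_nat i) -(scaler_nat j) scalerA -scalerBl scalerA; congr (_ *: _).
by rewrite rmorphM rmorphB rmorphM /= !rmorph_nat mulrC.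
Qed.

(** Coefficient of [F (t + g *+ m) - F (t - g *+ m)] when level [l] of the shift is averaged over
    all translations. On quarters of length [Q], it correlates the pattern +,+,-,- of a Haar
    function with the pattern +,-,-,+ of its image. *)
Definition level_kernel (R : realType) (q l m : nat) : R :=
  let Q := (q * 2 ^ l)%N in
  (3 * (tent Q Q m)%:R - (tent Q (3 * Q) m)%:R) / (16 * (Q%:R) ^+ 2).

Lemma level_kernel0 (R : realType) q l m : (4 * (q * 2 ^ l) <= m)%N ->
  level_kernel R q l m = 0.
Proof.
move=> h; rewrite /level_kernel; set Q := (q * 2 ^ l)%N.
rewrite (_ : tent Q Q m = 0%N); last by rewrite /tent; lia.
rewrite (_ : tent Q (3 * Q) m = 0%N); last by rewrite /tent; lia.
by rewrite mulr0 subrr mul0r.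
Qed.

(* The weights [16 / (q + 1)] turn the average over the dilations
   [q = Q, ..., 2 Q - 1] into a Riemann sum of the scale-invariant measure. *)
Definition kap (R : realType) (Q J m : nat) : R :=
  \sum_(i < Q) 16 / (Q + i).+1%:R * \sum_(l < J) level_kernel R (Q + i) l m.

(** * Averages of dyadic shifts over translates and dilates *)

Section averaging.
Context (R : realType) (X : completeNormedModType R[i]) (p : R) (b : R).
Hypothesis p1 : 1 < p.
Hypothesis hb : UMD_bound X p b.
Let b0 : 0 <= b. Proof. exact: hb.1. Qed.

Lemma lpn_snd (T1 T2 : finType) (F : T2 -> X) :
  lpn p (fun t : T1 * T2 => F t.2) = (#|T1|%:R `^ p^-1) * lpn p F.
Proof.
rewrite /lpn sum_pair /=.
under eq_bigr do rewrite sumr_const -mulr_natl.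
rewrite -mulr_sumr powRM ?ler0n// sumr_ge0// => t _; exact: powR_ge0.
Qed.

Lemma lpn_avg (T : finType) (L : nat) (G : 'I_L * T -> X) : (0 < L)%N ->
  L%:R `^ p^-1 * lpn p (fun t : T => (L%:R^-1)%:C *: \sum_(u < L) G (u, t)) <= lpn p G.
Proof.
move=> L0.
have Ln0 : L%:R != 0 :> R by rewrite pnatr_eq0 -lt0n.
pose r (j u : 'I_L) : 'I_L := Ordinal (ltn_pmod (u + j) L0).
have rinj j : injective (r j).
  move=> u v /(congr1 val) /= h; apply/val_inj => /=.
  have : (u = v %[mod L])%N by apply/eqP; rewrite -(eqn_modDr j); apply/eqP.
  by rewrite !modn_small.
have rinj' u : injective (r ^~ u).
  move=> i j /(congr1 val) /= h; apply/val_inj => /=.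
  have : (i = j %[mod L])%N by apply/eqP; rewrite -(eqn_modDl u); apply/eqP.
  by rewrite !modn_small.
have -> : (L%:R : R) = #|'I_L|%:R by rewrite card_ord.
rewrite -lpn_snd card_ord.
rewrite (eq_lpn p (G := fun t : 'I_L * T => (L%:R^-1)%:C *: \sum_(j < L) G (r j t.1, t.2))); last first.
  by move=> [u t] /=; rewrite (reindex_inj (rinj' u)).
rewrite lpnZr// ger0_norm ?invr_ge0// ler_pdivrMl ?ltr0n//.
apply: le_trans (lpn_sum p1 _ _ _) _.
rewrite (eq_bigr (fun=> lpn p G)); last first.
  move=> j _; apply: (lpn_reindexT p G (h := fun t => (r j t.1, t.2))).
  by move=> [u t] [u' t'] /= h; have := congr1 fst h; have := congr1 snd h => /= -> /rinj ->.
by rewrite sumr_const card_ord mulr_natl.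
Qed.

Context (A : finZmodType) (g : A) (q n : nat).
Hypothesis q0 : (0 < q)%N.
Let L := (q * 2 ^ n.+1)%N.
Let L0 : (0 < L)%N. Proof. by rewrite muln_gt0 q0 expn_gt0. Qed.

(** The shift acts along the orbit of [g]: [t - g *+ u] starts a segment of length [L] in which [t]
    has position [u]. Letting [u] take all values translates the dyadic grid uniformly. *)
Definition avg_shift (F : A -> X) (t : A) : X := (L%:R^-1)%:C *:
  \sum_(u < L) \sum_(l < n) mshift q (fun v => F (t - g *+ u + g *+ v)) l u.

(** Transference: after replacing [t] by [t + g *+ u], the integrand for fixed [t] is the shift of
    the function [F (t + g *+ v)] of [v], on a segment of length [L]. The shift does not leave the
    segment, so there are no boundary terms. *)
Lemma lpn_avg_shift (F : A -> X) : lpn p (avg_shift F) <= 2 * b ^+ 2 * lpn p F.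
Proof.
have c0 : 0 < (L%:R : R) `^ p^-1 by rewrite powR_gt0// ltr0n.
rewrite -(ler_pM2l c0).
pose G (ut : 'I_L * A) := \sum_(l < n) mshift q (fun v => F (ut.2 - g *+ ut.1 + g *+ v)) l ut.1.
apply: le_trans (lpn_avg G L0) _.
pose h (ut : 'I_L * A) := (ut.1, ut.2 + g *+ ut.1).
have hinj : injective h by move=> [u t] [u' t'] [<-] /addIr ->.
rewrite -(lpn_reindexT p G hinj).
pose K (ut : 'I_L * A) := F (ut.2 + g *+ ut.1).
have -> : (L%:R `^ p^-1) * (2 * b ^+ 2 * lpn p F) = 2 * b ^+ 2 * lpn p K.
  rewrite mulrCA; congr (_ * _).
  have -> : (L%:R : R) = #|'I_L|%:R by rewrite card_ord.
  by rewrite -lpn_snd -(lpn_reindexT p (fun ut : 'I_L * A => F ut.2) hinj).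
apply: lpn_pair_le => //; first by rewrite mulr_ge0// exprn_ge0.
move=> t.
rewrite (eq_lpn p (G := fun u : 'I_L => \sum_(l < n) mshift q (fun v => F (t + g *+ v)) l u)).
  exact: (@lpn_mshift _ _ _ _ p1 hb q n q0 (fun v => F (t + g *+ v))).
by move=> u; rewrite /G /h /= addrK.
Qed.

End averaging.

Section explicit.
Context (R : realType) (X : completeNormedModType R[i]).
Context (A : finZmodType) (g : A) (q n : nat).
Hypothesis q0 : (0 < q)%N.
Let L := (q * 2 ^ n.+1)%N.
Variables (F : A -> X) (t : A).

Let W (Q j1 j2 : nat) := \sum_(u < Q) \sum_(v < Q) F (t + g *+ (j2 * Q + v) - g *+ (j1 * Q + u)).

Let WS Q j1 j2 : W Q j1.+1 j2.+1 = W Q j1 j2.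
Proof.
apply: eq_bigr => u _; apply: eq_bigr => v _; congr (F _).
rewrite !mulSn -!addnA !(mulrnDr _ Q) addrCA opprD.
by rewrite addrACA subrr add0r.
Qed.

Let W0j Q j : (0 < j)%N -> (j <= 3)%N -> W Q 0 j = \sum_(m < 4 * Q) F (t + g *+ m) *+ tent Q (j * Q) m.
Proof.
move=> j0 j3; rewrite -(sum_tent (fun m => F (t + g *+ m))); last 2 first.
- by case: j j0 {j3} => // j _; rewrite mulSn leq_addr.
- by rewrite -mulSnr leq_mul2r; lia.
apply: eq_bigr => u _; apply: eq_bigr => v _; congr (F _).
rewrite mul0n add0n -addrA -mulrnBr//.
case: j j0 {j3} => // j _; rewrite mulSn; have := ltn_ord u; have := ltn_ord v; lia.
Qed.

Let Wj0 Q j : (0 < j)%N -> (j <= 3)%N -> W Q j 0 = \sum_(m < 4 * Q) F (t - g *+ m) *+ tent Q (j * Q) m.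
Proof.
move=> j0 j3; rewrite -(sum_tent (fun m => F (t - g *+ m))); last 2 first.
- by case: j j0 {j3} => // j _; rewrite mulSn leq_addr.
- by rewrite -mulSnr leq_mul2r; lia.
rewrite exchange_big /=; apply: eq_bigr => u _; apply: eq_bigr => v _; congr (F _).
rewrite mul0n add0n mulrnBr ?opprB ?addrA//.
case: j j0 {j3} => // j _; rewrite mulSn; have := ltn_ord u; have := ltn_ord v; lia.
Qed.

Let G (u : nat) := fun v => F (t - g *+ u + g *+ v).

Let blkW Q a al be : \sum_(u' < Q) blk (G ((4 * a + al) * Q + u')) Q (4 * a + be) = W Q al be.
Proof.
transitivity (W Q (4 * a + al) (4 * a + be)).
  apply: eq_bigr => u _; apply: eq_bigr => v _; rewrite /G; congr (F _).
  by rewrite addrAC (mulnC Q).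
by elim: (4 * a)%N => // k IH; rewrite !addSn WS.
Qed.

Lemma mshiftE l a al u' : let Q := (q * 2 ^ l)%N in (al < 4)%N -> (u' < Q)%N ->
  let u := ((4 * a + al) * Q + u')%N in
  mshift q (G u) l u = (sgb R (odd al (+) (2 <= al)%N) * (Q * 4)%:R^-1)%:C *:
    (blk (G u) Q (4 * a) + blk (G u) Q (4 * a + 1)
     - (blk (G u) Q (4 * a + 2) + blk (G u) Q (4 * a + 3))).
Proof.
move=> Q al4 uQ u.
have Q0 : (0 < Q)%N by rewrite muln_gt0 q0 expn_gt0.
have d1 : (u %/ Q = 4 * a + al)%N by rewrite /u divnMDl// divn_small// addn0.
have e2 : (q * 2 ^ l.+1 = Q * 2)%N by rewrite /Q expnSr mulnA.
have d2 : (u %/ (Q * 2) = 2 * a + (2 <= al))%N.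
  rewrite divnMA d1; case: (leqP 2 al) => h /=; lia.
rewrite /mshift -/Q d1 /mdiff e2 d2 scalerA -rmorphM /= -mulnA.
have -> : ((2 * a + (1 < al))./2 = a)%N by case: (1 < al)%N => /=; lia.
have o1 : odd (4 * a + al) = odd al by rewrite oddD oddM.
have o2 : odd (2 * a + (1 < al)) = (1 < al)%N by rewrite oddD oddM; case: (1 < al)%N.
rewrite o1 o2 !blk2 sgb_addb mulrA; congr (_ *: (_ - _)).
  by congr (blk _ _ _ + blk _ _ _); rewrite -!muln2; lia.
by congr (blk _ _ _ + blk _ _ _); rewrite -!muln2; lia.
Qed.

Lemma level_avgE l : (l < n)%N -> let Q := (q * 2 ^ l)%N in
  (L%:R^-1)%:C *: \sum_(u < L) mshift q (G u) l u =
  \sum_(m < 4 * Q) ((3 * (tent Q Q m)%:R - (tent Q (3 * Q) m)%:R) / (16 * (Q%:R) ^+ 2) : R)%:C *: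
    (F (t + g *+ m) - F (t - g *+ m)).
Proof.
move=> ln Q.
have Q0 : (0 < Q)%N by rewrite muln_gt0 q0 expn_gt0.
have Qn0 : Q%:R != 0 :> R by rewrite pnatr_eq0 -lt0n.
pose m' := (2 ^ (n - l.+1))%N.
have LE : L = (m' * 4 * Q)%N.
  rewrite /L /Q /m' (_ : 4 = 2 ^ 2)%N// -expnD mulnCA -expnD; congr (_ * 2 ^ _)%N; lia.
have m'0 : m'%:R != 0 :> R by rewrite pnatr_eq0 -lt0n expn_gt0.
pose c : R := (Q * 4)%:R^-1.
pose S := 3%:R *: (W Q 0 1 - W Q 1 0) - (W Q 0 3 - W Q 3 0) : X.
have key a : \sum_(al < 4) \sum_(u' < Q)
    mshift q (G ((a * 4 + al) * Q + u')%N) l ((a * 4 + al) * Q + u')%N = c%:C *: S.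
  pose Z al := \sum_(u' < Q) (blk (G ((4 * a + al) * Q + u')) Q (4 * a)
     + blk (G ((4 * a + al) * Q + u')) Q (4 * a + 1)
     - (blk (G ((4 * a + al) * Q + u')) Q (4 * a + 2)
     + blk (G ((4 * a + al) * Q + u')) Q (4 * a + 3))).
  have ZE al : Z al = W Q al 0 + W Q al 1 - (W Q al 2 + W Q al 3).
    rewrite /Z sumrB !big_split /= !blkW; congr (_ + _ - _).
    by rewrite -(blkW Q a al 0) addn0.
  transitivity (\sum_(al < 4) (sgb R (odd al (+) (2 <= al)%N) * c)%:C *: Z al).
    apply: eq_bigr => al _; rewrite /Z scaler_sumr; apply: eq_bigr => u' _.
    by rewrite (mulnC a) mshiftE.
  rewrite !big_ord_recr big_ord0 /= !ZE /sgb /= add0r !mul1r !mulN1r !rmorphN !scaleNr.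
  rewrite -!scalerN -!scalerDr; congr (_ *: _).
  (* The correlation [W] depends only on the difference of the two block indices. With the quarter
     signs +,-,-,+ the differences 0, 2 and -2 cancel; 1 and 3 survive with coefficients 3 and -1,
     and their negatives with the opposite ones. *)
  have e11 := WS Q 0 0; have e22 := WS Q 1 1; have e33 := WS Q 2 2.
  have e12 := WS Q 0 1; have e23 := WS Q 1 2; have e13 := WS Q 0 2.
  have e21 := WS Q 1 0; have e32 := WS Q 2 1; have e31 := WS Q 2 0.
  rewrite e33 e22 e11 e23 e12 e13 e32 e21 e31 /S.
  rewrite -[LHS]addrA [X in _ + X]addrC shift_sum1 shift_sum2.
  by rewrite scaler_nat mulrnBl !mulrS mulr0n !addr0 zmod_sum3.
transitivity (((m'%:R : R) / L%:R * c)%:C *: S).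
  have sumL (f : nat -> X) : \sum_(u < L) f u =
      \sum_(i < m') \sum_(al < 4) \sum_(u < Q) f ((i * 4 + al) * Q + u)%N.
    by rewrite LE sum_mul_nat (sum_mul_nat _ _ (fun i => \sum_(u < Q) f (i * Q + u)%N)).
  rewrite (sumL (fun u => mshift q (G u) l u)).
  rewrite (eq_bigr (fun=> c%:C *: S) (fun (i : 'I_m') _ => key i)).
  move: S {key} => S; rewrite sumr_const card_ord -(scaler_nat m' (c%:C *: S)) !scalerA.
  rewrite -(rmorph_nat (real_complex R) m') -!rmorphM /=.
  by congr (_%:C *: _); ring.
have -> : (m'%:R : R) / L%:R * c = (16 * (Q%:R) ^+ 2)^-1.
  rewrite /c LE (natrM _ (m' * 4) Q) (natrM _ m' 4) (natrM _ Q 4); move: (m'%:R : R) (Q%:R : R) m'0 Qn0 => x y x0 y0.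
  by field; rewrite x0 y0.
rewrite /S !W0j// !Wj0// mul1n -!sumrB scaler_sumr -sumrB scaler_sumr.
by apply: eq_bigr => m _; exact: tent_comb.
Qed.

End explicit.

Section hilbert.
Context (R : realType) (X : completeNormedModType R[i]) (p : R) (b : R).
Hypothesis p1 : 1 < p.
Hypothesis hb : UMD_bound X p b.
Context (A : finZmodType) (g : A).

Definition kap_op (Q J N : nat) (F : A -> X) (t : A) : X :=
  \sum_(m < N) (kap R Q J m)%:C *: (F (t + g *+ m) - F (t - g *+ m)).

Lemma avg_shiftE q n N (F : A -> X) t : (0 < q)%N -> (forall l, (l < n)%N -> (4 * (q * 2 ^ l) <= N)%N) ->
  avg_shift g q n F t =
  \sum_(m < N) (\sum_(l < n) level_kernel R q l m)%:C *: (F (t + g *+ m) - F (t - g *+ m)).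
Proof.
move=> q0 hN; rewrite /avg_shift exchange_big scaler_sumr /=.
rewrite [RHS](eq_bigr (fun m : 'I_N => \sum_(l < n) (level_kernel R q l m)%:C *: (F (t + g *+ m) - F (t - g *+ m)))); last first.
  by move=> m _; rewrite rmorph_sum scaler_suml.
rewrite [RHS]exchange_big /=; apply: eq_bigr => l _.
rewrite level_avgE//.
rewrite -[RHS](big_mkord xpredT (fun m => (level_kernel R q l m)%:C *: (F (t + g *+ m) - F (t - g *+ m)))).
rewrite [RHS](big_cat_nat _ (hN l (ltn_ord l)))//= [in RHS]big_mkord [X in _ = _ + X]big1_seq ?addr0//.
move=> m; rewrite mem_index_iota => /andP[_ /andP[h _]].
by rewrite level_kernel0// scale0r.
Qed.

Lemma sum_inv_le1 (Q : nat) : \sum_(i < Q) ((Q + i).+1%:R^-1 : R) <= 1.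
Proof.
case: Q => [|Q]; first by rewrite big_ord0.
apply: (@le_trans _ _ (\sum_(i < Q.+1) (Q.+1%:R^-1 : R))).
  apply: ler_sum => i _; rewrite lef_pV2 ?posrE ?ltr0n// ler_nat; lia.
by rewrite sumr_const card_ord -[_ *+ _]mulr_natl mulfV.
Qed.

(** The weights of the dilations add up to at most 16 and each averaged shift costs [2 * b ^+ 2], so
    nothing depends on [Q], [J] or [N]. The condition on [N] keeps the supports of all the level
    kernels below [N]. *)
Lemma lpn_kap_op Q J N (F : A -> X) : (0 < Q)%N ->
  (forall l, (l < J)%N -> (4 * (2 * Q * 2 ^ l) <= N)%N) ->
  lpn p (kap_op Q J N F) <= 32 * b ^+ 2 * lpn p F.
Proof.
move=> Q0 hN; have b0 := hb.1.
rewrite (eq_lpn p (G := fun t => \sum_(i < Q) (16 / (Q + i).+1%:R : R)%:C *: avg_shift g (Q + i) J F t)); last first.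
  move=> t; rewrite /kap_op.
  under [RHS]eq_bigr => i _.
    rewrite (@avg_shiftE (Q + i) J N); [|by rewrite addn_gt0 Q0|]; last first.
      move=> l lJ; apply: leq_trans (hN l lJ); rewrite leq_mul2l /= leq_mul2r.
      by rewrite mul2n -addnn leq_add2l ltnW ?orbT.
    rewrite scaler_sumr; over.
  rewrite exchange_big /=; apply: eq_bigr => m _.
  rewrite /kap rmorph_sum scaler_suml; apply: eq_bigr => i _.
  by rewrite rmorphM scalerA.
apply: le_trans (lpn_sum p1 _ _ _) _.
apply: (@le_trans _ _ (\sum_(i < Q) (16 / (Q + i).+1%:R) * (2 * b ^+ 2 * lpn p F))).
  apply: ler_sum => i _; rewrite lpnZr// ger0_norm ?divr_ge0//.
  apply: ler_wpM2l; first by rewrite divr_ge0.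
  by apply: lpn_avg_shift => //; rewrite addn_gt0 Q0.
rewrite -mulr_suml -mulr_sumr.
have L0 : 0 <= b ^+ 2 * lpn p F by rewrite mulr_ge0 ?exprn_ge0 ?lpn_ge0.
have := sum_inv_le1 Q; move: (\sum_(_ < _) _) => s s1; nra.
Qed.

End hilbert.

(** * Asymptotics of the averaged shift kernel *)

Section kernel.
Context (R : realType).
Implicit Types (s a c x : R).

Definition posp x : R := Num.max x 0.

Lemma posp_sqr_taylor a c x : a <= c ->
  `|posp (c - x) ^+ 2 / 2 - posp (a - x) ^+ 2 / 2 - posp (c - x) * (c - a)| <= (c - a) ^+ 2 / 2.
Proof.
move=> ac; rewrite /posp ler_norml.
by case: (leP (c - x) 0) => h1; case: (leP (a - x) 0) => h2; apply/andP; split; nra.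
Qed.

Lemma posp_bound s x : 0 <= x -> 0 <= s -> 0 <= posp (s - x) ^+ 2 <= s ^+ 2.
Proof. by move=> x0 s0; rewrite /posp; case: (leP (s - x) 0) => h; apply/andP; split; nra. Qed.

(* [Phi] is the autocorrelation profile of the dyadic shift and [PPhi] its
   antiderivative vanishing at [0]. *)
Definition Phi s : R := 3 * posp (s - 0) - 6 * posp (s - 1) + 2 * posp (s - 2) +
  2 * posp (s - 3) - posp (s - 4).

Definition PPhi s : R := 3 * (posp (s - 0) ^+ 2 / 2) - 6 * (posp (s - 1) ^+ 2 / 2)
  + 2 * (posp (s - 2) ^+ 2 / 2) + 2 * (posp (s - 3) ^+ 2 / 2) - posp (s - 4) ^+ 2 / 2.

Lemma PPhi_taylor a c : a <= c -> `|PPhi c - PPhi a - Phi c * (c - a)| <= 7 * (c - a) ^+ 2.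
Proof.
move=> ac.
have := posp_sqr_taylor 0 ac; have := posp_sqr_taylor 1 ac; have := posp_sqr_taylor 2 ac.
have := posp_sqr_taylor 3 ac; have := posp_sqr_taylor 4 ac.
rewrite !ler_norml /PPhi /Phi.
move=> /andP[? ?] /andP[? ?] /andP[? ?] /andP[? ?] /andP[? ?].
by apply/andP; split; lra.
Qed.

Lemma PPhi4 s : 4 <= s -> PPhi s = 2.
Proof.
move=> s4; rewrite /PPhi /posp !max_l; try lra.
Qed.

Lemma Phi4 s : 4 <= s -> Phi s = 0.
Proof. by move=> s4; rewrite /Phi /posp !max_l; try lra. Qed.

Lemma PPhi_le s : 0 <= s -> `|PPhi s| <= 7 * s ^+ 2.
Proof.
move=> s0; rewrite ler_norml /PPhi.
have := @posp_bound s 0 (lexx _) s0; have := @posp_bound s 1 ler01 s0.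
have := @posp_bound s 2 ltac:(lra) s0; have := @posp_bound s 3 ltac:(lra) s0.
have := @posp_bound s 4 ltac:(lra) s0.
move=> /andP[? ?] /andP[? ?] /andP[? ?] /andP[? ?] /andP[? ?].
by apply/andP; split; lra.
Qed.

Lemma PPhi_bounded s : 0 <= s -> `|PPhi s| <= 112.
Proof.
move=> s0; case: (leP 4 s) => h; first by rewrite PPhi4// ger0_norm; lra.
apply: le_trans (PPhi_le s0) _; nra.
Qed.

Lemma level_kernelE q l m : (0 < q)%N ->
  level_kernel R q l m = Phi (m%:R / (q * 2 ^ l)%:R) / (16 * (q * 2 ^ l)%:R).
Proof.
move=> q0; rewrite /level_kernel; set Q := (q * 2 ^ l)%N.
have Q0 : (0 < Q)%N by rewrite muln_gt0 q0 expn_gt0.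
have Qr0 : 0 < (Q%:R : R) by rewrite ltr0n.
have Qn0 : (Q%:R : R) != 0 by rewrite gt_eqF.
have tE (c : nat) : (tent Q c m)%:R = posp (m%:R - c%:R + Q%:R) - 2 * posp (m%:R - c%:R) + posp (m%:R - c%:R - Q%:R) :> R.
  rewrite /tent /posp.
  have [h1|h1] := leqP (m + Q) c.
    rewrite (_ : (Q - _)%N = 0%N); last by lia.
    have h1' : m%:R + Q%:R <= c%:R :> R by rewrite -natrD ler_nat.
    by rewrite !max_r; lra.
  have h1' : c%:R < m%:R + Q%:R :> R by rewrite -natrD ltr_nat.
  have [h2|h2] := leqP m c.
    rewrite (_ : (Q - _)%N = (m + Q - c)%N); last by lia.
    have h2' : m%:R <= c%:R :> R by rewrite ler_nat.
    rewrite natrB ?natrD; last by lia.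
    rewrite (max_l (x := m%:R - c%:R + Q%:R)); last lra.
    by rewrite !max_r; lra.
  have h2' : c%:R < m%:R :> R by rewrite ltr_nat.
  rewrite (max_l (x := m%:R - c%:R + Q%:R)); last lra.
  rewrite (max_l (x := m%:R - c%:R)); last lra.
  have [h3|h3] := leqP m (c + Q).
    rewrite (_ : (Q - _)%N = (c + Q - m)%N); last by lia.
    have h3' : m%:R <= c%:R + Q%:R :> R by rewrite -natrD ler_nat.
    rewrite natrB// natrD max_r; lra.
  rewrite (_ : (Q - _)%N = 0%N); last by lia.
  have h3' : c%:R + Q%:R < m%:R :> R by rewrite -natrD ltr_nat.
  rewrite max_l; lra.
have pE (j : R) : posp (m%:R / Q%:R - j) = posp (m%:R - j * Q%:R) / Q%:R.
  rewrite /posp (_ : m%:R / Q%:R - j = (m%:R - j * Q%:R) / Q%:R); last by field.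
  move: (m%:R - _) => y; case: (leP y 0) => h.
    by rewrite mul0r max_r// pmulr_lle0// invr_gt0.
  by rewrite max_l// divr_ge0// ltW.
rewrite !tE natrM /Phi !pE.
have -> : m%:R - Q%:R + Q%:R = m%:R - 0 * Q%:R :> R by ring.
have -> : m%:R - Q%:R - Q%:R = m%:R - 2 * Q%:R :> R by ring.
have -> : m%:R - 3 * Q%:R + Q%:R = m%:R - 2 * Q%:R :> R by ring.
have -> : m%:R - 3 * Q%:R - Q%:R = m%:R - 4 * Q%:R :> R by ring.
rewrite mul1r; field.
by [].
Qed.

Section kap_estimate.
Variables (Q J : nat).
Hypothesis Q0 : (0 < Q)%N.
Hypothesis JQ : (J <= Q)%N.

(** The value to which the weighted double sum telescopes. As [PPhi] is 2 from 4 on and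
    quadratically small at 0, this is close to [2 / m] between [4 * Q] and the largest scale
    [Q * 2 ^ J]. *)
Definition kap_main (m : nat) : R :=
  (PPhi (m%:R / Q%:R) - PPhi (m%:R / (Q * 2 ^ J)%:R)) / m%:R.

Let step_err (q l m : nat) : R :=
  if (m < 4 * q.+1 * 2 ^ l)%N then 28 / ((q%:R ^+ 2) * q.+1%:R * (2 ^ l)%:R) else 0.

Let natr_gt0 (k : nat) : (0 < k)%N -> 0 < (k%:R : R). Proof. by rewrite ltr0n. Qed.

(** Let c = m / (q 2^l) and a = m / ((q+1) 2^l). The weight makes the kernel exactly
    [Phi c * (c - a) / m], one term of a Riemann sum, and [PPhi_taylor] bounds the error. For
    [4 <= a] both sides of the comparison are 0, which confines the error to small [m]. *)
Let step q l m : (0 < q)%N -> (0 < m)%N ->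
  `|16 / q.+1%:R * level_kernel R q l m -
   (PPhi (m%:R / (q * 2 ^ l)%:R) - PPhi (m%:R / (q.+1 * 2 ^ l)%:R)) / m%:R| <= step_err q l m.
Proof.
move=> q0 m0; rewrite level_kernelE// /step_err.
have qr := natr_gt0 q0; have mr := natr_gt0 m0.
have q1r := natr_gt0 (ltn0Sn q).
have lr : 0 < ((2 ^ l)%:R : R) by rewrite natr_gt0// expn_gt0.
have qq : (q.+1%:R : R) = q%:R + 1 by rewrite -natr1.
have cond : (m%:R < 4 * q.+1%:R * (2 ^ l)%:R :> R) = (m < 4 * q.+1 * 2 ^ l)%N.
  by rewrite -!natrM ltr_nat.
rewrite -cond !natrM {cond}; move: qr mr q1r lr qq.
move: (q%:R : R) (m%:R : R) (q.+1%:R : R) ((2 ^ l)%:R : R) => x z y L x0 z0 y0 L0 yx.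
set c := z / (x * L); set a := z / (y * L).
have xn := lt0r_neq0 x0; have yn := lt0r_neq0 y0; have zn := lt0r_neq0 z0.
have Ln := lt0r_neq0 L0.
have ca : c - a = z / (x * y * L).
  rewrite /c /a.
  have x1 : x = y - 1 by rewrite yx addrK.
  have yn' : y - 1 != 0 by rewrite -x1.
  by rewrite x1; field; rewrite Ln yn yn'.
have ca0 : 0 <= c - a by rewrite ca divr_ge0 ?ltW// !mulr_gt0.
have e : 16 / y * (Phi c / (16 * (x * L))) = Phi c * (c - a) / z.
  by rewrite ca; field; rewrite Ln xn yn zn.
rewrite e -mulrBl normrM normfV (ger0_norm (ltW z0)) distrC ler_pdivrMr//.
case: ltP => h.
  apply: le_trans (PPhi_taylor _) _; first by rewrite -subr_ge0.
  rewrite ca; apply: (@le_trans _ _ (28 / (x ^+ 2 * y * L) * z * (z / (4 * y * L)))).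
    by rewrite le_eqVlt; apply/orP; left; apply/eqP; field; rewrite Ln xn yn.
  rewrite ler_piMr//; first by rewrite mulr_ge0 ?divr_ge0 ?mulr_ge0 ?exprn_ge0 ?ltW.
  by rewrite ler_pdivrMr ?mulr_gt0// mul1r ltW.
have a4 : 4 <= a.
  by rewrite /a ler_pdivlMr ?mulr_gt0// mulrA.
have c4 : 4 <= c by lra.
by rewrite !PPhi4// Phi4// mul0r subrr subr0 normr0 mul0r.
Qed.

(** At level [l] the scales run from [Q * 2 ^ l] to [2 * Q * 2 ^ l], where level [l + 1] takes over;
    the sum telescopes in the dilation and then in the level. *)
Let kap_main_sum m : (0 < m)%N -> kap_main m = \sum_(i < Q) \sum_(l < J)
  (PPhi (m%:R / ((Q + i) * 2 ^ l)%:R) - PPhi (m%:R / ((Q + i).+1 * 2 ^ l)%:R)) / m%:R.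
Proof.
move=> m0; rewrite /kap_main exchange_big /=.
under eq_bigr do rewrite -mulr_suml.
rewrite -mulr_suml; congr (_ / _).
pose g l := PPhi (m%:R / (Q * 2 ^ l)%:R).
have -> : PPhi (m%:R / Q%:R) - PPhi (m%:R / (Q * 2 ^ J)%:R) = \sum_(l < J) (g l - g l.+1).
  rewrite -(big_mkord xpredT (fun l => g l - g l.+1)).
  under eq_bigr do rewrite -opprB.
  by rewrite sumrN telescope_sumr// opprB /g expn0 muln1.
apply: eq_bigr => l _.
pose h i := PPhi (m%:R / ((Q + i) * 2 ^ l)%:R).
rewrite -(big_mkord xpredT (fun i => PPhi (m%:R / ((Q + i) * 2 ^ l)%:R) - PPhi (m%:R / ((Q + i).+1 * 2 ^ l)%:R))).
under eq_bigr do rewrite -opprB -addnS.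
rewrite sumrN (telescope_sumr h)// opprB /h addn0; congr (_ - PPhi (_ / _%:R)).
by rewrite expnS mulnA addnn muln2.
Qed.

(** A pair (dilation, level) has at most 4 (q+1) 2^l nonzero errors and costs at most 112 / Q^2 in
    total. There are Q J such pairs, and [J <= Q]. *)
Lemma sum_kap_err (N : nat) : \sum_(1 <= m < N) `|kap R Q J m - kap_main m| <= 112.
Proof.
have Qr := natr_gt0 Q0.
apply: (@le_trans _ _ (\sum_(1 <= m < N) \sum_(i < Q) \sum_(l < J) step_err (Q + i) l m)).
  rewrite big_nat [leRHS]big_nat; apply: ler_sum => m /andP[m1 _].
  rewrite kap_main_sum// /kap.
  under eq_bigr do rewrite mulr_sumr.
  rewrite -sumrB; apply: le_trans (ler_norm_sum _ _ _) _; apply: ler_sum => i _.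
  rewrite -sumrB; apply: le_trans (ler_norm_sum _ _ _) _; apply: ler_sum => l _.
  by apply: step => //; rewrite addn_gt0 Q0.
rewrite exchange_big /=.
apply: (@le_trans _ _ (\sum_(i < Q) \sum_(l < J) (112 / Q%:R ^+ 2))).
  apply: ler_sum => i _; rewrite exchange_big /=; apply: ler_sum => l _.
  set q := (Q + i)%N.
  have q0 : (0 < q)%N by rewrite addn_gt0 Q0.
  have qr := natr_gt0 q0; have q1r := natr_gt0 (ltn0Sn q).
  have lr : 0 < ((2 ^ l)%:R : R) by rewrite natr_gt0// expn_gt0.
  pose K := (4 * q.+1 * 2 ^ l)%N.
  pose v : R := 28 / (q%:R ^+ 2 * q.+1%:R * (2 ^ l)%:R).
  have v0 : 0 <= v by rewrite divr_ge0// !mulr_ge0 ?exprn_ge0// ltW.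
  apply: (@le_trans _ _ (\sum_(0 <= m < K) v)).
    rewrite /step_err -/K -/v.
    have [NK|KN] := leqP N K.
      apply: (@le_trans _ _ (\sum_(0 <= m < N) v)).
        have [->|N0] := posnP N; first by rewrite big_geq// big_geq.
        rewrite [leRHS](big_cat_nat _ (n := 1))//= -[leLHS]add0r; apply: lerD.
          by apply: sumr_ge0.
        by apply: ler_sum => m _; case: ifP.
      by rewrite [leRHS](big_cat_nat _ (n := N))//= lerDl; apply: sumr_ge0.
    have K0 : (0 < K)%N by rewrite !muln_gt0 expn_gt0.
    rewrite (big_cat_nat _ (n := K)) ?(ltnW KN)//=.
    rewrite [X in _ + X]big1_seq ?addr0; last first.
      by move=> m; rewrite mem_index_iota => /andP[_ /andP[h _]]; rewrite ltnNge h.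
    rewrite [leRHS](big_cat_nat _ (n := 1))//= -[leLHS]add0r; apply: lerD.
      by apply: sumr_ge0.
    by apply: ler_sum => m _; case: ifP.
  rewrite sumr_const_nat subn0 -[_ *+ _]mulr_natl.
  have -> : K%:R * v = 112 / q%:R ^+ 2.
    rewrite /K /v !natrM; field.
    by rewrite !lt0r_neq0.
  rewrite ler_pM2l// lef_pV2 ?posrE ?exprn_gt0// lerXn2r ?nnegrE//.
  by rewrite ler_nat leq_addr.
set c := 112 / _; rewrite !sumr_const !card_ord.
rewrite -(mulr_natl c J) -(mulr_natl (J%:R * c) Q) {}/c.
apply: (@le_trans _ _ (Q%:R * (Q%:R * (112 / Q%:R ^+ 2)))).
  apply: ler_wpM2l => //; apply: ler_wpM2r; last by rewrite ler_nat.
  by rewrite divr_ge0 ?exprn_ge0.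
by rewrite le_eqVlt; apply/orP; left; apply/eqP; field; rewrite lt0r_neq0.
Qed.

Section interpolated.
Variables (S mm : nat).
Hypothesis QS : (4 * Q <= S)%N.
Hypothesis NR : (mm * S <= 16 * (Q * 2 ^ J))%N.
Let N := (mm * S)%N.
Let S0 : (0 < S)%N. Proof. by apply: leq_trans QS; rewrite muln_gt0. Qed.

(** Kernel at distance [i + 1] induced on Z/mm by averaging over the cells: a translation by j S + r
    moves the fraction r/S of a cell to distance j + 1 and the rest to distance j. *)
Definition kap_interp (i : nat) : R := \sum_(r < S)
  ((1 - r%:R / S%:R) * kap R Q J (i.+1 * S + r) + r%:R / S%:R * kap R Q J (i * S + r)).

Let E t := if (4 * Q <= t)%N then `|kap R Q J t - 2 / t%:R| else 0.

Let E0 t : 0 <= E t. Proof. by rewrite /E; case: ifP. Qed.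

Let kap_main_tail t : (4 * Q <= t)%N -> `|kap_main t - 2 / t%:R| <= 7 * t%:R / ((Q * 2 ^ J)%:R) ^+ 2.
Proof.
move=> Qt; have t0 : (0 < t)%N by apply: leq_trans Qt; rewrite muln_gt0.
have tr := natr_gt0 t0; have Qr := natr_gt0 Q0.
have Rr : 0 < ((Q * 2 ^ J)%:R : R) by rewrite natr_gt0// muln_gt0 Q0 expn_gt0.
rewrite /kap_main PPhi4; last by rewrite ler_pdivlMr// -natrM ler_nat.
rewrite mulrBl addrAC subrr add0r normrN normrM normfV (ger0_norm (ltW tr)).
rewrite ler_pdivrMr//; apply: le_trans (PPhi_le _) _; first by rewrite divr_ge0// ltW.
rewrite le_eqVlt; apply/orP; left; apply/eqP.
by move: (t%:R : R) ((Q * 2 ^ J)%:R : R) Rr => x y y0; field; rewrite lt0r_neq0.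
Qed.

(** 112 comes from the Riemann sums. The tail error is at most 7 N / (Q 2^J)^2 per term, and N <= 16
    Q 2^J bounds the N terms by 7 * 16^2 = 1792. *)
Let sumE : \sum_(t < N) E t <= 1904.
Proof.
have Rr : 0 < ((Q * 2 ^ J)%:R : R) by rewrite natr_gt0// muln_gt0 Q0 expn_gt0.
apply: (@le_trans _ _ (\sum_(1 <= t < N) `|kap R Q J t - kap_main t| +
    \sum_(t < N) 7 * N%:R / ((Q * 2 ^ J)%:R) ^+ 2)).
  have -> : \sum_(t < N) E t = \sum_(1 <= t < N) E t.
    rewrite -(big_mkord xpredT E).
    have [->|N0] := posnP N; first by rewrite !big_geq.
    rewrite (big_cat_nat _ (n := 1))//= big_nat1 /E leqn0 muln_eq0 /=.
    by rewrite (gtn_eqF Q0) add0r.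
  rewrite -(big_mkord xpredT (fun=> 7 * N%:R / (Q * 2 ^ J)%:R ^+ 2)).
  have c0 : 0 <= 7 * N%:R / (Q * 2 ^ J)%:R ^+ 2 :> R.
    by rewrite divr_ge0 ?mulr_ge0 ?exprn_ge0// ltW.
  apply: (@le_trans _ _ (\sum_(1 <= t < N) (`|kap R Q J t - kap_main t| + 7 * N%:R / (Q * 2 ^ J)%:R ^+ 2))).
    rewrite big_nat [leRHS]big_nat; apply: ler_sum => t /andP[t1 tN].
    rewrite /E; case: leqP => Qt; last by rewrite addr_ge0.
    rewrite (_ : kap R Q J t - 2 / t%:R = (kap R Q J t - kap_main t) + (kap_main t - 2 / t%:R)); last by ring.
    apply: le_trans (ler_normD _ _) _; rewrite lerD2l.
    apply: le_trans (kap_main_tail Qt) _; apply: ler_wpM2r; first by rewrite invr_ge0 exprn_ge0// ltW.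
    by apply: ler_wpM2l => //; rewrite ler_nat ltnW.
  rewrite big_split /= lerD2l.
  have [->|N0] := posnP N; first by rewrite !big_geq.
  by rewrite [leRHS](big_cat_nat _ (n := 1))//= lerDr sumr_ge0.
have -> : (1904 : R) = 112 + 1792 by rewrite -natrD.
apply: lerD; first exact: sum_kap_err.
set c := 7 * _ / _; rewrite sumr_const card_ord -(mulr_natl c N) {}/c.
have NR' : N%:R <= 16 * ((Q * 2 ^ J)%:R : R) by rewrite -natrM ler_nat.
rewrite mulrA ler_pdivrMr ?exprn_gt0//.
have : 0 <= N%:R :> R by [].
move: NR' Rr; move: (N%:R : R) ((Q * 2 ^ J)%:R : R) => x y xy y0 x0; nra.
Qed.

Let term1 i (r : 'I_S) : `|kap R Q J (i.+1 * S + r) - 2 / (i.+1%:R * S%:R)| <=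
  E (i.+1 * S + r) + 2 / (i.+1%:R ^+ 2 * S%:R).
Proof.
set t := (i.+1 * S + r)%N.
have iS : (i.+1 * S <= t)%N by rewrite leq_addr.
have Qt : (4 * Q <= t)%N by apply: leq_trans QS (leq_trans _ iS); rewrite leq_pmull.
have t0 : (0 < t)%N by apply: leq_trans Qt; rewrite muln_gt0.
rewrite /E Qt.
rewrite (_ : kap R Q J t - 2 / (i.+1%:R * S%:R) = (kap R Q J t - 2 / t%:R) + (2 / t%:R - 2 / (i.+1%:R * S%:R))); last by ring.
apply: le_trans (ler_normD _ _) _; rewrite lerD2l.
have Sr := natr_gt0 S0; have ir := natr_gt0 (ltn0Sn i); have tr := natr_gt0 t0.
have iS' : i.+1%:R * S%:R <= t%:R :> R by rewrite -natrM ler_nat.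
have tS' : t%:R <= i.+1%:R * S%:R + S%:R :> R.
  by rewrite -natrM -natrD ler_nat /t leq_add2l ltnW.
move: Sr ir tr iS' tS'; move: (S%:R : R) (i.+1%:R : R) (t%:R : R) => s x y s0 x0 y0 h1 h2.
have xs0 : 0 < x * s by rewrite mulr_gt0.
rewrite distrC (_ : 2 / (x * s) - 2 / y = 2 * (y - x * s) / (y * (x * s))); last first.
  by field; rewrite !lt0r_neq0.
rewrite ger0_norm; last by rewrite divr_ge0 ?mulr_ge0 ?subr_ge0// ltW// mulr_gt0.
rewrite ler_pdivrMr ?mulr_gt0//.
rewrite (_ : 2 / (x ^+ 2 * s) * (y * (x * s)) = 2 * y / x); last by field; rewrite !lt0r_neq0.
by rewrite ler_pdivlMr//; nra.
Qed.

Let term2 i (r : 'I_S) : (0 < i)%N -> `|kap R Q J (i * S + r) - 2 / (i.+1%:R * S%:R)| <=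
  E (i * S + r) + 2 / (i%:R * i.+1%:R * S%:R).
Proof.
move=> i0; set t := (i * S + r)%N.
have iS : (i * S <= t)%N by rewrite leq_addr.
have Qt : (4 * Q <= t)%N by apply: leq_trans QS (leq_trans _ iS); rewrite leq_pmull.
have t0 : (0 < t)%N by apply: leq_trans Qt; rewrite muln_gt0.
rewrite /E Qt.
rewrite (_ : kap R Q J t - 2 / (i.+1%:R * S%:R) = (kap R Q J t - 2 / t%:R) + (2 / t%:R - 2 / (i.+1%:R * S%:R))); last by ring.
apply: le_trans (ler_normD _ _) _; rewrite lerD2l.
have Sr := natr_gt0 S0; have ir := natr_gt0 i0; have tr := natr_gt0 t0.
have iS' : i%:R * S%:R <= t%:R :> R by rewrite -natrM ler_nat.
have tS' : t%:R <= i.+1%:R * S%:R :> R.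
  by rewrite -natrM ler_nat /t mulSn addnC leq_add2r ltnW.
have ii : i.+1%:R = i%:R + 1 :> R by rewrite -natr1.
rewrite ii in tS' *.
move: Sr ir tr iS' tS'; move: (S%:R : R) (i%:R : R) (t%:R : R) => s x y s0 x0 y0 h1 h2.
have x1 : 0 < x + 1 by rewrite addr_gt0.
have xs0 : 0 < x * s by rewrite mulr_gt0.
rewrite (_ : 2 / y - 2 / ((x + 1) * s) = 2 * ((x + 1) * s - y) / (y * ((x + 1) * s))); last first.
  by field; rewrite !lt0r_neq0.
rewrite ger0_norm; last by rewrite divr_ge0 ?mulr_ge0 ?subr_ge0// ltW// mulr_gt0.
rewrite ler_pdivrMr ?mulr_gt0//.
rewrite (_ : 2 / (x * (x + 1) * s) * (y * ((x + 1) * s)) = 2 * y / x); last by field; rewrite !lt0r_neq0.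
by rewrite ler_pdivlMr//; nra.
Qed.

(** In the first cell [kap] need not be close to 2/r. Only the bound 224/r for [kap_main] is
    available, and the interpolation weight r/S compensates it: 338 = 112 + 224 + 2. *)
Let term20 : \sum_(r < S) r%:R / S%:R * `|kap R Q J (0 * S + r) - 2 / (1%:R * S%:R)| <= 338.
Proof.
have Sr := natr_gt0 S0.
apply: (@le_trans _ _ (\sum_(r < S) (r%:R / S%:R * `|kap R Q J r| + 2 / S%:R))).
  apply: ler_sum => r _; rewrite mul0n add0n mul1r.
  have rS : r%:R / S%:R <= 1 :> R by rewrite ler_pdivrMr// mul1r ler_nat ltnW.
  have rS0 : 0 <= r%:R / S%:R :> R by rewrite divr_ge0.
  have := ler_normB (kap R Q J r) (2 / S%:R).
  rewrite [X in _ <= _ + X -> _]ger0_norm ?divr_ge0//.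
  move: (r%:R / S%:R) rS rS0 => w w1 w0 h.
  apply: le_trans (ler_wpM2l w0 h) _; rewrite mulrDr lerD2l ler_piMl// divr_ge0//.
rewrite big_split /= sumr_const card_ord -[X in _ + X]mulr_natl.
have -> : S%:R * (2 / S%:R) = 2 :> R by field; rewrite lt0r_neq0.
have -> : (338 : R) = 336 + 2 by rewrite -natrD.
rewrite lerD2r.
apply: (@le_trans _ _ (\sum_(1 <= r < S) (`|kap R Q J r - kap_main r| + 224 / S%:R))).
  rewrite -(big_mkord xpredT (fun r => r%:R / S%:R * `|kap R Q J r|)).
  rewrite (big_cat_nat _ (n := 1))//= big_nat1 !mul0r add0r.
  rewrite big_nat [leRHS]big_nat; apply: ler_sum => r /andP[r0 rS].
  have rr := natr_gt0 r0; have Qr := natr_gt0 Q0.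
  have Rr : 0 < ((Q * 2 ^ J)%:R : R) by rewrite natr_gt0// muln_gt0 Q0 expn_gt0.
  have w1 : r%:R / S%:R <= 1 :> R by rewrite ler_pdivrMr// mul1r ler_nat ltnW.
  have w0 : 0 <= r%:R / S%:R :> R by rewrite divr_ge0.
  have mb : `|kap_main r| <= 224 / r%:R.
    rewrite /kap_main normrM normfV (ger0_norm (ltW rr)) ler_pM2r ?invr_gt0//.
    apply: le_trans (ler_normB _ _) _.
    have -> : (224 : R) = 112 + 112 by rewrite -natrD.
    by apply: lerD; apply: PPhi_bounded; rewrite divr_ge0// ltW.
  have h := ler_normD (kap R Q J r - kap_main r) (kap_main r); rewrite subrK in h.
  apply: le_trans (ler_wpM2l w0 h) _; rewrite mulrDr; apply: lerD.
    by rewrite ler_piMl.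
  apply: le_trans (ler_wpM2l w0 mb) _.
  by rewrite le_eqVlt; apply/orP; left; apply/eqP; field; rewrite !lt0r_neq0.
rewrite big_split /=.
have -> : (336 : R) = 112 + 224 by rewrite -natrD.
apply: lerD; first exact: sum_kap_err.
set c := 224 / _; rewrite sumr_const_nat -(mulr_natl c) {}/c mulrCA ler_piMr//.
by rewrite ler_pdivrMr// mul1r ler_nat leq_subr.
Qed.

Let w2 i : R := if i is 0 then 338 else 2 / (i%:R * i.+1%:R).

Let sum_w2 k : \sum_(i < k) w2 i <= 340.
Proof.
case: k => [|k]; first by rewrite big_ord0.
suff -> : \sum_(i < k.+1) w2 i = 340 - 2 / k.+1%:R by rewrite gerBl divr_ge0.
elim: k => [|k IH]; first by rewrite big_ord_recr big_ord0 /=; lra.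
rewrite big_ord_recr /= IH -(natr1 k.+1).
have := natr_gt0 (ltn0Sn k); move: (k.+1%:R : R) => x x0.
have x1 : 0 < x + 1 by rewrite addr_gt0.
by field; rewrite !lt0r_neq0.
Qed.

Let sum_w1 k : \sum_(i < k) 2 / (i.+1%:R ^+ 2 : R) <= 4.
Proof.
suff : \sum_(i < k) 2 / (i.+1%:R ^+ 2 : R) <= 4 - 4 / k.+1%:R.
  by move=> /le_trans; apply; rewrite gerBl divr_ge0.
elim: k => [|k IH]; first by rewrite big_ord0 divr1 subrr.
rewrite big_ord_recr /= -(natr1 k.+1).
apply: le_trans (lerD IH (lexx _)) _.
have : 1 <= (k.+1%:R : R) by rewrite ler1n.
move: (k.+1%:R : R) => x x1.
have x0 : 0 < x by lra.
have x10 : 0 < x + 1 by lra.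
rewrite -subr_ge0 (_ : _ - _ = (2 * (x - 1)) / (x ^+ 2 * (x + 1))).
  by rewrite divr_ge0 ?mulr_ge0 ?exprn_ge0 ?subr_ge0// ltW.
by field; rewrite !lt0r_neq0.
Qed.

(** 4152 = 1904 + 1904 + 4 + 340. The distance of [kap] to 2/t is counted once for each of the two
    cells that enter the interpolation; 4 and 340 pay for freezing 2/t at the common endpoint of the
    cells, with the first cell included in 340. *)
Lemma kap_interp_bound : \sum_(i < mm.-1) `|kap_interp i - 2 / i.+1%:R| <= 4152.
Proof.
have Sr := natr_gt0 S0.
have step1 i : `|kap_interp i - 2 / i.+1%:R| <=
    (\sum_(r < S) E (i.+1 * S + r) + 2 / (i.+1%:R ^+ 2)) + (\sum_(r < S) E (i * S + r) + w2 i).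
  have ir := natr_gt0 (ltn0Sn i).
  have -> : kap_interp i - 2 / i.+1%:R = \sum_(r < S)
     ((1 - r%:R / S%:R) * (kap R Q J (i.+1 * S + r) - 2 / (i.+1%:R * S%:R))
     + r%:R / S%:R * (kap R Q J (i * S + r) - 2 / (i.+1%:R * S%:R))).
    have -> : 2 / i.+1%:R = \sum_(r < S) (2 / (i.+1%:R * S%:R)) :> R.
      rewrite sumr_const card_ord -[RHS]mulr_natl; field.
      by rewrite !lt0r_neq0.
    by rewrite /kap_interp -sumrB; apply: eq_bigr => r _; ring.
  apply: le_trans (ler_norm_sum _ _ _) _.
  apply: (@le_trans _ _ (\sum_(r < S) (`|kap R Q J (i.+1 * S + r) - 2 / (i.+1%:R * S%:R)|
    + r%:R / S%:R * `|kap R Q J (i * S + r) - 2 / (i.+1%:R * S%:R)|))).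
    apply: ler_sum => r _.
    have w1 : r%:R / S%:R <= 1 :> R by rewrite ler_pdivrMr// mul1r ler_nat ltnW.
    have w0 : 0 <= r%:R / S%:R :> R by rewrite divr_ge0.
    move: (r%:R / S%:R) w1 w0 => w w1 w0.
    apply: le_trans (ler_normD _ _) _; rewrite !normrM (ger0_norm w0) lerD2r.
    by rewrite ler_piMl// ger0_norm ?subr_ge0// gerBl.
  have sumc (c : R) : \sum_(r < S) c / S%:R = c.
    by rewrite sumr_const card_ord -[LHS]mulr_natl; field; rewrite lt0r_neq0.
  rewrite big_split /=; apply: lerD.
    apply: le_trans (ler_sum _ (fun r _ => term1 i r)) _.
    rewrite big_split /= lerD2l -[leRHS]sumc; apply: ler_sum => r _.
    by rewrite invfM mulrA.
  case: i {ir} => [|i]; first by apply: le_trans term20 _; rewrite /= lerDr sumr_ge0.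
  apply: (@le_trans _ _ (\sum_(r < S) `|kap R Q J (i.+1 * S + r) - 2 / (i.+2%:R * S%:R)|)).
    apply: ler_sum => r _; rewrite ler_piMl// ler_pdivrMr// mul1r ler_nat.
    exact: ltnW.
  apply: le_trans (ler_sum _ (fun r _ => term2 r (ltn0Sn i))) _.
  rewrite big_split /= lerD2l -[leRHS]sumc; apply: ler_sum => r _.
  by rewrite invfM mulrA.
apply: (@le_trans _ _ (\sum_(i < mm.-1) ((\sum_(r < S) E (i.+1 * S + r) + 2 / (i.+1%:R ^+ 2))
    + (\sum_(r < S) E (i * S + r) + w2 i)))).
  by apply: ler_sum => i _; exact: step1.
rewrite !big_split /=.
have EE : \sum_(i < mm) \sum_(r < S) E (i * S + r) <= 1904.
  by rewrite -(sum_mul_nat _ _ E).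
have F0 i : 0 <= \sum_(r < S) E (i * S + r) by apply: sumr_ge0.
have E1 : \sum_(i < mm.-1) \sum_(r < S) E (i.+1 * S + r) <= 1904.
  apply: le_trans EE; case: (mm) => [|k] /=; first by rewrite !big_ord0.
  by rewrite [leRHS]big_ord_recl lerDr.
have E2 : \sum_(i < mm.-1) \sum_(r < S) E (i * S + r) <= 1904.
  apply: le_trans EE; case: (mm) => [|k] /=; first by rewrite !big_ord0.
  by rewrite [leRHS]big_ord_recr lerDl.
have := sum_w1 mm.-1; have := sum_w2 mm.-1; lra.
Qed.

End interpolated.
End kap_estimate.

End kernel.

(** * Roots of unity *)

Section trigonometry.
Context (R : realType).
Implicit Types (x y t : R).

Definition cis t : R[i] := cos t +i* sin t.

Lemma cis0 : cis 0 = 1.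
Proof. by rewrite /cis cos0 sin0. Qed.

Lemma cisD x y : cis (x + y) = cis x * cis y.
Proof. by rewrite /cis cosD sinD; apply/eqP; rewrite eq_complex /=; apply/andP; split; apply/eqP; ring. Qed.

Lemma cisX x n : cis x ^+ n = cis (x * n%:R).
Proof.
elim: n => [|n IH]; first by rewrite mulr0 cis0.
by rewrite exprS IH -cisD -natr1; congr cis; ring.
Qed.

Lemma cis_2pi n : cis (2 * pi * n%:R) = 1.
Proof.
rewrite -cisX (_ : cis (2 * pi) = 1) ?expr1n// /cis.
by rewrite mulr_natl cos2pi sin2pi.
Qed.

Lemma cabs_cis t : cabs (cis t) = 1.
Proof. by rewrite /cabs normc_def /= cos2Dsin2 sqrtr1. Qed.

Lemma cisVC t : (cis t)^-1 = cis (- t).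
Proof.
have e : cis t * cis (- t) = 1 by rewrite -cisD subrr cis0.
have n0 : cis t != 0 by apply: contra_eq_neq e => ->; rewrite mul0r eq_sym oner_eq0.
by apply: (mulfI n0); rewrite mulfV.
Qed.

Lemma sin_le_id x : 0 <= x -> sin x <= x.
Proof.
move=> x0; have [c _] := @MVT_segment R sin cos 0 x x0
  (fun y _ => is_derive_sin y) (continuous_subspaceT (@continuous_sin R)).
by rewrite sin0 !subr0 => ->; rewrite ler_piMl// cos_le1.
Qed.

Lemma cos_ge_quad x : 0 <= x -> 1 - x ^+ 2 <= cos x.
Proof.
move=> x0; have [c] := @MVT_segment R cos (fun y => - sin y) 0 x x0
  (fun y _ => is_derive_cos y) (continuous_subspaceT (@continuous_cos R)).
rewrite in_itv /= => /andP[c0 cx]; rewrite cos0 subr0 => e.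
have := sin_le_id c0; nra.
Qed.

Lemma sin_ge_cubic x : 0 <= x -> x - x ^+ 3 <= sin x.
Proof.
move=> x0; have [c] := @MVT_segment R sin cos 0 x x0
  (fun y _ => is_derive_sin y) (continuous_subspaceT (@continuous_sin R)).
rewrite in_itv /= sin0 !subr0 => /andP[c0 cx] ->.
have h := cos_ge_quad c0.
apply: (@le_trans _ _ ((1 - c ^+ 2) * x)); last by apply: ler_wpM2r.
have : c ^+ 2 <= x ^+ 2 by rewrite lerXn2r ?nnegrE.
rewrite [x ^+ 3]exprS; nra.
Qed.

Lemma cot_sub_inv x : 0 < x <= pi / 2 -> `|cos x / sin x - x^-1| <= 5.
Proof.
move=> /andP[x0 xpi].
have pi2 := pihalf_ge1 R.
have s1 := sin_le_id (ltW x0); have s2 := sin_ge_cubic (ltW x0); have c1 := cos_ge_quad (ltW x0).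
have c2 := cos_le1 x.
have [xh|xh] := leP x 2^-1.
  have s3 : 3 / 4 * x <= sin x.
    apply: le_trans s2; rewrite [x ^+ 3]exprS; nra.
  have s0 : 0 < sin x by apply: lt_le_trans s3; rewrite mulr_gt0.
  rewrite (_ : cos x / sin x - x^-1 = (x * cos x - sin x) / (sin x * x)); last first.
    by field; rewrite !lt0r_neq0.
  rewrite normrM normfV (ger0_norm (ltW (mulr_gt0 s0 x0))) ler_pdivrMr ?mulr_gt0//.
  have h1 : `|x * cos x - sin x| <= x ^+ 3.
    rewrite ler_norml [x ^+ 3]exprS; apply/andP; split; last first.
      rewrite [x ^+ 3]exprS in s2; nra.
    nra.
  apply: le_trans h1 _; rewrite [x ^+ 3]exprS.
  apply: (@le_trans _ _ (5 * (3 / 4 * x * x))); first nra.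
  by apply: ler_wpM2l => //; apply: ler_wpM2r => //; exact: ltW.
have s3 : 3 / 8 <= sin x.
  have h := @sin_ge_cubic 2^-1 ltac:(lra).
  apply: (@le_trans _ _ (sin 2^-1)); first by apply: le_trans h; lra.
  by apply: ltW; rewrite ltr_sin ?in_itv //=; apply/andP; split; lra.
have s0 : 0 < sin x by lra.
apply: le_trans (ler_normB _ _) _.
have xi : `|x^-1| <= 2.
  rewrite ger0_norm ?invr_ge0 ?(ltW x0)// -[2]invrK lef_pV2 ?posrE//; exact: ltW.
have ci : `|cos x / sin x| <= 3.
  rewrite normrM normfV (ger0_norm (ltW s0)) ler_pdivrMr//.
  have := cos_max x; lra.
lra.
Qed.

(** Both poles of the cotangent on [0, pi] are removed. The expression is odd under x -> pi - x, so
    half of the interval suffices, where the second pole costs at most 1. *)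
Lemma cot_bound x : 0 < x < pi -> `|cos x / sin x - x^-1 + (pi - x)^-1| <= 6.
Proof.
move=> /andP[x0 xpi]; have pi2 := pihalf_ge1 R.
wlog xh : x x0 xpi / x <= pi / 2.
  move=> W; have [h|h] := leP x (pi / 2); first exact: W.
  have y0 : 0 < pi - x by lra.
  have := W (pi - x) y0 ltac:(lra) ltac:(lra).
  have -> : cos (pi - x) = - cos x by rewrite cosB cospi sinpi; ring.
  have -> : sin (pi - x) = sin x by rewrite sinB cospi sinpi; ring.
  rewrite -normrN; congr (`|_| <= _).
  have -> : pi - (pi - x) = x by ring.
  ring.
apply: le_trans (ler_normD _ _) _.
have -> : (6 : R) = 5 + 1 by lra.
apply: lerD; first by apply: cot_sub_inv; rewrite x0.
rewrite ger0_norm ?invr_ge0; last lra.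
by rewrite invf_le1; lra.
Qed.

Definition alphaC : R[i] := 0 +i* (- (2 * pi)^-1).

(** With x = pi j / m one has w / (w - 1) = 1/2 - (i/2) cot x. The poles of cot at 0 and pi produce
    1/j and 1/(m - j), both with factor [alphaC] = -i / (2 pi); what remains is at most 1/2 + 6/2
    over m. *)
Lemma projection_kernel_approx (m j : nat) : (0 < j < m)%N ->
  let w := cis (2 * pi * j%:R / m%:R) in
  w != 1 /\
  cabs (w / (w - 1) / m%:R - alphaC * (j%:R^-1 - (m - j)%:R^-1 : R)%:C) <= 4 / m%:R.
Proof.
move=> /andP[j0 jm] w.
have m0 : (0 < m)%N by apply: leq_trans jm.
have mr : 0 < (m%:R : R) by rewrite ltr0n.
have jr : 0 < (j%:R : R) by rewrite ltr0n.
have pr := pi_gt0 R.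
have jmr : j%:R < m%:R :> R by rewrite ltr_nat.
pose x : R := pi * j%:R / m%:R.
have x0 : 0 < x by rewrite divr_gt0// mulr_gt0.
have xpi : x < pi by rewrite /x ltr_pdivrMr// ltr_pM2l.
have s0 : 0 < sin x by rewrite sin_gt0_pi// x0.
have wE : w = (cos x ^+ 2 - sin x ^+ 2) +i* (2 * (sin x * cos x)).
  rewrite /w (_ : 2 * pi * j%:R / m%:R = x + x); last by rewrite /x; ring.
  by rewrite /cis cosD sinD; congr (_ +i* _); ring.
have w1 : w - 1 = (- 2 * sin x ^+ 2) +i* (2 * (sin x * cos x)).
  rewrite wE; apply/eqP; rewrite eq_complex /=; apply/andP; split; apply/eqP; last by ring.
  by have := cos2Dsin2 x; lra.
have w1n0 : w - 1 != 0.
  rewrite w1 eq_complex /= negb_and; apply/orP; left.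
  have : 0 < sin x ^+ 2 by rewrite exprn_gt0.
  by move=> h; apply/eqP; lra.
split; first by rewrite -subr_eq0.
have qE : w / (w - 1) = 2^-1 +i* (- (cos x / sin x) / 2).
  apply: (mulIf w1n0); rewrite divfK// w1 wE; apply/eqP; rewrite eq_complex /=.
  by apply/andP; split; apply/eqP; field; rewrite lt0r_neq0.
have -> : w / (w - 1) / m%:R - alphaC * (j%:R^-1 - (m - j)%:R^-1 : R)%:C =
  (m%:R^-1)%:C * (2^-1 +i* (- 2^-1 * (cos x / sin x - x^-1 + (pi - x)^-1))).
  rewrite qE natrB ?(ltnW jm)// /alphaC -(rmorph_nat (real_complex R) m) -fmorphV /=.
  have mj : m%:R - j%:R != 0 :> R by rewrite subr_eq0 gt_eqF.
  apply/eqP; rewrite eq_complex /=; apply/andP; split; apply/eqP; first by ring.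
  have -> : pi - x = pi * (m%:R - j%:R) / m%:R by rewrite /x; move: (@pi R) => P; field; rewrite lt0r_neq0.
  rewrite /x; move: (cos _ / sin _) => ct.
  move: (@pi R) (lt0r_neq0 pr) => P P0; field.
  by rewrite mj P0 !lt0r_neq0.
rewrite cabsM cabs_real ger0_norm ?invr_ge0 ?(ltW mr)// mulrC.
apply: ler_wpM2r; first by rewrite invr_ge0 ltW.
have h := cot_bound (_ : 0 < x < pi).
have {}h := h ltac:(by rewrite x0).
move: h; move: (_ + _) => z h.
rewrite (_ : _ +i* _ = (2^-1 : R)%:C + (0 +i* 1) * (- 2^-1 * z)%:C); last first.
  by apply/eqP; rewrite eq_complex /=; apply/andP; split; apply/eqP; ring.
apply: le_trans (ler_cabsD _ _) _.
have ci : cabs (0 +i* 1 : R[i]) = 1.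
  by rewrite /cabs normc_def /= expr0n add0r expr1n sqrtr1.
rewrite cabsM ci !cabs_real mul1r.
have h2 : `|2^-1| = 2^-1 :> R by rewrite ger0_norm.
by rewrite normrM normrN h2; lra.
Qed.

End trigonometry.

(** * Rademacher sums *)

Section mixing.
Context (R : realType) (X : completeNormedModType R[i]) (p : R).
Hypothesis p1 : 1 < p.
Context (K : nat) (I : finType).
Local Notation IK := {ffun 'I_K -> I}.
Context (w : 'I_K -> I -> R).
Hypothesis w0 : forall k i, 0 <= w k i.
Hypothesis w1 : forall k, \sum_i w k i = 1.

Definition wprod (io : {ffun 'I_K -> I}) : R := \prod_k w k (io k).

Lemma sum_wprod : \sum_io wprod io = 1.
Proof. by rewrite /wprod -(bigA_distr_bigA w) big1. Qed.

Lemma sum_wprod_cond k0 i : \sum_(io : IK | io k0 == i) wprod io = w k0 i.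
Proof.
rewrite big_mkcond /=.
pose w' k j := w k j * ((k == k0) ==> (j == i))%:R.
rewrite (eq_bigr (fun io : IK => \prod_k w' k (io k))); last first.
  move=> io _; rewrite /w' big_split /= -/(wprod io).
  have -> : \prod_(k : 'I_K) ((k == k0) ==> (io k == i))%:R = (io k0 == i)%:R :> R.
    rewrite (bigD1 k0)//= eqxx /= big1 ?mulr1// => k nk.
    by rewrite (negbTE nk).
  by case: ifP => _; rewrite ?mulr1 ?mulr0.
rewrite -(bigA_distr_bigA w') (bigD1 k0)//= [X in _ * X]big1 ?mulr1.
  rewrite /w' eqxx /= (bigD1 i)//= eqxx mulr1 big1 ?addr0// => j nj.
  by rewrite (negbTE nj) mulr0.
move=> k nk; rewrite -[RHS](w1 k); apply: eq_bigr => j _.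
by rewrite /w' (negbTE nk) mulr1.
Qed.

(** A different convex combination in each coordinate is the mean, over independent choices, of sums
    with a single choice per coordinate. By the triangle inequality only such sums need a bound. *)
Lemma marginal (f : 'I_K -> I -> X) :
  \sum_(io : IK) (wprod io)%:C *: \sum_k f k (io k) = \sum_k \sum_i (w k i)%:C *: f k i.
Proof.
under eq_bigr do rewrite scaler_sumr.
rewrite exchange_big /=; apply: eq_bigr => k _.
rewrite (partition_big (fun io : IK => io k) predT)//=; apply: eq_bigr => i _.
rewrite -sum_wprod_cond rmorph_sum scaler_suml.
by apply: eq_bigr => io /eqP ->.
Qed.

Lemma lpn_mix (T : finType) (f : 'I_K -> I -> T -> X) (c : R) :
  (forall io : IK, lpn p (fun t => \sum_k f k (io k) t) <= c) ->
  lpn p (fun t => \sum_k \sum_i (w k i)%:C *: f k i t) <= c.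
Proof.
move=> h.
rewrite (eq_lpn p (G := fun t => \sum_(io : IK) (wprod io)%:C *: \sum_k f k (io k) t)); last first.
  by move=> t; rewrite (marginal (fun k i => f k i t)).
have wp0 io : 0 <= wprod io by apply: prodr_ge0.
apply: le_trans (lpn_sum p1 _ _ _) _.
apply: (@le_trans _ _ (\sum_(io : IK) wprod io * c)).
  apply: ler_sum => io _; rewrite lpnZr// ger0_norm//.
  by apply: ler_wpM2l.
by rewrite -mulr_suml sum_wprod mul1r.
Qed.

End mixing.

Section rademacher_sums.
Context (R : realType) (X : completeNormedModType R[i]) (p : R).
Hypothesis p1 : 1 < p.
Context (K : nat) (A : finType).
Local Notation V := {ffun 'I_K -> A}.
Local Notation E := {ffun 'I_K -> bool}.
Implicit Types (x : 'I_K -> A -> X).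

Definition rad x (ey : {ffun 'I_K -> bool} * {ffun 'I_K -> A}) : X :=
  \sum_k (sgb R (ey.1 k))%:C *: x k (ey.2 k).

Lemma eq_rad x x' : (forall k a, x k a = x' k a) -> lpn p (rad x) = lpn p (rad x').
Proof. by move=> h; apply: eq_lpn => ey; apply: eq_bigr => k _; rewrite h. Qed.

Lemma radD x x' : lpn p (rad (fun k a => x k a + x' k a)) <= lpn p (rad x) + lpn p (rad x').
Proof.
apply: le_trans (lpnD p1 _ _); rewrite le_eqVlt; apply/orP; left; apply/eqP.
by apply: eq_lpn => ey; rewrite -big_split /=; apply: eq_bigr => k _; rewrite scalerDr.
Qed.

Lemma radZ (c : R[i]) x : lpn p (rad (fun k a => c *: x k a)) = cabs c * lpn p (rad x).
Proof.
rewrite -(lpnZ p1); apply: eq_lpn => ey; rewrite /rad scaler_sumr; apply: eq_bigr => k _.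
by rewrite !scalerA mulrC.
Qed.

Lemma radB x x' : lpn p (rad (fun k a => x k a - x' k a)) <= lpn p (rad x) + lpn p (rad x').
Proof.
rewrite -[X in _ + X]mul1r -(cabs1 R) -[cabs 1]cabsN -radZ.
apply: le_trans (radD _ _); rewrite le_eqVlt; apply/orP; left; apply/eqP.
by apply: eq_rad => k a; rewrite scaleN1r.
Qed.

Lemma contraction_fixed (z : 'I_K -> X) (a : 'I_K -> R) : (forall k, `|a k| <= 1) ->
  lpn p (fun eps : E => \sum_k (sgb R (eps k))%:C *: ((a k)%:C *: z k)) <=
  lpn p (fun eps : E => \sum_k (sgb R (eps k))%:C *: z k).
Proof.
move=> a1.
(* Law of a random sign of mean [a k]. Once these signs are chosen, they merely permute the
   [eps]. *)
pose w k (s : bool) := (1 + sgb R s * a k) / 2.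
have w0 k s : 0 <= w k s.
  have := a1 k; rewrite ler_norml /w /sgb => /andP[? ?].
  by case: s; rewrite divr_ge0//; lra.
have w1 k : \sum_s w k s = 1 by rewrite big_bool /w /sgb /=; field.
rewrite (eq_lpn p (G := fun eps : E => \sum_k \sum_s (w k s)%:C *: ((sgb R (eps k (+) s))%:C *: z k))); last first.
  move=> eps; apply: eq_bigr => k _; rewrite big_bool /= !scalerA -scalerDl; congr (_ *: _).
  rewrite -!rmorphM -rmorphD /=; congr (_%:C).
  by rewrite !sgb_addb /w /sgb /=; field.
apply: (@lpn_mix _ _ _ p1 _ _ w w0 w1 _ (fun k s (eps : E) => (sgb R (eps k (+) s))%:C *: z k)) => io.
pose h (eps : E) : E := [ffun k => eps k (+) io k].
have hK : involutive h by move=> eps; apply/ffunP => k; rewrite !ffunE -addbA addbb addbF.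
rewrite -(lpn_reindexT p (fun eps : E => \sum_k (sgb R (eps k))%:C *: z k) (can_inj hK)).
apply: eq_lpn_le => eps.
by apply: eq_bigr => k _; rewrite ffunE.
Qed.

Lemma contraction_real x (a : 'I_K -> A -> R) : (forall k y, `|a k y| <= 1) ->
  lpn p (rad (fun k y => (a k y)%:C *: x k y)) <= lpn p (rad x).
Proof.
move=> a1; rewrite -[leRHS]mul1r; apply: (lpn_pair_le p1 ler01) => y; rewrite mul1r.
exact: (contraction_fixed (fun k => x k (y k)) (fun k => a1 k (y k))).
Qed.

Lemma contraction x (a : 'I_K -> A -> R[i]) : (forall k y, cabs (a k y) <= 1) ->
  lpn p (rad (fun k y => a k y *: x k y)) <= 2 * lpn p (rad x).
Proof.
move=> a1.
rewrite (@eq_rad _ (fun k y => (complex.Re (a k y))%:C *: x k y + 'i *: ((complex.Im (a k y))%:C *: x k y))); last first.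
  by move=> k y; rewrite scalerA -scalerDl {1}(complexE (a k y)).
apply: le_trans (radD _ _) _; rewrite mulr2n mulrDl mul1r; apply: lerD.
  by apply: contraction_real => k y; apply: le_trans (Re_le_cabs _) _.
rewrite radZ (_ : cabs 'i = 1) ?mul1r.
  by apply: contraction_real => k y; apply: le_trans (Im_le_cabs _) _.
by rewrite /cabs normc_def /= expr0n add0r expr1n sqrtr1.
Qed.

Lemma rad_convolution x (I : finType) (w : 'I_K -> I -> R) (sigma : 'I_K -> I -> A -> A) :
  (forall k i, 0 <= w k i) -> (forall k, \sum_i w k i = 1) ->
  (forall k i, injective (sigma k i)) ->
  lpn p (rad (fun k y => \sum_i (w k i)%:C *: x k (sigma k i y))) <= lpn p (rad x).
Proof.
move=> w0 w1 isig.
rewrite (eq_lpn p (G := fun ey : E * V => \sum_k \sum_i (w k i)%:C *: ((sgb R (ey.1 k))%:C *: x k (sigma k i (ey.2 k))))); last first.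
  move=> ey; apply: eq_bigr => k _; rewrite scaler_sumr; apply: eq_bigr => i _.
  by rewrite !scalerA mulrC.
apply: (lpn_mix p1 w0 w1) => io.
pose h (ey : E * V) : E * V := (ey.1, [ffun k => sigma k (io k) (ey.2 k)]).
have hi : injective h.
  move=> [e y] [e' y'] h'; have := congr1 fst h'; have := congr1 snd h' => /= /ffunP hy ->.
  by congr (_, _); apply/ffunP => k; have := hy k; rewrite !ffunE => /isig.
rewrite -(lpn_reindexT p (rad x) hi); apply: eq_lpn_le => ey.
by apply: eq_bigr => k _; rewrite ffunE.
Qed.

(** The moduli divided by [W] form a sub-probability; the extra index [None], with multiplier 0,
    takes the missing mass. The phases are left to [contraction], whence the factor 2. *)
Lemma rad_kernel x (I : finType) (e : 'I_K -> I -> R[i]) (sigma : 'I_K -> I -> A -> A) (W : R) :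
  0 < W -> (forall k, \sum_i cabs (e k i) <= W) ->
  (forall k i, injective (sigma k i)) ->
  lpn p (rad (fun k y => \sum_i e k i *: x k (sigma k i y))) <= 2 * W * lpn p (rad x).
Proof.
move=> W0 eW isig.
pose w k (o : option I) := if o is Some i then cabs (e k i) / W else 1 - (\sum_i cabs (e k i)) / W.
pose ph k (o : option I) : R[i] := if o is Some i then e k i / (cabs (e k i))%:C else 0.
pose sg k (o : option I) : A -> A := if o is Some i then sigma k i else id.
have w0 k o : 0 <= w k o.
  case: o => [i|] /=; first by rewrite divr_ge0 ?cabs_ge0// ltW.
  by rewrite subr_ge0 ler_pdivrMr// mul1r.
have sum_option (U : nmodType) (f : option I -> U) : \sum_o f o = f None + \sum_i f (Some i).
  rewrite (bigD1 None)//=; congr (_ + _).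
  by rewrite (reindex_omap Some id)//=; [apply: eq_bigl => i; rewrite eqxx|case].
have w1 k : \sum_o w k o = 1.
  by rewrite sum_option /= mulr_suml subrK.
rewrite (@eq_rad _ (fun k y => (W%:C : R[i]) *: \sum_o (w k o)%:C *: (ph k o *: x k (sg k o y)))); last first.
  move=> k y; rewrite sum_option /= scale0r scaler0 add0r scaler_sumr; apply: eq_bigr => i _.
  rewrite !scalerA; congr (_ *: _).
  have [e0|e0] := eqVneq (e k i) 0; first by rewrite e0 mul0r mulr0.
  have c0 : cabs (e k i) != 0 by rewrite cabs_eq0.
  rewrite -rmorphM /= (_ : W * (cabs (e k i) / W) = cabs (e k i)).
    by rewrite mulrC divfK// (inj_eq (@complexI R) _ 0).
  by field; rewrite lt0r_neq0.
rewrite radZ cabs_real (ger0_norm (ltW W0)) -(mulrA 2) (mulrCA 2).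
apply: ler_wpM2l; first exact: ltW.
rewrite (eq_lpn p (G := fun ey : E * V => \sum_k \sum_o (w k o)%:C *: ((sgb R (ey.1 k))%:C *: (ph k o *: x k (sg k o (ey.2 k)))))); last first.
  move=> ey; apply: eq_bigr => k _; rewrite scaler_sumr; apply: eq_bigr => i _.
  by rewrite !scalerA; congr (_ *: _); ring.
apply: (lpn_mix p1 w0 w1) => io.
have isg k o : injective (sg k o) by case: o => [i|] /=; [exact: isig|exact: inj_id].
pose h (ey : E * V) : E * V := (ey.1, [ffun k => sg k (io k) (ey.2 k)]).
have hi : injective h.
  move=> [e1 y] [e' y'] h'; have := congr1 fst h'; have := congr1 snd h' => /= /ffunP hy ->.
  by congr (_, _); apply/ffunP => k; have := hy k; rewrite !ffunE => /isg.
have hc := @contraction x (fun k _ => ph k (io k)).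
apply: le_trans (hc _); last first.
  move=> k _; case: (io k) => [i|] /=; last by rewrite cabs0.
  rewrite cabsM cabsV cabs_real (ger0_norm (cabs_ge0 _)).
  have [e0|e0] := eqVneq (cabs (e k i)) 0; first by rewrite e0 mul0r.
  by rewrite mulfV.
rewrite -(lpn_reindexT p (rad (fun k y => ph k (io k) *: x k y)) hi).
apply: eq_lpn_le => ey.
by apply: eq_bigr => k _; rewrite ffunE.
Qed.

End rademacher_sums.

(** Makes (Z/N)^K a finite abelian group, to which [lpn_kap_op] is applied as a whole in
    [rad_kap]. *)
HB.instance Definition _ (I : finType) (A : finZmodType) := GRing.Zmodule.on {ffun I -> A}.

(** * Step functions on Z/N and the discrete Hilbert transform *)

Section periodic.
Context (T : Type) (U : nat -> T) (m S : nat).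
Hypothesis Um : forall j, U (j + m) = U j.

Lemma periodic_mul q j : U (q * m + j) = U j.
Proof. by elim: q => [|q IH]; rewrite ?add0n// mulSn -addnA addnC Um. Qed.

Lemma periodic_step_mod n : (0 < S)%N -> U ((n %% (m * S)) %/ S) = U (n %/ S).
Proof.
move=> S0; rewrite [in RHS](divn_eq n (m * S)) mulnA divnMDl//.
by rewrite periodic_mul.
Qed.

Lemma periodic_step_add N (y : 'Z_N) n : (1 < N)%N -> (0 < S)%N -> N = (m * S)%N ->
  U ((y + n%:R : 'Z_N)%R %/ S) = U ((y + n) %/ S).
Proof.
move=> N1 S0 NE; rewrite -[y in LHS]natr_Zp -natrD val_Zp_nat// {2}NE.
exact: periodic_step_mod.
Qed.

Lemma periodic_step_sub N (y : 'Z_N) n : (1 < N)%N -> (0 < S)%N -> N = (m * S)%N -> (n <= N)%N ->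
  U ((y - n%:R : 'Z_N)%R %/ S) = U ((y + (N - n)) %/ S).
Proof.
move=> N1 S0 NE nN; rewrite -periodic_step_add//; congr (U (_ %/ _)%N).
by rewrite natrB// pchar_Zp// sub0r.
Qed.

End periodic.

Section step_functions.
Context (R : realType) (X : completeNormedModType R[i]).
Implicit Types (U : nat -> X).

(** For [U] of period [m] and [j <= m] the second argument stands for q - j, kept in [nat]. *)
Definition refl_diff U (m q j : nat) : X := U (q + j)%N - U (q + (m - j))%N.

Definition hilbert_sum U (m q : nat) : X :=
  \sum_(i < m.-1) (i.+1%:R^-1)%:C *: refl_diff U m q i.+1.

Lemma sum_lt_split S t (a c : X) : (t <= S)%N ->
  \sum_(r < S) (if (r < t)%N then a else c) = a *+ t + c *+ (S - t).
Proof.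
move=> /subnKC; move: (S - t)%N => d <-; rewrite big_split_ord /=; congr (_ + _).
  by under eq_bigr => i _ do rewrite ltn_ord; rewrite sumr_const card_ord.
under eq_bigr => i _ do rewrite ltnNge leq_addr.
by rewrite sumr_const card_ord.
Qed.

(** Of the [S] points of a cell, a translation by [j * S + t] leaves [S - t] in the cell at distance
    [j] and pushes [t] into the next one. *)
Lemma cell_sum_add U S q j t : (t < S)%N ->
  \sum_(r < S) U ((q * S + r + (j * S + t)) %/ S)%N =
  U (q + j)%N *+ (S - t) + U (q + j.+1)%N *+ t.
Proof.
move=> tS; have S0 : (0 < S)%N by lia.
rewrite (eq_bigr (fun r : 'I_S => if (r < S - t)%N then U (q + j)%N else U (q + j.+1)%N)).
  by rewrite sum_lt_split ?leq_subr// subKn// ltnW.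
move=> r _; have -> : (q * S + r + (j * S + t) = (q + j) * S + (r + t))%N by ring.
rewrite divnMDl//; have rS := ltn_ord r; case: ltnP => h.
  by rewrite divn_small ?addn0//; lia.
have -> : (r + t = 1 * S + (r + t - S))%N by lia.
by rewrite divnMDl// divn_small ?addn0 ?addn1 ?addnS//; lia.
Qed.

Lemma cell_sum_sub U S m q j t : (t < S)%N -> (j < m)%N ->
  \sum_(r < S) U ((q * S + r + (m * S - (j * S + t))) %/ S)%N =
  U (q + (m - j))%N *+ (S - t) + U (q + (m - j.+1))%N *+ t.
Proof.
move=> tS jm; have S0 : (0 < S)%N by lia.
rewrite (eq_bigr (fun r : 'I_S => if (r < t)%N then U (q + (m - j.+1))%N else U (q + (m - j))%N)).
  by rewrite (sum_lt_split _ _ (ltnW tS)) addrC.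
move=> r _; have -> : (q * S + r + (m * S - (j * S + t)) = (q + (m - j.+1)) * S + (S + r - t))%N.
  have : (j * S + S <= m * S)%N by rewrite -mulSnr leq_mul2r jm orbT.
  by rewrite mulnDl mulnBl mulSn; lia.
rewrite divnMDl//; have rS := ltn_ord r; case: ltnP => h.
  by rewrite divn_small ?addn0//; lia.
have -> : (S + r - t = 1 * S + (r - t))%N by lia.
rewrite divnMDl// divn_small; last by lia.
by congr U; lia.
Qed.

(** The difference at distance i + 1 receives contributions from translations starting in cell i + 1
    and in cell i, which together are [kap_interp]. The end terms at distances 0 and [m] vanish by
    periodicity. *)
Lemma kap_cell_average U Q J m S q : (0 < S)%N -> (0 < m)%N -> (forall j, U (j + m)%N = U j) ->
  \sum_(r < S) (S%:R^-1)%:C *: (\sum_(n < m * S) (kap R Q J n)%:C *: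
    (U ((q * S + r + n) %/ S)%N - U ((q * S + r + (m * S - n)) %/ S)%N)) =
  \sum_(i < m.-1) (kap_interp R Q J S i)%:C *: refl_diff U m q i.+1.
Proof.
move=> S0 m0 Um; rewrite -scaler_sumr exchange_big /=.
under eq_bigr do rewrite -scaler_sumr.
have -> : \sum_(n < m * S) (kap R Q J n)%:C *: (\sum_(r < S)
    (U ((q * S + r + n) %/ S)%N - U ((q * S + r + (m * S - n)) %/ S)%N)) =
  \sum_(j < m) \sum_(t < S) (kap R Q J (j * S + t))%:C *:
     (refl_diff U m q j *+ (S - t) + refl_diff U m q j.+1 *+ t).
  rewrite (sum_mul_nat m S (fun n => (kap R Q J n)%:C *: \sum_(r < S)
    (U ((q * S + r + n) %/ S)%N - U ((q * S + r + (m * S - n)) %/ S)%N))).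
  apply: eq_bigr => j _; apply: eq_bigr => t _.
  congr (_ *: _); rewrite sumrB cell_sum_add// cell_sum_sub// /refl_diff !mulrnBl opprD.
  by rewrite addrACA.
have r0 : refl_diff U m q 0 = 0 by rewrite /refl_diff subn0 addn0 Um subrr.
have rm : refl_diff U m q m = 0 by rewrite /refl_diff subnn addn0 Um subrr.
have -> : \sum_(j < m) \sum_(t < S) (kap R Q J (j * S + t))%:C *:
     (refl_diff U m q j *+ (S - t) + refl_diff U m q j.+1 *+ t) =
   \sum_(j < m) (\sum_(t < S) (kap R Q J (j * S + t))%:C *: (refl_diff U m q j *+ (S - t))) +
   \sum_(j < m) (\sum_(t < S) (kap R Q J (j * S + t))%:C *: (refl_diff U m q j.+1 *+ t)).
  rewrite -big_split; apply: eq_bigr => j _; rewrite -big_split; apply: eq_bigr => t _.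
  by rewrite scalerDr.
rewrite scalerDr.
case: m m0 Um rm r0 => // m' _ Um rm r0.
rewrite [in X in X + _]big_ord_recl /= [X in _ *: (X + _)]big1 ?add0r; last by move=> t _; rewrite r0 mul0rn scaler0.
rewrite [in X in _ + X]big_ord_recr /= [X in _ + _ *: (_ + X)]big1 ?addr0; last first.
  by move=> t _; rewrite rm mul0rn scaler0.
rewrite -scalerDr -big_split /= scaler_sumr; apply: eq_bigr => i _.
rewrite -big_split /= /kap_interp rmorph_sum scaler_suml scaler_sumr; apply: eq_bigr => t _.
rewrite /bump add1n; move: (refl_diff _ _ _ _) => D.
rewrite -(scaler_nat (S - t) D) -(scaler_nat t D) scalerDr !scalerA -scalerDl; congr (_ *: _).
rewrite -(rmorph_nat (real_complex R) (S - t)) -(rmorph_nat (real_complex R) t).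
rewrite -!(rmorphM (real_complex R)) -rmorphD; congr (_%:C) => /=.
rewrite natrB ?(ltnW (ltn_ord t))//.
have Sr : S%:R != 0 :> R by rewrite pnatr_eq0 -lt0n.
by move: (S%:R : R) Sr (t%:R : R) (kap _ _ _ _) (kap _ _ _ _) => s s0 u v w; field.
Qed.

End step_functions.

Lemma sum_rotate (V : nmodType) (S r : nat) (F : nat -> V) : (0 < S)%N ->
  \sum_(s < S) F ((r + s) %% S)%N = \sum_(s < S) F s.
Proof.
move=> S0; pose h (s : 'I_S) : 'I_S := Ordinal (ltn_pmod (r + s) S0).
rewrite [RHS](reindex_inj (h := h))// => s s' /(congr1 val) /= /eqP.
by rewrite eqn_modDl !modn_small// => /eqP/val_inj.
Qed.

Section cell_rotation.
Context (N S m : nat).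
Hypotheses (N1 : (1 < N)%N) (S0 : (0 < S)%N) (NE : N = (m * S)%N).

(* Averaging over these rotations of a cell replaces a kernel on Z/N by its
   linear interpolation at multiples of S. *)
Definition cell_rot (s : nat) (y : 'Z_N) : 'Z_N := (y %/ S * S + (y %% S + s) %% S)%:R.

Lemma val_cell_rot s y : cell_rot s y = (y %/ S * S + (y %% S + s) %% S)%N :> nat.
Proof.
have yN : (y < N)%N by have := ltn_ord y; rewrite [X in (_ < X)%N]Zp_cast.
rewrite val_Zp_nat// modn_small// [X in (_ < X)%N]NE.
apply: (@leq_trans ((y %/ S).+1 * S)); first by rewrite mulSnr ltn_add2l ltn_mod.
by rewrite leq_mul2r ltn_divLR// -NE yN orbT.
Qed.

Lemma cell_rot_inj s : injective (cell_rot s).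
Proof.
move=> y y' /(congr1 (@nat_of_ord _)); rewrite !val_cell_rot => h.
have hd := congr1 (divn^~ S) h; have hm := congr1 (modn^~ S) h; move: hd hm => /=.
rewrite !divnMDl// !modnMDl !modn_mod !(divn_small (ltn_pmod _ S0)) !addn0 => hd /eqP.
rewrite eqn_modDr !modn_mod => /eqP hm; apply: val_inj => /=.
by rewrite [LHS](divn_eq _ S) [RHS](divn_eq _ S) hd hm.
Qed.

End cell_rotation.

Section hilbert.
Context (R : realType) (X : completeNormedModType R[i]) (p : R) (b : R).
Hypotheses (p1 : 1 < p) (hb : UMD_bound X p b) (b1 : 1 <= b).
Context (K N Q J : nat) (m S : 'I_K -> nat).
Hypotheses (N1 : (1 < N)%N) (Q0 : (0 < Q)%N) (JQ : (J <= Q)%N).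
Hypothesis levels : forall l, (l < J)%N -> (4 * (2 * Q * 2 ^ l) <= N)%N.
Hypothesis NQ : (N <= 16 * (Q * 2 ^ J))%N.
Hypotheses (QS : forall k, (4 * Q <= S k)%N) (NE : forall k, N = (m k * S k)%N).
Implicit Types U : 'I_K -> nat -> X.

Let S0 k : (0 < S k)%N. Proof. by apply: leq_trans (QS k); rewrite muln_gt0 Q0. Qed.
Let m0 k : (0 < m k)%N. Proof. by have := ltnW N1; rewrite (NE k) muln_gt0 => /andP[]. Qed.
Let b20 : 0 <= b ^+ 2. Proof. exact: sqr_ge0. Qed.
Let b21 : 1 <= b ^+ 2. Proof. by rewrite expr_ge1 // (le_trans ler01). Qed.

(** For fixed signs, the Rademacher sum is a function on the group (Z/N)^K, and translating it by
    multiples of (1,...,1) translates every summand in its own variable. The vector-valued bound for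
    one operator is thus a bound for all coordinates together. *)
Lemma rad_kap (x : 'I_K -> 'Z_N -> X) :
  lpn p (rad (fun k => kap_op 1 Q J N (x k))) <= 32 * b ^+ 2 * lpn p (rad x).
Proof.
pose sw (u : {ffun 'I_K -> 'Z_N} * {ffun 'I_K -> bool}) := (u.2, u.1).
have swb : bijective sw by exists (fun u => (u.2, u.1)) => -[].
rewrite -(lpn_reindex p (rad (fun k => kap_op 1 Q J N (x k))) swb) -(lpn_reindex p (rad x) swb).
apply: lpn_pair_le => // [|e]; first by rewrite mulr_ge0.
pose one : {ffun 'I_K -> 'Z_N} := [ffun _ => 1].
apply: le_trans (lpn_kap_op p1 hb one (fun v => rad x (sw (v, e))) Q0 levels).
apply: eq_lpn_le => v; rewrite /rad /kap_op /=.
under [RHS]eq_bigr => n _.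
  rewrite -sumrB scaler_sumr; over.
rewrite exchange_big /=; apply: eq_bigr => k _; rewrite scaler_sumr; apply: eq_bigr => n _.
rewrite -scalerBr !scalerA mulrC; congr (_ *: (x k _ - x k _)).
  by rewrite ffunE ffunMnE ffunE.
by rewrite !ffunE ffunMnE ffunE.
Qed.

(** Twice the Hilbert sum is the interpolated operator [Y] minus an error whose kernel has l1-norm
    at most 2 * 4152. With 32 from [rad_kap], this gives 8320 = (32 + 4 * 4152) / 2. *)
Lemma rad_hilbert U : (forall k j, U k (j + m k)%N = U k j) ->
  lpn p (rad (fun k (y : 'Z_N) => hilbert_sum (U k) (m k) (y %/ S k))) <=
  8320 * b ^+ 2 * lpn p (rad (fun k (y : 'Z_N) => U k (y %/ S k)%N)).
Proof.
move=> Um; set x := fun k (y : 'Z_N) => U k (y %/ S k)%N.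
pose kt k i := kap_interp R Q J (S k) i.
pose Y k (y : 'Z_N) := \sum_(i < (m k).-1) (kt k i)%:C *: refl_diff (U k) (m k) (y %/ S k) i.+1.
(* The lemmas on Rademacher sums need one index type for all coordinates, so sums whose length
   depends on [k] are padded with zeros up to [N]; [sumN] removes the padding. *)
pose w k (s : 'I_N) : R := if (s < S k)%N then (S k)%:R^-1 else 0.
have SN k : (S k <= N)%N by rewrite (NE k) leq_pmull.
have sumN (V : nmodType) n (F : nat -> V) : (n <= N)%N ->
    \sum_(s < N) (if (s < n)%N then F s else 0) = \sum_(s < n) F s.
  by move=> nN; rewrite (big_ord_widen _ F nN) [RHS]big_mkcond.
have hY : lpn p (rad Y) <= 32 * b ^+ 2 * lpn p (rad x).
  apply: le_trans (rad_kap x).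
  have w0 k s : 0 <= w k s by rewrite /w; case: ifP => // _; rewrite invr_ge0.
  have w1 k : \sum_s w k s = 1.
    rewrite (sumN _ _ (fun=> (S k)%:R^-1))// sumr_const card_ord -[_ *+ _]mulr_natl mulfV//.
    by rewrite pnatr_eq0 -lt0n.
  have := rad_convolution p1 (fun k => kap_op 1 Q J N (x k)) w0 w1
    (fun k (s : 'I_N) => @cell_rot_inj N (S k) (m k) N1 (S0 k) (NE k) s).
  apply: le_trans; rewrite le_eqVlt; apply/orP; left; apply/eqP; apply: eq_rad => k y.
  rewrite /Y -kap_cell_average//.
  pose G r : X := (((S k)%:R^-1)%:C : R[i]) *: (\sum_(n < m k * S k) (kap R Q J n)%:C *:
    (U k ((y %/ S k * S k + r + n) %/ S k)%N - U k ((y %/ S k * S k + r + (m k * S k - n)) %/ S k)%N)).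
  rewrite -(sum_rotate (y %% S k) G)// -(sumN _ _ (fun s => G ((y %% S k + s) %% S k)%N))//.
  apply: eq_bigr => s _; rewrite /w; case: ifP => _; last by rewrite scale0r.
  rewrite /G; congr (_ *: _); rewrite /kap_op -NE; apply: eq_bigr => n _; congr (_ *: (_ - _)).
    by rewrite /x (periodic_step_add (Um k))// (@val_cell_rot N (S k) (m k)).
  by rewrite /x (periodic_step_sub (Um k))// ?(@val_cell_rot N (S k) (m k))// ltnW.
pose e k (ib : 'I_N * bool) : R[i] := if (ib.1 < (m k).-1)%N then
  ((if ib.2 then -1 else 1) * (kt k ib.1 - 2 / ib.1.+1%:R))%:C else 0.
pose sg k (ib : 'I_N * bool) (y : 'Z_N) : 'Z_N :=
  if ib.2 then y - (ib.1.+1 * S k)%:R else y + (ib.1.+1 * S k)%:R.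
have mN k : ((m k).-1 <= N)%N by rewrite (leq_trans (leq_pred _))// (NE k) leq_pmulr.
pose Err k y := \sum_ib e k ib *: x k (sg k ib y).
have [W W0 WE] : exists2 W : R, 0 < W & W = 4152.
  by exists 4152; [rewrite ltr0n; exact: isT|exact: erefl].
have hE : lpn p (rad Err) <= 2 * (2 * W) * lpn p (rad x).
  apply: rad_kernel => [//||k|k ib]; first exact: mulr_gt0.
    rewrite sum_pair /= big_bool -big_split /= /e /=.
    rewrite (_ : \sum_(i < N) _ = \sum_(i < (m k).-1) 2 * `|kt k i - 2 / i.+1%:R|).
      rewrite -mulr_sumr; apply: ler_wpM2l => //.
      rewrite WE; apply: kap_interp_bound => //; last by rewrite -NE.
    rewrite -(sumN _ _ (fun i => 2 * `|kt k i - 2 / i.+1%:R|))//; apply: eq_bigr => i _.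
    case: ifP => _; last by rewrite cabs0 addr0.
    by rewrite !cabs_real mul1r mulN1r normrN [RHS]mulr_natl mulr2n.
  by rewrite /sg; case: ib.2 => y y' /addIr.
have -> : lpn p (rad (fun k (y : 'Z_N) => hilbert_sum (U k) (m k) (y %/ S k)%N)) =
   lpn p (rad (fun k (y : 'Z_N) => (2^-1 : R)%:C *: (Y k y - Err k y))).
  apply: eq_rad => k y.
  have -> : Err k y = \sum_(i < (m k).-1) (kt k i - 2 / i.+1%:R)%:C *: refl_diff (U k) (m k) (y %/ S k) i.+1.
    rewrite /Err sum_pair /= big_bool -big_split /=.
    rewrite -(sumN _ _ (fun i => (kt k i - 2 / i.+1%:R)%:C *: refl_diff (U k) (m k) (y %/ S k) i.+1))//.
    apply: eq_bigr => i _; rewrite /e /=; case: ifP => im; last by rewrite !scale0r addr0.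
    rewrite mul1r mulN1r rmorphN scaleNr addrC -scalerBr; congr (_ *: (_ - _)).
      by rewrite [LHS](periodic_step_add (Um k) y _ N1 (S0 k) (NE k)) divnDr ?dvdn_mull// mulnK.
    have imN : (i.+1 * S k <= N)%N by rewrite [X in (_ <= X)%N](NE k) leq_mul2r (leq_trans im (leq_pred _)) orbT.
    rewrite [LHS](periodic_step_sub (Um k) y N1 (S0 k) (NE k) imN).
    by rewrite [X in (X - _)%N](NE k) -mulnBl divnDr ?dvdn_mull// mulnK.
  rewrite -sumrB scaler_sumr; apply: eq_bigr => i _; rewrite -scalerBl scalerA; congr (_ *: _).
  rewrite -rmorphB -rmorphM /=; congr (_%:C).
  have ir : i.+1%:R != 0 :> R by rewrite pnatr_eq0.
  by move: (i.+1%:R : R) ir (kt k i) => u u0 v; field.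
rewrite (radZ p1) cabs_real (_ : `|2^-1| = 2^-1 :> R); last by rewrite ger0_norm// invr_ge0.
have := radB p1 Y Err; have L0 := lpn_ge0 p (rad x); rewrite {}WE in hE.
move: (lpn p (rad (fun k (y : 'Z_N) => Y k y - Err k y))) hY hE; move: (lpn p (rad x)) L0 => L L0.
move: (lpn p (rad Y)) (lpn p (rad Err)) => l1 l2 D h1 h2 h3.
have : L <= b ^+ 2 * L by rewrite ler_peMl.
move: h1; rewrite -!mulrA; move: (b ^+ 2 * L) => Z h1 h4; lra.
Qed.

End hilbert.

(** * Projections on consecutive frequencies of Z/m *)

Section projection_sums.
Context (R : realType) (X : completeNormedModType R[i]).
Implicit Types (U : nat -> X) (l m q : nat).

(** Because [proj_sum] evaluates at [q + i], this kernel selects the frequencies -1, ..., -l. After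
    multiplication by the conjugate of psi_n these are the digits below n_k. *)
Definition proj_kernel l m (i : nat) : R[i] :=
  (m%:R^-1)%:C * \sum_(c < l) cis (2 * pi * i%:R / m%:R : R) ^+ c.+1.

Definition proj_sum l m U q : X := \sum_(i < m) proj_kernel l m i *: U (q + i)%N.

Definition modulation l m q : R[i] := cis (2 * pi * q%:R / m%:R * l%:R : R).

Definition proj_error l m (i : nat) : R[i] :=
  let w := cis (2 * pi * i%:R / m%:R : R) in
  (w ^+ l - 1) * (w / (w - 1) / m%:R - alphaC R * (i%:R^-1 - (m - i)%:R^-1 : R)%:C).

Lemma modulationD l m q i : modulation l m (q + i) = modulation l m q * modulation l m i.
Proof. by rewrite /modulation -cisD natrD; congr cis; ring. Qed.

Lemma modulation_full l m : (0 < m)%N -> modulation l m m = 1.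
Proof. by move=> m0; rewrite /modulation mulfK ?cis_2pi// pnatr_eq0 -lt0n. Qed.

Lemma modulationVK l m q : (modulation l m q)^-1 * modulation l m q = 1.
Proof. by rewrite cisVC -cisD addNr cis0. Qed.

Lemma cabs_modulation l m q : cabs (modulation l m q) = 1.
Proof. exact: cabs_cis. Qed.

Lemma proj_kernel0 l m : (0 < m)%N -> proj_kernel l m 0 = (l%:R / m%:R : R)%:C.
Proof.
move=> m0; rewrite /proj_kernel mulr0 mul0r cis0.
under eq_bigr do rewrite expr1n.
by rewrite sumr_const card_ord -(rmorph_nat (real_complex R)) -rmorphM mulrC.
Qed.

(** The geometric sum is (w^l - 1) w / (w - 1) / m. Its second factor is a discrete Hilbert kernel
    up to O(1/m), and w^l is the modulation; the m errors of size 8/m add up to at most 8. *)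
Lemma proj_kernelE l m j : (0 < j < m)%N -> proj_kernel l m j =
  alphaC R * (j%:R^-1 - (m - j)%:R^-1 : R)%:C * (modulation l m j - 1) + proj_error l m j.
Proof.
move=> jm; have [w1 _] := projection_kernel_approx R jm.
rewrite /proj_kernel /proj_error /modulation -cisX; set w := cis _ in w1 *.
set a := alphaC R * _; rewrite mulrC.
have -> : a * (w ^+ l - 1) + (w ^+ l - 1) * (w / (w - 1) / m%:R - a) = (w ^+ l - 1) * (w / (w - 1) / m%:R).
  by ring.
under eq_bigr do rewrite exprS.
rewrite -mulr_sumr subrX1 fmorphV (rmorph_nat (real_complex R)); move: (\sum_(i < l) _) => s.
have w10 : w - 1 != 0 by rewrite subr_eq0.
have m0 : m%:R != 0 :> R[i] by rewrite pnatr_eq0 -lt0n; case/andP: jm => _; apply: leq_trans.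
by move: (w - 1) w10 (m%:R : R[i]) m0 => u u0 v v0; field; rewrite u0 v0.
Qed.

Lemma cabs_proj_error l m j : (0 < j < m)%N -> cabs (proj_error l m j) <= 8 / m%:R.
Proof.
move=> jm; have [_ h] := projection_kernel_approx R jm.
rewrite /proj_error; set w := cis _ in h *; rewrite cabsM.
have w2 : cabs (w ^+ l - 1) <= 2.
  by apply: le_trans (ler_cabsB _ _) _; rewrite cabs1 cisX cabs_cis; lra.
apply: le_trans (ler_pM _ _ w2 h) _; try exact: cabs_ge0.
by rewrite mulrA; apply: ler_wpM2r; rewrite ?invr_ge0 ?ler0n//; lra.
Qed.

Lemma hilbert_sumE m U q : hilbert_sum U m q =
  \sum_(i < m.-1) (i.+1%:R^-1 - (m - i.+1)%:R^-1)%:C *: U (q + i.+1)%N.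
Proof.
rewrite /hilbert_sum /refl_diff.
under eq_bigr do rewrite scalerBr.
under [RHS]eq_bigr do rewrite rmorphB scalerBl.
rewrite !sumrB; congr (_ - _); rewrite (reindex_inj rev_ord_inj) /=.
apply: eq_bigr => i _; have im := ltn_ord i.
have -> : (m.-1 - i.+1).+1 = (m - i.+1)%N by lia.
by congr (_ *: U _); lia.
Qed.

Lemma proj_sumE l m U q : (0 < m)%N -> proj_sum l m U q =
  (l%:R / m%:R : R)%:C *: U q +
  (\sum_(i < m.-1) proj_error l m i.+1 *: U (q + i.+1)%N +
  alphaC R *: ((modulation l m q)^-1 *: hilbert_sum (fun j => modulation l m j *: U j) m q
              - hilbert_sum U m q)).
Proof.
move=> m0; rewrite !hilbert_sumE /proj_sum; case: m m0 => // m' _.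
rewrite big_ord_recl proj_kernel0// addn0; congr (_ + _).
rewrite scaler_sumr -sumrB scaler_sumr -big_split; apply: eq_bigr => i _ /=.
rewrite /bump add1n; have -> := @proj_kernelE l m'.+1 i.+1; last by have := ltn_ord i; lia.
rewrite scalerDl addrC; congr (_ + _).
rewrite modulationD !scalerA -scalerBl scalerA; congr (_ *: _).
have := modulationVK l m'.+1 q; move: (modulation _ _ q) ((_)^-1) => a c ca.
rewrite -[X in _ = _ * (X - _)]mulrA.
move: (modulation _ _ _) ((_)%:C) => e d.
have -> : c * (d * (a * e)) = c * a * (d * e) by ring.
by rewrite ca; ring.
Qed.

End projection_sums.

(** The diagonal term and the error kernel give 17 L, the plain Hilbert sum 8320 B L, and the
    modulated one four times that, each of its two modulations costing a factor 2 by [contraction].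
    The 17 L fit into one more 8320 B L. *)
Lemma proj_constants (R : realType) (L B z e h2 h1 h f : R) : 0 <= L -> 1 <= B ->
  z <= L -> e <= 2 * 8 * L -> h2 <= 8320 * B * L -> h1 <= 2 * (8320 * B * (2 * L)) ->
  h <= h1 + h2 -> f <= e + h -> z + f <= 6 * 8320 * B * L.
Proof.
move=> L0 B1; have : L <= B * L by rewrite ler_peMl.
by move=> *; lra.
Qed.

Section projections.
Context (R : realType) (X : completeNormedModType R[i]) (p : R) (b : R).
Hypotheses (p1 : 1 < p) (hb : UMD_bound X p b) (b1 : 1 <= b).
Context (K N Q J : nat) (m S : 'I_K -> nat).
Hypotheses (N1 : (1 < N)%N) (Q0 : (0 < Q)%N) (JQ : (J <= Q)%N).
Hypothesis levels : forall l, (l < J)%N -> (4 * (2 * Q * 2 ^ l) <= N)%N.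
Hypothesis NQ : (N <= 16 * (Q * 2 ^ J))%N.
Hypotheses (QS : forall k, (4 * Q <= S k)%N) (NE : forall k, N = (m k * S k)%N).
Implicit Types U : 'I_K -> nat -> X.

Let S0 k : (0 < S k)%N. Proof. by apply: leq_trans (QS k); rewrite muln_gt0 Q0. Qed.
Let m0 k : (0 < m k)%N. Proof. by have := ltnW N1; rewrite (NE k) muln_gt0 => /andP[]. Qed.

Lemma cabs_alphaC : cabs (alphaC R) <= 1.
Proof.
have -> : alphaC R = 'i * (- (2 * pi)^-1)%:C.
  by apply/eqP; rewrite eq_complex /=; apply/andP; split; apply/eqP; ring.
rewrite cabsM cabs_real (_ : cabs 'i = 1) ?mul1r; last first.
  by rewrite /cabs normc_def /= expr0n add0r expr1n sqrtr1.
have := pi_ge2 R => pi2.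
by rewrite normrN ger0_norm ?invr_ge0 ?invf_le1; lra.
Qed.

Lemma rad_proj (l : 'I_K -> nat) U : (forall k, (l k <= m k)%N) ->
  (forall k j, U k (j + m k)%N = U k j) ->
  lpn p (rad (fun k (y : 'Z_N) => proj_sum (l k) (m k) (U k) (y %/ S k))) <=
  6 * 8320 * b ^+ 2 * lpn p (rad (fun k (y : 'Z_N) => U k (y %/ S k)%N)).
Proof.
move=> lm Um; set x := fun k (y : 'Z_N) => U k (y %/ S k)%N.
pose Mo k (y : 'Z_N) := modulation R (l k) (m k) (y %/ S k).
pose MU k j := modulation R (l k) (m k) j *: U k j.
have MUm k j : MU k (j + m k)%N = MU k j.
  by rewrite /MU Um modulationD (modulation_full _ _ (m0 k)) mulr1.
pose H1 k (y : 'Z_N) := (Mo k y)^-1 *: hilbert_sum (MU k) (m k) (y %/ S k).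
pose H2 k (y : 'Z_N) := hilbert_sum (U k) (m k) (y %/ S k).
pose e k (i : 'I_N) : R[i] := if (i < (m k).-1)%N then proj_error R (l k) (m k) i.+1 else 0.
pose Err k (y : 'Z_N) := \sum_i e k i *: x k (y + (i.+1 * S k)%:R).
pose Z k (y : 'Z_N) := ((l k)%:R / (m k)%:R : R)%:C *: x k y.
have mN k : ((m k).-1 <= N)%N by rewrite (leq_trans (leq_pred _))// (NE k) leq_pmulr.
have sumN (V : nmodType) n (F : nat -> V) : (n <= N)%N ->
    \sum_(s < N) (if (s < n)%N then F s else 0) = \sum_(s < n) F s.
  by move=> nN; rewrite (big_ord_widen _ F nN) [RHS]big_mkcond.
have hZ : lpn p (rad Z) <= lpn p (rad x).
  apply: (contraction_real p1) => k y; have mr : 0 < (m k)%:R :> R by rewrite ltr0n.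
  by rewrite ger0_norm ?divr_ge0 ?ler0n// ler_pdivrMr// mul1r ler_nat.
have hE : lpn p (rad Err) <= 2 * 8 * lpn p (rad x).
  apply: (rad_kernel p1 x (e := e) (sigma := fun k (i : 'I_N) (y : 'Z_N) => y + (i.+1 * S k)%:R)).
  - by rewrite ltr0n.
  - move=> k; apply: (@le_trans _ _ (\sum_(i < (m k).-1) 8 / (m k)%:R)).
      rewrite -(sumN _ _ (fun i => 8 / (m k)%:R))//; apply: ler_sum => i _.
      rewrite /e; case: ifP => im; last by rewrite cabs0.
      by apply: cabs_proj_error; lia.
    rewrite sumr_const card_ord -[_ *+ _]mulr_natr; have mr : 0 < (m k)%:R :> R by rewrite ltr0n.
    rewrite mulrAC ler_pdivrMr//; apply: ler_wpM2l; first exact: ler0n.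
    by rewrite ler_nat leq_pred.
  - by move=> k i y y' /addIr.
have hH2 : lpn p (rad H2) <= 8320 * b ^+ 2 * lpn p (rad x).
  exact: (rad_hilbert p1 hb b1 N1 Q0 JQ levels NQ QS NE Um).
have hH1 : lpn p (rad H1) <= 2 * (8320 * b ^+ 2 * (2 * lpn p (rad x))).
  apply: le_trans (contraction p1 (fun k (y : 'Z_N) => hilbert_sum (MU k) (m k) (y %/ S k)) (a := fun k y => (Mo k y)^-1) _) _.
    by move=> k y; rewrite cabsV cabs_modulation invr1.
  apply: ler_wpM2l; first exact: ler0n.
  apply: le_trans (rad_hilbert p1 hb b1 N1 Q0 JQ levels NQ QS NE MUm) _.
  apply: ler_wpM2l; first by apply: mulr_ge0; [exact: ler0n|exact: sqr_ge0].
  apply: (contraction p1 x (a := fun k y => Mo k y)) => k y.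
  by rewrite cabs_modulation.
have -> : lpn p (rad (fun k (y : 'Z_N) => proj_sum (l k) (m k) (U k) (y %/ S k))) =
   lpn p (rad (fun k y => Z k y + (Err k y + alphaC R *: (H1 k y - H2 k y)))).
  apply: eq_rad => k y; rewrite proj_sumE//; congr (_ + (_ + _)).
  rewrite /Err -(sumN _ _ (fun i => proj_error R (l k) (m k) i.+1 *: U k (y %/ S k + i.+1)%N))//.
  apply: eq_bigr => i _; rewrite /e; case: ifP => im; last by rewrite scale0r.
  by rewrite [x _ _](periodic_step_add (Um k) y _ N1 (S0 k) (NE k)) divnDr ?dvdn_mull// mulnK.
apply: le_trans (radD p1 _ _) _.
have hA := le_trans (radD p1 Err (fun k y => alphaC R *: (H1 k y - H2 k y))) (lexx _).
have hB : lpn p (rad (fun k y => alphaC R *: (H1 k y - H2 k y))) <= lpn p (rad H1) + lpn p (rad H2).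
  rewrite (radZ p1); apply: le_trans (radB p1 _ _).
  by apply: ler_piMl; [exact: lpn_ge0|exact: cabs_alphaC].
apply: (proj_constants (lpn_ge0 p (rad x)) _ hZ hE hH2 hH1 hB hA).
by rewrite expr_ge1// (le_trans ler01).
Qed.

End projections.

(** * Projections along coordinates *)

Section coordinate_expectations.
Context (R : realType) (X : completeNormedModType R[i]) (p : R).
Hypothesis p1 : 1 < p.
Context (A : finZmodType) (K : nat).
Local Notation V := {ffun 'I_K -> A}.
Implicit Types (g : V -> X) (x y z : V).

Definition mix (j : nat) y z : V := [ffun l : 'I_K => if (l < j)%N then y l else z l].

(** Conditional expectation given the coordinates below [j]. The mean runs over all of [V]; the
    entries of [z] below [j] only repeat terms. *)
Definition expect (j : nat) g y : X := ((#|{: V}|%:R^-1 : R)%:C : R[i]) *: \sum_z g (mix j y z).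

Definition increment (k : nat) g y : X := expect k.+1 g y - expect k g y.

Lemma card_ffun_neq0 : #|{: V}|%:R != 0 :> R.
Proof. by rewrite pnatr_eq0 -lt0n; apply/card_gt0P; exists 0. Qed.

Lemma scaler_mean (v : X) : ((#|{: V}|%:R^-1 : R)%:C : R[i]) *: (v *+ #|{: V}|) = v.
Proof.
rewrite -(scaler_nat #|{: V}| v) scalerA -(rmorph_nat (real_complex R)) -rmorphM /=.
by rewrite mulVf ?scale1r// card_ffun_neq0.
Qed.

Lemma expect_full g y : expect K g y = g y.
Proof.
rewrite /expect (eq_bigr (fun=> g y)) ?sumr_const ?scaler_mean// => z _.
by congr g; apply/ffunP => l; rewrite ffunE ltn_ord.
Qed.

Lemma expect_shift k g y c : expect k g (shift y k c) = expect k g y.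
Proof.
congr (_ *: _); apply: eq_bigr => z _; congr g; apply/ffunP => l; rewrite !ffunE.
by case: ifP => // lk; rewrite ltn_eqF.
Qed.

Lemma sum_expect_shift k g y :
  \sum_c expect k.+1 g (shift y k c) = expect k g y *+ #|A|.
Proof.
rewrite /expect -scaler_sumr scalerMnr; congr (_ *: _).
have -> : (\sum_z g (mix k y z)) *+ #|A| = \sum_z \sum_c g (mix k y (shift z k c)).
  rewrite exchange_big -sumr_const; apply: eq_bigr => c _.
  by rewrite [LHS](reindex_inj (@shift_inj _ _ k c)).
rewrite exchange_big; apply: eq_bigr => z _.
case: (ltnP k K) => kK; last first.
  apply: eq_bigr => c _; congr g; apply/ffunP => l; rewrite !ffunE.
  by have lk := leq_trans (ltn_ord l) kK; rewrite ltnS lk (ltnW lk) (ltn_eqF lk).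
rewrite (reindex_inj (addIr (z (Ordinal kK) - y (Ordinal kK)))).
apply: eq_bigr => c _; congr g; apply/ffunP => l; rewrite !ffunE ltnS.
case: ltngtP => // lk; have -> : l = Ordinal kK by apply: val_inj.
by rewrite addrCA [X in c + X]addrC subrK addrC.
Qed.

Lemma sum_increment_shift k g y : \sum_c increment k g (shift y k c) = 0.
Proof.
rewrite /increment sumrB sum_expect_shift.
by under eq_bigr do rewrite expect_shift; rewrite sumr_const subrr.
Qed.

Lemma lpn_sum_increment g :
  lpn p (fun y => \sum_(k < K) increment k g y) <= 2 * lpn p g.
Proof.
rewrite (eq_lpn p (G := fun y => g y - expect 0 g y)); last first.
  move=> y; rewrite -{1}(expect_full g) /increment -(big_mkord predT (fun k => expect k.+1 g y - expect k g y)).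
  by rewrite telescope_sumr.
apply: le_trans (lpnB p1 _ _) _; rewrite mulr2n mulrDl mul1r lerD2l.
rewrite (eq_lpn p (G := fun y => ((#|{: V}|%:R^-1 : R)%:C : R[i]) *: \sum_z g (y + z))); last first.
  move=> y; congr (_ *: _); rewrite [RHS](reindex_inj (addrI (- y))) /=.
  apply: eq_bigr => z _; congr g; apply/ffunP => l; rewrite !ffunE /=.
  by rewrite addNKr.
rewrite (lpnZr p1) ger0_norm ?invr_ge0 ?ler0n//.
apply: le_trans (ler_wpM2l _ (lpn_sum p1 _ _ _)) _; first by rewrite invr_ge0.
rewrite (eq_bigr (fun=> lpn p g)); last first.
  by move=> z _; apply: (lpn_reindexT p g (addIr z)).
by rewrite sumr_const -[lpn p g *+ _]mulr_natl mulrA mulVf ?mul1r// card_ffun_neq0.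
Qed.

End coordinate_expectations.

Section coordinate_projections.
Context (R : realType) (X : completeNormedModType R[i]) (p : R) (b : R).
Hypotheses (p1 : 1 < p) (hb : UMD_bound X p b) (b1 : 1 <= b).
Context (K N Q J : nat) (m S : nat -> nat).
Hypotheses (N1 : (1 < N)%N) (Q0 : (0 < Q)%N) (JQ : (J <= Q)%N).
Hypothesis levels : forall l, (l < J)%N -> (4 * (2 * Q * 2 ^ l) <= N)%N.
Hypothesis NQ : (N <= 16 * (Q * 2 ^ J))%N.
Hypotheses (QS : forall k, (k < K)%N -> (4 * Q <= S k)%N).
Hypotheses (NE : forall k, (k < K)%N -> N = (m k * S k)%N).
Context (l : nat -> nat).
Hypothesis lm : forall k, (l k < m k)%N.
Local Notation V := {ffun 'I_K -> 'Z_N}.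
Implicit Types (x y z : V).

Definition coord_proj (k : nat) (phi : V -> X) y : X :=
  \sum_(i < m k) proj_kernel R (l k) (m k) i *: phi (shift y k (i * S k)%:R).

Definition cellwise (j : nat) (g : V -> X) := forall y y',
  (forall i : 'I_K, (i < j)%N -> y i %/ S i = y' i %/ S i)%N -> g y = g y'.

Context (g : V -> X).
Hypothesis gS : cellwise K g.

Lemma expect_cellwise j : cellwise j (expect j g).
Proof.
move=> y y' h; congr (_ *: _); apply: eq_bigr => z _; apply: gS => i _.
by rewrite !ffunE; case: ifP => // ij; rewrite h.
Qed.

Lemma increment_cellwise k : cellwise k.+1 (increment k g).
Proof.
move=> y y' h; rewrite /increment; congr (_ - _); apply: expect_cellwise => // i ik.
by apply: h; exact: ltnW.
Qed.

Let S0 k : (k < K)%N -> (0 < S k)%N.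
Proof. by move=> kK; apply: leq_trans (QS kK); rewrite muln_gt0 Q0. Qed.

(** A function that does not depend on coordinate k is multiplied by the total mass of the kernel, a
    sum over the frequencies 1, ..., [l k]. As [l k < m k], none of them is 0 modulo [m k], so every
    one sums to 0. *)
Lemma coord_proj_expect k y : coord_proj k (expect k g) y = 0.
Proof.
rewrite /coord_proj; under eq_bigr do rewrite expect_shift.
rewrite -scaler_suml /proj_kernel -mulr_sumr exchange_big /= big1 ?mulr0 ?scale0r// => c _.
have m0 : (m k)%:R != 0 :> R by rewrite pnatr_eq0 -lt0n (leq_ltn_trans _ (lm k)).
have cm : (0 < c.+1 < m k)%N by rewrite /= (leq_ltn_trans (ltn_ord c) (lm k)).
have [w1 _] := projection_kernel_approx R cm.
pose w : R[i] := cis (2 * pi * c.+1%:R / (m k)%:R).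
rewrite (eq_bigr (fun i : 'I_(m k) => w ^+ i)); last first.
  by move=> i _; rewrite /w !cisX; congr cis; ring.
have : (w - 1) * \sum_(i < m k) w ^+ i = 0.
  rewrite -subrX1 /w cisX (_ : _ * _ = 2 * pi * c.+1%:R) ?cis_2pi ?subrr//.
  by rewrite divfK.
by move/eqP; rewrite mulf_eq0 subr_eq0 (negbTE w1) => /eqP.
Qed.

Lemma coord_projE k y : coord_proj k (increment k g) y = coord_proj k (expect k.+1 g) y.
Proof.
rewrite -[RHS]subr0 -[X in _ - X](coord_proj_expect k y) -sumrB; apply: eq_bigr => i _.
by rewrite -scalerBr.
Qed.

Let hD1 k x y : (k < K)%N -> (forall i : 'I_K, (i <= k)%N -> x i = y i) ->
  increment k g x = increment k g y.
Proof. by move=> _ h; apply: increment_cellwise => i ik; rewrite h. Qed.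

Let hP1 k x y : (k < K)%N -> (forall i : 'I_K, (i <= k)%N -> x i = y i) ->
  coord_proj k (increment k g) x = coord_proj k (increment k g) y.
Proof.
move=> kK h; apply: eq_bigr => i _; congr (_ *: _); apply: hD1 => // j jk.
by rewrite !ffunE h.
Qed.

Let hD2 k x : (k < K)%N -> \sum_c increment k g (shift x k c) = 0.
Proof. by move=> _; exact: sum_increment_shift. Qed.

Let hP2 k x : (k < K)%N -> \sum_c coord_proj k (increment k g) (shift x k c) = 0.
Proof.
move=> kK; rewrite exchange_big big1// => i _; rewrite -scaler_sumr -[RHS](scaler0 _ (proj_kernel R (l k) (m k) i)).
congr (_ *: _); rewrite -[RHS](hD2 x kK) [RHS](reindex_inj (addIr (i * S k)%:R)).
apply: eq_bigr => c _; congr (increment k g); apply/ffunP => j; rewrite !ffunE.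
by case: (_ == _) => //; rewrite addrA.
Qed.

(** The increment as a function of the cell index of its last variable, the earlier ones being
    frozen at [x]; this is the function on Z/m_k to which [rad_proj] applies. *)
Let slice (x : V) (k : 'I_K) (j : nat) : X :=
  increment k g (repl x [ffun=> (j * S k)%:R] k).

Let slice_periodic x (k : 'I_K) j : slice x k (j + m k) = slice x k j.
Proof.
rewrite /slice; congr (increment k g (repl x _ k)); apply/ffunP => i; rewrite !ffunE.
by rewrite mulnDl -NE// natrD [X in _ + X]pchar_Zp ?addr0.
Qed.

Let sliceE x y (k : 'I_K) : increment k g (repl x y k) = slice x k (y k %/ S k)%N.
Proof.
have Sk := S0 (ltn_ord k).
apply: increment_cellwise => i _; rewrite !ffunE; case: eqP => // /val_inj ->.
have yN : (y k < N)%N by have := ltn_ord (y k); rewrite [X in (_ < X)%N]Zp_cast.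
rewrite val_Zp_nat// modn_small ?mulnK//.
by apply: leq_ltn_trans yN; exact: leq_trunc_div.
Qed.

Let proj_sliceE x y (k : 'I_K) : coord_proj k (increment k g) (repl x y k) =
  proj_sum (l k) (m k) (slice x k) (y k %/ S k).
Proof.
have Sk := S0 (ltn_ord k).
apply: eq_bigr => i _; congr (_ *: _).
have -> : shift (repl x y k) k (i * S k)%:R = repl x (shift y k (i * S k)%:R) k.
  by apply/ffunP => j; rewrite !ffunE; case: (_ == _).
rewrite sliceE ffunE eqxx.
rewrite (periodic_step_add (slice_periodic x k) _ _ N1 Sk (NE (ltn_ord k))).
by rewrite divnDr ?dvdn_mull// mulnK.
Qed.

(** [recouple_le] costs [b], [rad_proj] costs [b ^+ 2] and [decouple_le] costs [b]. The constant is
    that of [rad_proj] doubled by [lpn_sum_increment]. The signs [T] are added as a variable because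
    [rad] averages over them. *)
Lemma lpn_coord_proj :
  lpn p (fun y => \sum_(k < K) coord_proj k (expect k.+1 g) y) <=
  12 * 8320 * b ^+ 4 * lpn p g.
Proof.
have b0 : 0 <= b by apply: le_trans b1.
pose Esum y := \sum_(k < K) increment k g y.
pose Psum y := \sum_(k < K) coord_proj k (increment k g) y.
rewrite (eq_lpn p (G := Psum)); last by move=> y; apply: eq_bigr => k _; rewrite coord_projE.
pose T : finType := {ffun 'I_K -> bool}.
pose sg (e : T) (k : nat) : R := sgb R (if insub k is Some i then e i else false).
have sg1 e k : sg e k = 1 \/ sg e k = -1 by exact: sgb2.
have sgE e (k : 'I_K) : sg e k = sgb R (e k) by rewrite /sg valK.
pose c : R := #|{: V}|%:R `^ p^-1.
pose cT : R := #|{: T}|%:R `^ p^-1.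
pose Pdec (t : (V * V) * T) := rad (fun k (a : 'Z_N) => proj_sum (l k) (m k) (slice t.1.1 k) (a %/ S k)) (t.2, t.1.2).
pose Edec (t : (V * V) * T) := rad (fun k (a : 'Z_N) => slice t.1.1 k (a %/ S k)%N) (t.2, t.1.2).
have h1 : lpn p (fun t : (V * V) * T => Psum t.1.1) <= b * lpn p Pdec.
  apply: (lpn_pair_le p1 b0) => e; rewrite (lpn_fst p V Psum).
  have hr := recouple_le hb hP1 hP2 (sg1 e).
  apply: (le_trans hr).
  apply: ler_wpM2l; first exact: b0.
  apply: eq_lpn_le => t.
  by apply: eq_bigr => k _; rewrite sgE proj_sliceE.
(* After decoupling, the first copy is only a parameter of the slices, and the k-th summand depends
   on the second copy through y_k alone, so [rad_proj] applies for each fixed x. *)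
have h2 : lpn p Pdec <= 6 * 8320 * b ^+ 2 * lpn p Edec.
  pose h (u : (T * V) * V) : (V * V) * T := ((u.2, u.1.2), u.1.1).
  have hbij : bijective h by exists (fun t => ((t.2, t.1.2), t.1.1)) => -[[]].
  rewrite -(lpn_reindex p Pdec hbij) -(lpn_reindex p Edec hbij).
  apply: (lpn_pair_le p1); first by do !apply: mulr_ge0; rewrite ?sqr_ge0 ?ler0n.
  move=> x; pose l' (k : 'I_K) := l k; pose m' (k : 'I_K) := m k; pose S' (k : 'I_K) := S k.
  apply: le_trans (rad_proj p1 hb b1 (m := m') (S := S') N1 Q0 JQ levels NQ _ _ (l := l') (U := slice x) _ _) _.
  - by move=> k; apply: QS.
  - by move=> k; apply: NE.
  - by move=> k; exact: ltnW (lm k).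
  - by move=> k j; apply: slice_periodic.
  apply: ler_wpM2l; first by do !apply: mulr_ge0; rewrite ?sqr_ge0 ?ler0n.
  by apply: eq_lpn_le => -[].
have h3 : lpn p Edec <= b * lpn p (fun t : (V * V) * T => Esum t.1.1).
  apply: (lpn_pair_le p1 b0) => e; rewrite (lpn_fst p V Esum).
  apply: le_trans (decouple_le hb hD1 hD2 (sg1 e)).
  apply: eq_lpn_le => t.
  by apply: eq_bigr => k _; rewrite sgE sliceE.
have fstfst (F : V -> X) : lpn p (fun t : (V * V) * T => F t.1.1) = cT * (c * lpn p F).
  by rewrite (lpn_fst p T (fun t : V * V => F t.1)) (lpn_fst p V F).
have c0 : 0 < c by apply: powR_gt0; rewrite ltr0n; apply/card_gt0P; exists 0.
have cT0 : 0 < cT by apply: powR_gt0; rewrite ltr0n; apply/card_gt0P; exists [ffun=> true].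
have h4 := lpn_sum_increment p1 g.
rewrite !{}fstfst in h1 h3; rewrite -/Esum in h4.
apply: (@le_trans _ _ (6 * 8320 * b ^+ 4 * lpn p Esum)).
  rewrite -(ler_pM2l c0) -(ler_pM2l cT0); apply: le_trans h1 _.
  apply: le_trans (ler_wpM2l b0 h2) _.
  apply: le_trans (ler_wpM2l b0 (ler_wpM2l _ h3)) _.
    by do !apply: mulr_ge0; rewrite ?sqr_ge0 ?ler0n.
  by rewrite le_eqVlt; apply/orP; left; apply/eqP; ring.
apply: le_trans (ler_wpM2l _ h4) _.
  by apply: mulr_ge0; [apply: mulr_ge0; exact: ler0n|exact: exprn_ge0].
by rewrite le_eqVlt; apply/orP; left; apply/eqP; ring.
Qed.

End coordinate_projections.

(** * The Dirichlet kernel in mixed radix *)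

Section mixed_radix.
Variable m : nat -> nat.
Hypothesis m_gt0 : forall k, (0 < m k)%N.

Lemma radixS k : radix m k.+1 = (m k * radix m k)%N.
Proof. by rewrite /radix big_ord_recr mulnC. Qed.

Lemma radix_gt0 k : (0 < radix m k)%N.
Proof. by rewrite /radix prodn_gt0. Qed.

Lemma radix_dvd k K : (k < K)%N -> (m k * radix m k %| radix m K)%N.
Proof.
elim: K => // K IH; rewrite ltnS radixS leq_eqVlt => /predU1P[->//|kK].
by rewrite dvdn_mull// IH.
Qed.

Lemma digit_low K a s k : (k < K)%N -> digit m (a * radix m K + s) k = digit m s k.
Proof.
move=> /radix_dvd/dvdnP[t ->]; by rewrite /digit !mulnA divnMDl ?radix_gt0// modnMDl.
Qed.

Lemma digit_top K a s : (s < radix m K)%N -> (a < m K)%N -> digit m (a * radix m K + s) K = a.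
Proof. by move=> sK aK; rewrite /digit divnMDl ?radix_gt0// divn_small// addn0 modn_small. Qed.

Variable F : fieldType.
Implicit Types u : nat -> F.

Definition digit_mon K u (j : nat) : F := \prod_(k < K) u k ^+ digit m j k.

Lemma digit_monS K u a s : (s < radix m K)%N -> (a < m K)%N ->
  digit_mon K.+1 u (a * radix m K + s) = u K ^+ a * digit_mon K u s.
Proof.
move=> sK aK; rewrite /digit_mon big_ord_recr /= digit_top// mulrC; congr (_ * _).
by apply: eq_bigr => k _; rewrite digit_low.
Qed.

Lemma sum_digit_mon K u : \sum_(s < radix m K) digit_mon K u s = \prod_(l < K) \sum_(c < m l) u l ^+ c.
Proof.
elim: K => [|K IH].
  by rewrite /radix big_ord0 big_ord1 /digit_mon big_ord0 big_ord0.
rewrite radixS (sum_mul_nat (m K) (radix m K) (digit_mon K.+1 u)) big_ord_recr /= -IH mulrC.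
rewrite mulr_suml; apply: eq_bigr => a _; rewrite mulr_sumr; apply: eq_bigr => s _.
exact: digit_monS.
Qed.

(* The integers below n are grouped by their highest digit that differs from
   that of n. *)
Lemma dirichlet_kernel K n u : (n < radix m K)%N -> (forall l, u l != 0) -> (forall l, u l ^+ m l = 1) ->
  \sum_(j < n) digit_mon K u j = digit_mon K u n *
    \sum_(k < K) (\sum_(c < digit m n k) (u k)^-1 ^+ c.+1) * \prod_(l < k) \sum_(c < m l) u l ^+ c.
Proof.
(* A full geometric sum of a root of unity vanishes unless the root is 1, so it absorbs all powers
   of [u l]. *)
move=> + u0 um; have wu l e : (\sum_(c < m l) u l ^+ c) * u l ^+ e = \sum_(c < m l) u l ^+ c.
  elim: e => [|e IH]; rewrite ?expr0 ?mulr1// exprSr mulrA IH.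
  have := subrX1 (u l) (m l); rewrite um subrr => /esym/eqP; rewrite mulf_eq0 subr_eq0.
  by move=> /orP[/eqP ->|/eqP ->]; rewrite ?mulr1 ?mul0r.
elim: K n => [|K IH] n.
  by rewrite /radix big_ord0 ltnS leqn0 => /eqP ->; rewrite !big_ord0 mulr0.
rewrite radixS => nK; set a := (n %/ radix m K)%N; set r := (n %% radix m K)%N.
have nE : n = (a * radix m K + r)%N by exact: divn_eq.
have rK : (r < radix m K)%N by rewrite ltn_mod radix_gt0.
have aK : (a < m K)%N by rewrite ltn_divLR// radix_gt0.
have dK : digit m n K = a by rewrite nE digit_top.
have dl k : (k < K)%N -> digit m n k = digit m r k by move=> kK; rewrite [in LHS]nE digit_low.
have monE : digit_mon K.+1 u n = u K ^+ a * digit_mon K u r by rewrite [in LHS]nE digit_monS.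
have sumE (f : nat -> F) : \sum_(j < n) f j =
    \sum_(j < a * radix m K) f j + \sum_(s < r) f (a * radix m K + s)%N.
  by rewrite -(big_mkord xpredT f) [in LHS]nE big_mkord big_split_ord.
rewrite big_ord_recr /= dK mulrDr [RHS]addrC sumE monE.
congr (_ + _); last first.
  rewrite (eq_bigr (fun s : 'I_r => u K ^+ a * digit_mon K u s)); last first.
    by move=> s _; rewrite digit_monS// (ltn_trans (ltn_ord s)).
  rewrite -mulr_sumr IH// -!mulrA; congr (_ * (_ * _)); apply: eq_bigr => k _.
  by rewrite dl.
(* Top digit smaller than that of [n]: the lower digits are free and give the full product, from
   which [wu] lets the lower part of the monomial of [n] be split off. *)
rewrite (sum_mul_nat a (radix m K) (digit_mon K.+1 u)).
rewrite (eq_bigr (fun i : 'I_a => u K ^+ i * \prod_(l < K) \sum_(c < m l) u l ^+ c)); last first.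
  move=> i _; rewrite -sum_digit_mon mulr_sumr; apply: eq_bigr => s _.
  by rewrite digit_monS// (ltn_trans (ltn_ord i)).
rewrite -mulr_suml mulrACA; congr (_ * _); last first.
  rewrite /digit_mon -big_split; apply: eq_bigr => l _ /=; by rewrite mulrC wu.
(* Counting the top digit down from that of [n], as a - (c + 1), yields the negative powers. *)
rewrite mulr_sumr (reindex_inj rev_ord_inj); apply: eq_bigr => c _ /=.
by rewrite -[X in _ = u K ^+ X * _](subnK (ltn_ord c)) exprD -mulrA -exprMn mulfV// expr1n mulr1.
Qed.

End mixed_radix.

Section dirichlet_projections.
Context (R : realType) (X : completeNormedModType R[i]).
Context (K N : nat) (m S : nat -> nat).
Hypotheses (N1 : (1 < N)%N) (m_gt0 : forall k, (0 < m k)%N).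
Hypothesis NE : forall k, (k < K)%N -> N = (m k * S k)%N.
Local Notation V := {ffun 'I_K -> 'Z_N}.
Implicit Types (y z : V) (g : V -> X).

Let S0 k : (k < K)%N -> (0 < S k)%N.
Proof. by move=> kK; have := ltnW N1; rewrite (NE kK) muln_gt0 => /andP[]. Qed.

Lemma cell_lt y (k : 'I_K) : (y k %/ S k < m k)%N.
Proof.
rewrite ltn_divLR ?S0// -NE//.
by have := ltn_ord (y k); rewrite [X in (_ < X)%N]Zp_cast.
Qed.

Lemma cell_add y (k : 'I_K) i :
  ((y k + (i * S k)%:R : 'Z_N)%R %/ S k = (y k %/ S k + i) %% m k)%N.
Proof.
have per j : ((j + m k) %% m k = j %% m k)%N by rewrite modnDr.
have := periodic_step_add per (y k) (i * S k) N1 (S0 (ltn_ord k)) (NE (ltn_ord k)).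
rewrite divnDr ?dvdn_mull// mulnK ?S0// => <-; rewrite modn_small//.
by have := cell_lt [ffun=> (y k + (i * S k)%:R : 'Z_N)%R] k; rewrite ffunE.
Qed.

Lemma cell_nat (k : 'I_K) j : (((j * S k)%:R : 'Z_N) %/ S k = j %% m k)%N.
Proof. by have := cell_add 0 k j; rewrite ffunE add0r div0n add0n. Qed.

Lemma sum_cells (k : 'I_K) (H : nat -> X) : (forall j, H (j + m k)%N = H j) ->
  forall q, \sum_(a : 'Z_N) H (a %/ S k)%N = (\sum_(i < m k) H (q + i)%N) *+ S k.
Proof.
move=> Hm q; have -> : \sum_(a : 'Z_N) H (a %/ S k)%N = \sum_(a < N) H (a %/ S k)%N.
  by rewrite -(big_mkord xpredT (fun a => H (a %/ S k)%N)) [X in index_iota 0 X](_ : _ = N) ?big_mkord// Zp_cast.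
rewrite [in LHS](NE (ltn_ord k)) (sum_mul_nat (m k) (S k) (fun a => H (a %/ S k)%N)).
have Hmod j : H (j %% m k)%N = H j.
  by rewrite [in RHS](divn_eq j (m k)) (periodic_mul Hm).
rewrite -(eq_bigr _ (fun (i : 'I_(m k)) _ => Hmod (q + i)%N)) sum_rotate// -sumrMnl.
apply: eq_bigr => i _; rewrite (eq_bigr (fun=> H i)) ?sumr_const ?card_ord// => t _.
by rewrite divnMDl ?S0// divn_small ?addn0.
Qed.

(** For cellwise [g] only the cell of z_k matters. It is the cell of y_k moved by some i < [m k],
    and each cell is hit by the same proportion of the z_k. *)
Lemma sum_coord (k : 'I_K) (kappa : nat -> R[i]) g y :
  (forall j, kappa (j + m k)%N = kappa j) -> cellwise S K g ->
  \sum_(z : V) kappa (z k %/ S k)%N *: g (mix k y z) =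
  ((m k)%:R^-1 : R)%:C *: \sum_(i < m k) kappa (y k %/ S k + i)%N *:
    \sum_z g (mix k.+1 (shift y k (i * S k)%:R) z).
Proof.
move=> kap_per gS.
pose Hn z j : X := kappa j *: g (mix k.+1 (shift y k ((j * S k)%:R - y k)) z).
have cell_eq z i (a : 'Z_N) : (i = a %/ S k %[mod m k])%N ->
    g (mix k.+1 (shift y k ((i * S k)%:R - y k)) z) = g (mix k.+1 (shift y k (a - y k)) z).
  move=> ia; apply: gS => l _; rewrite !ffunE; case: ifP => // _; case: eqP => // /val_inj ->.
  rewrite ![y k + _]addrC !subrK cell_nat ia modn_small//.
  by have := cell_lt [ffun=> a] k; rewrite ffunE.
have Hper z j : Hn z (j + m k)%N = Hn z j.
  by rewrite /Hn kap_per mulnDl -NE// natrD [X in _ + X - _]pchar_Zp// addr0.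
have step z : \sum_c kappa ((shift z k c) k %/ S k)%N *: g (mix k y (shift z k c)) =
    (\sum_(i < m k) kappa (y k %/ S k + i)%N *: g (mix k.+1 (shift y k (i * S k)%:R) z)) *+ S k.
  rewrite (_ : \sum_(i < m k) _ = \sum_(i < m k) Hn z (y k %/ S k + i)%N); last first.
    apply: eq_bigr => i _; congr (_ *: _).
    rewrite (@cell_eq z _ (y k + (i * S k)%:R)) ?cell_add ?modn_mod//.
    by rewrite [y k + _]addrC addrK.
  rewrite -sum_cells// [LHS](reindex_inj (addIr (- z k))).
  apply: eq_bigr => a _; rewrite /Hn ffunE eqxx [z k + _]addrC subrK; congr (_ *: _).
  rewrite (@cell_eq z _ a)//; congr g; apply/ffunP => l; rewrite !ffunE ltnS.
  case: ltngtP => // /val_inj ->; by rewrite [z k + _]addrC [y k + _]addrC !subrK.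
have Nr : N%:R != 0 :> R by rewrite pnatr_eq0 -lt0n ltnW.
(* Multiplication by [N] allows the k-th coordinate of [z] to be resampled by summing over all its
   translates. *)
apply: (@scalerI _ _ (N%:R%:C)); first by rewrite (inj_eq (@complexI R) _ 0).
rewrite [in LHS](rmorph_nat (real_complex R)) scaler_nat.
have -> : (\sum_(z : V) kappa (z k %/ S k)%N *: g (mix k y z)) *+ N =
    \sum_(z : V) \sum_(c : 'Z_N) kappa ((shift z k c) k %/ S k)%N *: g (mix k y (shift z k c)).
  have -> (v : X) : v *+ N = \sum_(c : 'Z_N) v.
    by rewrite sumr_const card_ord [in RHS]Zp_cast.
  rewrite [RHS]exchange_big; apply: eq_bigr => c _.
  by rewrite [LHS](reindex_inj (@shift_inj _ _ k c)).
under eq_bigr do rewrite step.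
rewrite sumrMnl exchange_big scalerA -rmorphM /=.
rewrite (_ : N%:R * (m k)%:R^-1 = (S k)%:R :> R); last first.
  by rewrite [in LHS](NE (ltn_ord k)) natrM mulrAC mulfV ?mul1r// pnatr_eq0 -lt0n.
rewrite (rmorph_nat (real_complex R)) scaler_nat; congr (_ *+ _).
by apply: eq_bigr => i _; rewrite scaler_sumr.
Qed.

(** Density of the conditional expectation on the cells of the first [j] coordinates; by
    orthogonality it is the product of the full geometric sums in the Dirichlet kernel. *)
Definition same_cells (j : nat) y z : R[i] :=
  \prod_(l < K | (l < j)%N) ((m l)%:R * (y l %/ S l == z l %/ S l)%N%:R).

Lemma sum_same_cells j g y : (j <= K)%N -> cellwise S K g ->
  \sum_z same_cells j y z *: g z = \sum_z g (mix j y z).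
Proof.
elim: j g => [|j IH] g jK gS.
  apply: eq_bigr => z _; rewrite /same_cells big1 // scale1r; congr g.
  by apply/ffunP => l; rewrite ffunE.
pose k := Ordinal jK.
pose kappa q' : R[i] := (m k)%:R * (y k %/ S k == q' %% m k)%N%:R.
pose g1 (z : V) := kappa (z k %/ S k)%N *: g z.
have g1S : cellwise S K g1 by move=> z z' zz'; rewrite /g1 (gS z z')// zz'.
have -> : \sum_z same_cells j.+1 y z *: g z = \sum_z same_cells j y z *: g1 z.
  apply: eq_bigr => z _; rewrite /g1 scalerA; congr (_ *: _).
  rewrite /same_cells (bigD1 k) ?ltnS ?leqnn//= mulrC /kappa (modn_small (cell_lt z k)).
  congr (_ * _); apply: eq_bigl => l; rewrite ltnS -(inj_eq val_inj) /= ltn_neqAle andbC.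
  by [].
rewrite IH ?(ltnW jK)//.
have -> : \sum_z g1 (mix j y z) = \sum_(z : V) kappa (z k %/ S k)%N *: g (mix k y z).
  by apply: eq_bigr => z _; rewrite /g1 ffunE ltnn.
rewrite sum_coord// => [|q]; last by rewrite /kappa modnDr.
have ylt := cell_lt y k.
rewrite (bigD1 (Ordinal (m_gt0 k)))//= addn0 /kappa modn_small// eqxx mulr1.
rewrite [X in _ + X]big1 ?addr0 => [|i i0]; last first.
  rewrite -{1}(modn_small ylt) -[X in (X %% _ == _)%N]addn0 eqn_modDl mod0n modn_small//.
  rewrite eq_sym (_ : (i == 0 :> nat) = false) ?mulr0 ?scale0r//.
  by apply: contraNF i0 => /eqP i0; apply/eqP/val_inj.
rewrite scalerA -(rmorph_nat (real_complex R)) -rmorphM mulVf ?pnatr_eq0 -?lt0n// scale1r.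
apply: eq_bigr => z _; congr (g (mix _ _ z)); apply/ffunP => l; rewrite ffunE mul0n.
by rewrite mulr0n addr0; case: ifP.
Qed.

Definition root_fun (k q : nat) : R[i] := cis (2 * pi * q%:R / (m k)%:R : R).

Lemma root_funD k q i : root_fun k (q + i) = root_fun k q * root_fun k i.
Proof. by rewrite /root_fun natrD -cisD; congr cis; ring. Qed.

Lemma root_fun_neq0 k q : root_fun k q != 0.
Proof. by rewrite -(cabs_eq0 (root_fun k q)) cabs_cis oner_neq0. Qed.

Lemma root_funX k q : root_fun k q ^+ m k = 1.
Proof.
rewrite /root_fun cisX (_ : _ * _ = 2 * pi * q%:R) ?cis_2pi//.
by rewrite divfK// pnatr_eq0 -lt0n.
Qed.

Lemma root_fun_full k : root_fun k (m k) = 1.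
Proof.
rewrite /root_fun mulfK ?pnatr_eq0 -?lt0n// -[X in cis X]mulr1.
exact: (cis_2pi R 1).
Qed.

Lemma root_fun_lt_neq1 k q : (0 < q < m k)%N -> root_fun k q != 1.
Proof. by move=> /(projection_kernel_approx R)[]. Qed.

Lemma sum_root_fun k q q' : (q < m k)%N -> (q' < m k)%N ->
  \sum_(c < m k) (root_fun k q / root_fun k q') ^+ c = (m k)%:R * (q == q')%:R.
Proof.
move=> qm qm'; case: eqVneq => [->|qq'].
  rewrite mulfV ?root_fun_neq0// mulr1; under eq_bigr do rewrite expr1n.
  by rewrite sumr_const card_ord.
set u := _ / _; have u1 : u != 1.
  rewrite /u; case: (ltngtP q q') qq' => // h _.
    rewrite -(subnKC (ltnW h)) root_funD invfM mulrA mulfV ?root_fun_neq0// mul1r invr_eq1.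
    by apply: root_fun_lt_neq1; rewrite subn_gt0 h (leq_ltn_trans (leq_subr _ _)).
  rewrite -(subnK (ltnW h)) root_funD mulfK ?root_fun_neq0//.
  by apply: root_fun_lt_neq1; rewrite subn_gt0 h (leq_ltn_trans (leq_subr _ _)).
have := subrX1 u (m k); rewrite expr_div_n !root_funX divr1 subrr => /esym/eqP.
by rewrite mulf_eq0 subr_eq0 (negbTE u1) /= mulr0 => /eqP.
Qed.

Definition cell_root y (k : nat) : R[i] :=
  root_fun k (if insub k is Some i then y i %/ S (i : 'I_K) else 0)%N.

Lemma cell_rootE y (k : 'I_K) : cell_root y k = root_fun k (y k %/ S k).
Proof. by rewrite /cell_root valK. Qed.

Definition lift_char (j : nat) y : R[i] := digit_mon m K (cell_root y) j.

Lemma lift_char_div j y z :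
  lift_char j y / lift_char j z = digit_mon m K (fun k => cell_root y k / cell_root z k) j.
Proof.
rewrite /lift_char /digit_mon -prodf_div; apply: eq_bigr => k _.
by rewrite expr_div_n.
Qed.

Lemma cabs_lift_char j y : cabs (lift_char j y) = 1.
Proof.
rewrite /lift_char /digit_mon; apply: (big_ind (fun u => cabs u = 1)); first exact: cabs1.
  by move=> u v u1 v1; rewrite cabsM u1 v1 mulr1.
by move=> k _; rewrite cisX cabs_cis.
Qed.

Lemma lift_char_cellwise j y z : (forall i : 'I_K, y i %/ S i = z i %/ S i)%N ->
  lift_char j y = lift_char j z.
Proof. by move=> h; apply: eq_bigr => k _; rewrite !cell_rootE h. Qed.

(** In term k of the kernel, the full sums below k fix the cells of [y], the partial sum in
    coordinate k is [proj_kernel], and the coordinates above k are averaged out, which gives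
    [expect k.+1]. *)
Lemma dirichlet_sum n g y : (n < radix m K)%N -> cellwise S K g ->
  \sum_(j < n) lift_char j y *: (((#|{: V}|%:R^-1 : R)%:C : R[i]) *:
     \sum_z (lift_char j z)^-1 *: g z) =
  lift_char n y *: \sum_(k < K) coord_proj m S (digit m n) k
     (expect k.+1 (fun z => (lift_char n z)^-1 *: g z)) y.
Proof.
move=> nK gS; set c := _%:C; set h := fun z => (lift_char n z)^-1 *: g z.
have hS : cellwise S K h.
  move=> z z' zz'; rewrite /h (gS z z' zz').
  have e : lift_char n z = lift_char n z'.
    apply: lift_char_cellwise => i; apply: zz'; exact: ltn_ord.
  by rewrite e.
pose kappa k q q' : R[i] := \sum_(e < digit m n k) (root_fun k q / root_fun k q')^-1 ^+ e.+1.
have kernel z : \sum_(j < n) lift_char j y * (lift_char j z)^-1 =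
    lift_char n y * (lift_char n z)^-1 *
    \sum_(k < K) kappa k (y k %/ S k)%N (z k %/ S k)%N * same_cells k y z.
  under eq_bigr do rewrite lift_char_div.
  rewrite lift_char_div (dirichlet_kernel m_gt0 nK) => [|l|l].
  - congr (_ * _); apply: eq_bigr => k _; rewrite /kappa !cell_rootE; congr (_ * _).
    rewrite (big_ord_widen K (fun l => \sum_(e < m l) (cell_root y l / cell_root z l) ^+ e) (ltnW (ltn_ord k))).
    apply: eq_bigr => l _; rewrite !cell_rootE sum_root_fun ?cell_lt//.
  - by rewrite mulf_neq0 ?invr_eq0 ?root_fun_neq0.
  - by rewrite expr_div_n !root_funX divr1.
have -> : \sum_(j < n) lift_char j y *: (c *: \sum_z (lift_char j z)^-1 *: g z) =
    lift_char n y *: \sum_(k < K) c *: \sum_z same_cells k y z *: (kappa k (y k %/ S k)%N (z k %/ S k)%N *: h z).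
  rewrite -scaler_sumr exchange_big.
  transitivity (c *: \sum_z (\sum_(j < n) lift_char j y * (lift_char j z)^-1) *: g z).
    rewrite (eq_bigr (fun j : 'I_n => c *: \sum_z (lift_char j y / lift_char j z) *: g z)); last first.
      move=> j _; rewrite scalerA mulrC -scalerA; congr (_ *: _); rewrite scaler_sumr.
      by apply: eq_bigr => z _; rewrite scalerA.
    rewrite -scaler_sumr exchange_big; congr (_ *: _); apply: eq_bigr => z _.
    by rewrite scaler_suml.
  rewrite [in RHS]scalerA mulrC -scalerA; congr (_ *: _).
  rewrite scaler_sumr; apply: eq_bigr => z _; rewrite kernel mulr_sumr scaler_suml scaler_sumr.
  apply: eq_bigr => k _; rewrite /h !scalerA; congr (_ *: _); ring.
congr (_ *: _); apply: eq_bigr => k _.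
have kS q : cellwise S K (fun z : V => kappa k q (z k %/ S k)%N *: h z).
  by move=> z z' zz'; rewrite zz'// (hS z z').
rewrite (sum_same_cells _ (ltnW (ltn_ord k)) (kS _)).
under [X in _ *: X = _]eq_bigr do rewrite ffunE ltnn.
rewrite (@sum_coord k (kappa k (y k %/ S k)%N) h y) => [|j|//]; last first.
  by rewrite /kappa root_funD root_fun_full mulr1.
rewrite scalerA mulrC -scalerA scaler_sumr scaler_sumr; apply: eq_bigr => i _.
rewrite /expect -/c !scalerA; congr (_ *: _).
rewrite mulrAC; congr (_ * _ * _); apply: eq_bigr => e _.
by rewrite invfM invrK root_funD mulrA mulVf ?root_fun_neq0// mul1r.
Qed.

End dirichlet_projections.

(** * Lifting the Vilenkin group *)

Section cell_representatives.
Context (K N : nat) (m S : nat -> nat).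
Hypotheses (N1 : (1 < N)%N) (m_gt0 : forall k, (0 < m k)%N).
Hypothesis NE : forall k, (k < K)%N -> N = (m k * S k)%N.
Local Notation V := {ffun 'I_K -> 'Z_N}.
Implicit Types (y z i : V).

(* The coordinates of [vilenkin m] below K are the cells, i.e. the quotients
   by S, of the coordinates of V; [corner] picks one point in each cell. *)
Definition corner y : V := [ffun k : 'I_K => (y k %/ S k * S k)%:R].

Lemma corner_cell y (k : 'I_K) : (corner y k %/ S k = y k %/ S k)%N.
Proof. by rewrite ffunE (cell_nat N1 NE) modn_small// (cell_lt N1 NE). Qed.

Lemma eq_corner y z : (forall k : 'I_K, y k %/ S k = z k %/ S k)%N -> corner y = corner z.
Proof. by move=> h; apply/ffunP => k; rewrite !ffunE h. Qed.

Lemma corner_idem y : corner (corner y) = corner y.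
Proof. by apply: eq_corner => k; rewrite corner_cell. Qed.

Definition cell_card i : nat := #|[set y | corner y == i]%SET|.

Lemma cell_card_out i : corner i != i -> cell_card i = 0%N.
Proof.
move=> ii; apply/eqP; rewrite cards_eq0; apply/eqP/setP => y; rewrite !inE.
by apply: contraNF ii => /eqP <-; rewrite corner_idem.
Qed.

(** A translation of [V] by a vector of multiples of the [S k] carries one cell into the other. *)
Lemma cell_card_const i j : corner i = i -> corner j = j -> (cell_card i <= cell_card j)%N.
Proof.
move=> ii jj; pose q (k : 'I_K) := (j k %/ S k + (m k - i k %/ S k))%N.
pose d : V := [ffun k => (q k * S k)%:R].
rewrite /cell_card -(card_imset [set y | corner y == i]%SET (addIr d)); apply: subset_leq_card.
apply/fintype.subsetP => z /imsetP[y]; rewrite !inE => /eqP yi ->{z}; apply/eqP.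
rewrite -jj; apply: eq_corner => k; rewrite ffunE [d k]ffunE (cell_add N1 NE) -(corner_cell y) yi.
rewrite /q addnCA subnKC ?modnDr ?modn_small ?(cell_lt N1 NE)//.
exact: ltnW (cell_lt N1 NE i k).
Qed.

Lemma sum_corner (W : nmodType) (H : V -> W) :
  \sum_y H (corner y) = \sum_i H i *+ cell_card i.
Proof.
rewrite (partition_big corner predT)//=; apply: eq_bigr => i _.
rewrite (eq_bigr (fun=> H i)) => [|y /eqP -> //].
by rewrite sumr_const; congr (_ *+ _); apply: eq_card => y; rewrite !inE.
Qed.

End cell_representatives.

Section haar_cells.
Context (R : realType) (m : nat -> nat) (mu : probability (vilenkin m) R).
Hypotheses (m2 : forall k, (2 <= m k)%N) (hmu : normalized_haar mu).
Context (K N : nat) (S : nat -> nat).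
Hypothesis N1 : (1 < N)%N.
Hypothesis NE : forall k, (k < K)%N -> N = (m k * S k)%N.
Local Notation V := {ffun 'I_K -> 'Z_N}.
Implicit Types (x a : vilenkin m) (i j y : V).

Let m_gt0 k : (0 < m k)%N. Proof. exact: ltnW (m2 k). Qed.

Lemma val_coord_lt x k : (x k < m k)%N.
Proof. by have := ltn_ord (x k); rewrite [X in (_ < X)%N]Zp_cast. Qed.

Definition embed x : V := [ffun k : 'I_K => ((x k : nat) * S k)%:R].

Lemma embed_cell x (k : 'I_K) : (embed x k %/ S k = x k)%N.
Proof. by rewrite ffunE (cell_nat N1 NE) modn_small// val_coord_lt. Qed.

Lemma corner_embed x : corner S (embed x) = embed x.
Proof. by apply/ffunP => k; rewrite [LHS]ffunE embed_cell [RHS]ffunE. Qed.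

Definition cell_digit i (k : nat) : 'Z_(m k) :=
  (if insub k is Some l then i l %/ S (l : 'I_K) else 0)%N%:R.

Lemma cell_digitE i (k : 'I_K) : cell_digit i k = (i k %/ S k)%N :> nat.
Proof. by rewrite /cell_digit valK val_Zp_nat// modn_small// (cell_lt N1 NE). Qed.

Lemma embed_fiber i : corner S i = i ->
  embed @^-1` [set i] = [set x | forall k : 'I_K, x k = cell_digit i k].
Proof.
move=> ii; apply/seteqP; split => x /= h.
  by move=> k; apply: val_inj; rewrite /= cell_digitE -h embed_cell.
by rewrite -ii; apply/ffunP => k; rewrite !ffunE h cell_digitE.
Qed.

Lemma embed_measurable : fin_measurable embed.
Proof.
move=> i; have [ii|ii] := eqVneq (corner S i) i; last first.
  rewrite (_ : embed @^-1` [set i] = set0); first exact: measurable0.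
  by apply/seteqP; split => x //= xi; move: ii; rewrite -xi corner_embed eqxx.
rewrite embed_fiber// (_ : [set x | _] = \bigcap_(k in [set: 'I_K]) [set x | x k = cell_digit i k]).
  apply: fin_bigcap_measurable => // k _; apply: sub_sigma_algebra.
  by exists k, (cell_digit i k).
by apply/seteqP; split => x /= h k; [move=> _; apply: h | apply: (h k I)].
Qed.

Lemma embed_fp_const i j : corner S i = i -> corner S j = j -> fp mu embed i = fp mu embed j.
Proof.
move=> ii jj; rewrite /fp; pose a : vilenkin m := fun k => cell_digit j k - cell_digit i k.
rewrite -(hmu a (embed_measurable i)); congr (fine (mu _)).
rewrite !embed_fiber//; apply/seteqP; split => [_ [x /= h <-] k|x /= h].
  by rewrite /vadd /a h subrK.
exists (fun k => x k - a k); last by apply: functional_extensionality_dep => k; rewrite /vadd addrC subrK.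
by move=> k; rewrite h /a opprB addrCA subrr addr0.
Qed.

Lemma embed_fp_out i : corner S i != i -> fp mu embed i = 0.
Proof.
move=> ii; rewrite /fp (_ : embed @^-1` [set i] = set0) ?measure0//.
by apply/seteqP; split => x //= xi; move: ii; rewrite -xi corner_embed eqxx.
Qed.

(** Translation invariance makes all cylinders equally likely, translations of [V] make all cells
    equally large, and the total mass is 1. The image of Haar measure is thus the uniform measure of
    [V] pushed to the corners. *)
Lemma embed_fpE i : fp mu embed i = (cell_card S i)%:R / #|{: V}|%:R.
Proof.
have V0 : (#|{: V}|%:R : R) != 0 by rewrite pnatr_eq0 -lt0n; apply/card_gt0P; exists 0.
apply: (mulIf V0); rewrite divfK//.
have [ii|ii] := eqVneq (corner S i) i; last by rewrite embed_fp_out// (cell_card_out N1 NE)// mul0r.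
have <- : (\sum_(j : V) cell_card S j = #|{: V}|)%N.
  rewrite -[RHS]sum1_card [RHS](partition_big (corner S) predT)//=; apply: eq_bigr => j _.
  by rewrite /cell_card -sum1_card; apply: eq_bigl => y; rewrite inE.
have s1 : \sum_j fp mu embed j = 1.
  rewrite -(fp_pred mu predT embed_measurable) (_ : [set x | _] = setT) ?probability_setT//.
  by apply/seteqP; split.
rewrite natr_sum mulr_sumr -[RHS]mul1r -[X in _ = X * _]s1 mulr_suml; apply: eq_bigr => j _.
have [jj|jj] := eqVneq (corner S j) j; last by rewrite (embed_fp_out jj) (cell_card_out N1 NE jj) mulr0 mul0r.
rewrite (embed_fp_const ii jj); congr (_ * _%:R); apply/eqP; rewrite eqn_leq.
by rewrite !(cell_card_const N1 NE).
Qed.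

End haar_cells.

Section lifting.
Context (R : realType) (X : completeNormedModType R[i]) (p : R).
Hypothesis p1 : 1 < p.
Context (m : nat -> nat) (mu : probability (vilenkin m) R).
Hypotheses (m2 : forall k, (2 <= m k)%N) (hmu : normalized_haar mu).
Context (K N : nat) (S : nat -> nat).
Hypothesis N1 : (1 < N)%N.
Hypothesis NE : forall k, (k < K)%N -> N = (m k * S k)%N.
Local Notation V := {ffun 'I_K -> 'Z_N}.
Implicit Types (x : vilenkin m) (i y z : V) (f : vilenkin m -> X).
Local Notation cV := ((#|{: V}|%:R^-1 : R)%:C : R[i]).
Local Notation emb := (@embed m K N S).

Let p0 : 0 < p. Proof. exact: lt_trans p1. Qed.
Let m_gt0 k : (0 < m k)%N. Proof. exact: ltnW (m2 k). Qed.

Lemma vilenkin_fun_lift j x : (j <= K)%N -> vilenkin_fun R j x = lift_char R m S j (emb x).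
Proof.
move=> jK; rewrite /vilenkin_fun /lift_char /digit_mon.
rewrite (big_ord_widen K (fun k => rademacher R k x ^+ digit m j k) jK) big_mkcond.
apply: eq_bigr => k _; rewrite cell_rootE (embed_cell m2 N1 NE).
by case: ltnP => // jk; have [_ -> //] := digitP j m2.
Qed.

Lemma conj_unimodular (u : R[i]) : cabs u = 1 -> u^* = u^-1.
Proof. by move=> u1; rewrite invC_norm normc_cabs u1 expr1n invr1 mul1r. Qed.

Lemma fp_mean (W : V -> X) :
  \sum_i (fp mu emb i)%:C *: W i = cV *: \sum_y W (corner S y).
Proof.
rewrite sum_corner scaler_sumr; apply: eq_bigr => i _.
rewrite (embed_fpE m2 hmu N1 NE) -(scaler_nat (cell_card S i) (W i)) scalerA mulrC.
by rewrite rmorphM (rmorph_nat (real_complex R)).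
Qed.

Lemma fp_mean_real (W : V -> R) :
  \sum_i fp mu emb i * W i = #|{: V}|%:R^-1 * \sum_y W (corner S y).
Proof.
rewrite sum_corner mulr_sumr; apply: eq_bigr => i _.
by rewrite (embed_fpE m2 hmu N1 NE) -[W i *+ _]mulr_natl mulrA [_^-1 * _]mulrC.
Qed.

(** [G] is the mean of [f] over the cylinder of a cell. The character of index [j <= K] depends on
    the first [K] coordinates only, so integrating against it sees no more of [f]. *)
Lemma fourier_coef_lift f : in_Lp mu measurable p f ->
  exists G : V -> X,
    (forall j, (j <= K)%N -> fourier_coef mu f j =
       cV *: \sum_z (lift_char R m S j z)^-1 *: G (corner S z)) /\
    #|{: V}|%:R^-1 * \sum_y rnorm (G (corner S y)) `^ p <= fine (Lp_norm mu p f) `^ p.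
Proof.
move=> hf; have [W [intW normW]] := bochner_weights_Lp p1 (embed_measurable m2 N1 NE) hf.
have fp0_out i : fp mu emb i = 0 -> forall x, emb x != i.
  rewrite (embed_fpE m2 hmu N1 NE) => /eqP; rewrite mulf_eq0 invr_eq0.
  have -> : (#|{: V}|%:R == 0 :> R) = false by apply/negbTE; exact: card_ffun_neq0.
  rewrite orbF pnatr_eq0 => /eqP h x; apply/negP => /eqP xi; move: h; apply/eqP.
  rewrite -lt0n; apply/card_gt0P; exists i.
  by rewrite inE -xi (corner_embed m2 N1 NE).
have W0 i : fp mu emb i = 0 -> W i = 0.
  move=> /fp0_out hi; pose w (l : V) : R[i] := (l == i)%:R.
  have e : (fun x => w (emb x) *: f x) = (fun x => 0 *: f x).
    by apply: functional_extensionality_dep => x; rewrite /w (negbTE (hi x)).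
  have h1 := bochner_integralE (intW w); have h2 := bochner_integralE (intW (fun=> 0)).
  move: h1; rewrite e h2 big1 => [|l _]; last by rewrite scale0r.
  by rewrite sum_deltaZ => ->.
(* Labels that are not corners have mass 0, and there [W] vanishes by [W0], so the inverse of 0 does
   no harm. *)
pose G i := ((fp mu emb i)^-1)%:C *: W i.
have GW i : (fp mu emb i)%:C *: G i = W i.
  rewrite /G scalerA -rmorphM /=; have [e|e] := eqVneq (fp mu emb i) 0; first by rewrite (W0 i e) scaler0.
  by rewrite mulfV// scale1r.
exists G; split => [j jK|].
  have charC y : lift_char R m S j y = lift_char R m S j (corner S y).
    by apply: lift_char_cellwise => k; rewrite (corner_cell N1 NE).
  pose H i := (lift_char R m S j i)^-1 *: G i.
  have HE z : (lift_char R m S j z)^-1 *: G (corner S z) = H (corner S z) by rewrite /H -charC.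
  rewrite (eq_bigr _ (fun z _ => HE z)) -(fp_mean H).
  rewrite (_ : \sum_i _ = \sum_i (lift_char R m S j i)^-1 *: W i); last first.
    by apply: eq_bigr => i _; rewrite scalerA mulrC -scalerA GW.
  rewrite -(bochner_integralE (intW (fun i => (lift_char R m S j i)^-1))).
  congr (bochner_integral mu _); apply: functional_extensionality_dep => x; congr (_ *: _).
  by rewrite vilenkin_fun_lift// conj_unimodular// cabs_lift_char.
rewrite -(fp_mean_real (fun i => rnorm (G i) `^ p)).
apply: le_trans normW; apply: ler_sum => i _.
have [e|e] := eqVneq (fp mu emb i) 0; first by rewrite e mul0r divr_ge0// powR_ge0.
have f0 := fp_ge0 mu emb i; have f1 : 0 < fp mu emb i by rewrite lt_neqAle eq_sym e.
rewrite /G rnormZr ger0_norm ?invr_ge0// powRM ?invr_ge0 ?rnorm_ge0// -powR_inv1// -powRrM mulN1r.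
rewrite mulrA mulrC; apply: ler_wpM2l; first exact: powR_ge0.
rewrite -powRN opprB powRD ?e ?implybT// powRr1//.
Qed.

Definition lift_sum f n i : X := \sum_(j < n) lift_char R m S j i *: fourier_coef mu f j.

Lemma partial_sum_lift f n : (n <= K)%N -> partial_sum mu n f = lift_sum f n \o emb.
Proof.
move=> nK; apply: functional_extensionality_dep => x; apply: eq_bigr => j _.
by rewrite vilenkin_fun_lift// (leq_trans (ltnW (ltn_ord j))).
Qed.

Lemma Lp_norm_lift (Phi : V -> X) : Lp_norm mu p (Phi \o emb) =
  ((#|{: V}|%:R^-1 * \sum_y rnorm (Phi (corner S y)) `^ p) `^ p^-1)%:E.
Proof.
by rewrite (Lp_norm_fin mu p Phi (embed_measurable m2 N1 NE)) (fp_mean_real (fun i => rnorm (Phi i) `^ p)).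
Qed.

Lemma Lp_norm_partial_sum_fin f n : (n <= K)%N -> Lp_norm mu p (partial_sum mu n f) \is a fin_num.
Proof. by move=> nK; rewrite partial_sum_lift// Lp_norm_lift. Qed.

Lemma Lp_norm_partial_sum_null f n : (n <= K)%N -> in_Lp mu measurable p f ->
  Lp_norm mu p f = 0%E -> Lp_norm mu p (partial_sum mu n f) = 0%E.
Proof.
move=> nK hf f0; have [G [fG normG]] := fourier_coef_lift hf.
have G0 y : G (corner S y) = 0.
  move: normG; rewrite f0 /= powR0 ?gt_eqF// pmulr_rle0; last first.
    by rewrite invr_gt0 lt_neqAle eq_sym card_ffun_neq0 ler0n.
  rewrite (bigD1 y)//= => h; apply: rnorm0_eq0; apply: (@powR_eq0_eq0 _ _ p).
  apply/le_anti; rewrite powR_ge0 andbT; apply: le_trans h; rewrite lerDl.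
  by apply: sumr_ge0 => z _; exact: powR_ge0.
have -> : partial_sum mu n f = fun=> 0.
  apply: functional_extensionality_dep => x; rewrite /partial_sum big1// => j _.
  rewrite fG ?(leq_trans (ltnW (ltn_ord j)))// big1 ?scaler0// => z _.
  by rewrite G0 scaler0.
rewrite (_ : (fun=> 0) = (fun=> 0 : X) \o emb)// Lp_norm_lift big1 ?mulr0 ?powR0 ?invr_eq0 ?gt_eqF// => y _.
by rewrite rnorm0 powR0// gt_eqF.
Qed.

Lemma Lp_norm_partial_sum_lift b Q J n f : UMD_bound X p b -> 1 <= b ->
  (0 < Q)%N -> (J <= Q)%N -> (forall l, (l < J)%N -> (4 * (2 * Q * 2 ^ l) <= N)%N) ->
  (N <= 16 * (Q * 2 ^ J))%N -> (forall k, (k < K)%N -> (4 * Q <= S k)%N) ->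
  (n <= K)%N -> (n < radix m K)%N -> in_Lp mu measurable p f ->
  (Lp_norm mu p (partial_sum mu n f) <= (12 * 8320 * b ^+ 4)%:E * Lp_norm mu p f)%E.
Proof.
move=> hb b1 Q0 JQ levels NQ QS nK nrad hf.
have [G [fG normG]] := fourier_coef_lift hf.
pose g (z : V) := G (corner S z).
have gS : cellwise S K g.
  by move=> y z h; rewrite /g (@eq_corner _ _ _ y z)// => k; apply: h.
rewrite partial_sum_lift// Lp_norm_lift; set Phi := lift_sum f n.
have fnf : Lp_norm mu p f \is a fin_num by rewrite ge0_fin_numE ?Lp_norm_ge0//; case: hf.
rewrite -(fineK fnf) -EFinM lee_fin.
have Vi : 0 <= #|{: V}|%:R^-1 :> R by rewrite invr_ge0.
have hPhi : lpn p Phi <= 12 * 8320 * b ^+ 4 * lpn p g.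
  pose h z := (lift_char R m S n z)^-1 *: g z.
  have PhiE y : Phi y = lift_char R m S n y *:
      \sum_(k < K) coord_proj m S (digit m n) k (expect k.+1 h) y.
    rewrite -(dirichlet_sum N1 m_gt0 NE y nrad gS); apply: eq_bigr => j _; congr (_ *: _).
    by rewrite fG// (leq_trans (ltnW (ltn_ord j))).
  have hS : cellwise S K h.
    move=> y z yz; rewrite /h (gS y z yz).
    have e : lift_char R m S n y = lift_char R m S n z.
      by apply: lift_char_cellwise => i; apply: yz; exact: ltn_ord.
    by rewrite e.
  have dm k : (digit m n k < m k)%N by have [] := digitP n m2.
  apply: le_trans (lpn_le_pw p1 (G := fun y => \sum_(k < K) coord_proj m S (digit m n) k (expect k.+1 h) y) _) _.
    by move=> y; rewrite PhiE rnormZ cabs_lift_char mul1r.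
  apply: le_trans (lpn_coord_proj p1 hb b1 N1 Q0 JQ levels NQ QS NE dm hS) _.
  apply: ler_wpM2l.
    by apply: mulr_ge0; [apply: mulr_ge0; exact: ler0n|apply: exprn_ge0; exact: le_trans b1].
  by apply: (lpn_le_pw p1) => y; rewrite /h rnormZ cabsV cabs_lift_char invr1 mul1r.
have s0 (F : V -> X) : 0 <= \sum_y rnorm (F y) `^ p by apply: sumr_ge0 => y _; exact: powR_ge0.
have PhiC y : Phi (corner S y) = Phi y.
  apply: eq_bigr => j _; rewrite (@lift_char_cellwise _ _ _ m S j (corner S y) y) // => k.
  by rewrite (corner_cell N1 NE).
under eq_bigr do rewrite PhiC.
rewrite powRM// -/(lpn p Phi).
apply: le_trans (ler_wpM2l (powR_ge0 _ _) hPhi) _; rewrite mulrCA.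
apply: ler_wpM2l.
  by apply: mulr_ge0; [apply: mulr_ge0; exact: ler0n|apply: exprn_ge0; exact: le_trans b1].
rewrite /lpn -powRM//.
apply: le_trans (ge0_ler_powR _ _ _ normG) _; rewrite ?nnegrE ?powR_ge0 ?invr_ge0 ?(ltW p0) ?mulr_ge0//.
by rewrite -powRrM mulfV ?gt_eqF// powRr1// fine_ge0// Lp_norm_ge0.
Qed.

End lifting.

(** * From admissible constants to the UMD constant *)

Section umd_constant.
Context (R : realType) (X : completeNormedModType R[i]) (p : R).
Hypothesis p1 : 1 < p.

(** Tested on the single difference equal to [x] or [- x] with equal probability, and on the trivial
    transform. In the zero space 0 is admissible, which is why that case is treated apart. *)
Lemma UMD_bound_ge1 (b : R) (x : X) : x != 0 -> UMD_bound X p b -> 1 <= b.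
Proof.
move=> x0 hb; pose D (k : nat) (t : bool) : X := (sgb R t)%:C *: x.
pose e (k : nat) : rel bool := if k is 0%N then fun _ _ => true else fun s t => s == t.
have cancelD k : (k < 1)%N -> cancels (e k) (D k).
  case: k => // _; exists bool, (fun i t => t (+) i); split => [||//|t].
  - by rewrite card_bool.
  - by move=> i s t /addIb.
  - rewrite big_bool /D /= addbT addbF -scalerDl -rmorphD.
    by case: t; rewrite /sgb /= ?subrr ?addNr ?scale0r.
have := @fin_umd _ _ _ _ hb bool true 1 e D (fun=> 1) _ _ _ cancelD _.
have -> : lpn p (fun t => \sum_(k < 1) (1 : R)%:C *: D k t) = lpn p (fun t => \sum_(k < 1) D k t).
  by apply: eq_lpn => t; apply: eq_bigr => k _; rewrite scale1r.
have L0 : 0 < lpn p (fun t => \sum_(k < 1) D k t).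
  rewrite lt_neqAle lpn_ge0 andbT eq_sym; apply/eqP => L0.
  have := lpn_powR p1 (fun t => \sum_(k < 1) D k t).
  rewrite L0 powR0 ?gt_eqF ?(lt_trans ltr01)// big_bool /= => /esym/eqP.
  rewrite paddr_eq0 ?powR_ge0// => /andP[/eqP/powR_eq0_eq0/rnorm0_eq0 + _].
  by rewrite big_ord1 /D /sgb rmorphN scaleN1r => /eqP; rewrite oppr_eq0 (negbTE x0).
rewrite -{1}[lpn p _]mul1r (ler_pM2r L0); apply=> //.
- case=> [|k] s t u /=; first by split.
  by split => [|/eqP ->]; rewrite ?eqxx.
- by case=> [|k].
- by case=> // s t _ /= /eqP ->.
- by left.
Qed.

Lemma lee_expe (x y : \bar R) n : (0 <= x -> x <= y -> x ^+ n <= y ^+ n)%E.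
Proof.
move=> x0 xy; elim: n => [|n IH]; first by rewrite !expe0.
by rewrite !expeS; apply: lee_pmul => //; exact: expe_ge0.
Qed.

(* Taking fourth roots first covers the case [UMD_constant X p = +oo]. *)
Lemma le_UMD_constant_expr (C a l : R) : 0 < C -> 0 <= a -> 0 < l ->
  (forall b, UMD_bound X p b -> a <= C * b ^+ 4 * l) ->
  (a%:E <= C%:E * UMD_constant X p ^+ 4 * l%:E)%E.
Proof.
move=> C0 a0 l0 h; pose t := (a / (C * l)) `^ 4^-1.
have t4 : t ^+ 4 = a / (C * l).
  rewrite -powR_mulrn ?powR_ge0// -powRrM mulVf// powRr1//.
  by rewrite divr_ge0// mulr_ge0 ?ltW.
have aE : a = C * t ^+ 4 * l.
  by rewrite t4; field; rewrite !gt_eqF.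
have t0 : 0 <= t by exact: powR_ge0.
have tb : (t%:E <= UMD_constant X p)%E.
  apply: le_ereal_inf_tmp => _ [b hb <-]; rewrite lee_fin.
  have := h b hb; rewrite {1}aE (ler_pM2r l0) (ler_pM2l C0).
  by rewrite ler_pXn2r// nnegrE ?t0 ?hb.1.
rewrite aE (EFinM (C * t ^+ 4)) (EFinM C) EFin_expe; apply: lee_wpmul2r; first by rewrite lee_fin ltW.
by apply: lee_wpmul2l; [rewrite lee_fin ltW|apply: lee_expe; rewrite ?lee_fin].
Qed.

End umd_constant.

Section vilenkin_bound.
Context (R : realType) (X : completeNormedModType R[i]) (p : R).
Hypothesis p1 : 1 < p.
Context (m : nat -> nat) (mu : probability (vilenkin m) R).
Hypotheses (m2 : forall k, (2 <= m k)%N) (hmu : normalized_haar mu).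

Let m_gt0 k : (0 < m k)%N. Proof. exact: ltnW (m2 k). Qed.

Lemma radix_gt k : (k < radix m k)%N.
Proof.
elim: k => [|k IH]; first by rewrite radix_gt0.
rewrite radixS; apply: (@leq_ltn_trans (1 * radix m k)); first by rewrite mul1n.
by rewrite ltn_pmul2r ?radix_gt0//; exact: m2.
Qed.

Lemma Lp_norm_partial_sum (n : nat) (f : vilenkin m -> X) : (1 <= n)%N -> in_Lp mu measurable p f ->
  (Lp_norm mu p (partial_sum mu n f) <=
   (12 * 8320 : R)%:E * UMD_constant X p ^+ 4 * Lp_norm mu p f)%E.
Proof.
(* Only the coordinates below [n] matter, as [n < radix m n], and every [m k] among them divides
   [M]. The smallest dilation is [M]; since [m k <= M], the factor 4 M^2 makes the cells at least
   [4 * M] long. *)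
move=> n1 hf; pose M := radix m n; pose N := (4 * M ^ 2)%N; pose S k := (N %/ m k)%N.
have M1 : (1 < M)%N by rewrite (leq_ltn_trans n1)// radix_gt.
have mM k : (k < n)%N -> (m k %| M)%N.
  by move=> kn; apply: dvdn_trans (radix_dvd m kn); exact: dvdn_mulr.
have NE k : (k < n)%N -> N = (m k * S k)%N.
  by move=> /mM h; rewrite /S mulnC divnK// /N dvdn_mull// expnS dvdn_mulr.
have N1 : (1 < N)%N by rewrite /N; nia.
have QS k : (k < n)%N -> (4 * M <= S k)%N.
  move=> /mM h; rewrite /S leq_divRL// /N -mulnA leq_mul2l /= expnS expn1 leq_mul2l.
  by rewrite (dvdn_leq _ h) ?orbT// ltnW.
pose J := trunc_log 2 M.
have JM : (2 ^ J <= M)%N by apply: trunc_logP => //; exact: ltnW.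
have JM2 : (M < 2 ^ J.+1)%N by apply: trunc_log_ltn.
have levels l : (l < J)%N -> (4 * (2 * M * 2 ^ l) <= N)%N.
  move=> lJ; have : (2 ^ l.+1 <= M)%N by apply: leq_trans JM; rewrite leq_pexp2l.
  by rewrite /N expnS => h; nia.
have NQ : (N <= 16 * (M * 2 ^ J))%N by move: JM2; rewrite /N expnS => h; nia.
have JQ : (J <= M)%N by apply: leq_trans JM; exact: ltnW (ltn_expl _ _).
(* [le_UMD_constant_expr] divides by the norm of [f], so null functions are settled first. *)
have [f0|f0] := eqVneq (Lp_norm mu p f) 0%E.
  by rewrite (Lp_norm_partial_sum_null p1 m2 hmu N1 NE (leqnn n) hf f0) f0 mule0.
have fnf : Lp_norm mu p f \is a fin_num by rewrite ge0_fin_numE ?Lp_norm_ge0//; case: hf.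
have fng := @Lp_norm_partial_sum_fin _ X p _ mu m2 hmu n N S N1 NE f n (leqnn n).
(* In the zero space [f] would have norm 0, which is excluded at this point; hence [UMD_bound_ge1]
   is applicable. *)
have [x x0] : exists x : X, x != 0.
  apply: contrapT => h; move: f0; apply/negP; rewrite negbK; apply/eqP.
  have X0 (x : X) : x = 0 by apply: contrapT => /eqP nx; apply: h; exists x.
  rewrite (_ : f = (fun=> 0 : X) \o @embed m n N S); last by apply: functional_extensionality_dep => x; rewrite [LHS]X0.
  rewrite (Lp_norm_lift p m2 hmu N1 NE) big1 ?mulr0 ?powR0 ?invr_eq0 ?gt_eqF ?(lt_trans ltr01)// => y _.
  by rewrite rnorm0 powR0// gt_eqF// (lt_trans ltr01).
have C0 : (0 : R) < 12 * 8320 by apply: mulr_gt0; rewrite ltr0n.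
rewrite -(fineK fng) -(fineK fnf); apply: (le_UMD_constant_expr C0).
- by rewrite fine_ge0// Lp_norm_ge0.
- by rewrite fine_gt0// lt_neqAle eq_sym f0 Lp_norm_ge0 -ge0_fin_numE ?Lp_norm_ge0.
move=> b hb; have b1 := UMD_bound_ge1 p1 x0 hb.
rewrite -lee_fin EFinM (fineK fng) (fineK fnf).
by apply: (Lp_norm_partial_sum_lift p1 m2 hmu N1 NE hb b1 (ltnW M1) JQ levels NQ QS (leqnn n) (radix_gt n) hf).
Qed.

End vilenkin_bound.

Theorem theorem1p2 (R : realType) (p : R) (hp : 1 < p) :
  exists C : R,
    forall (X : completeNormedModType R[i]) (hX : UMD X)
      (m : nat -> nat) (hm : forall k, (2 <= m k)%N)
      (mu : probability (vilenkin m) R) (hmu : normalized_haar mu)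
      (f : vilenkin m -> X) (hf : in_Lp mu measurable p f),
      (ereal_sup [set Lp_norm mu p (partial_sum mu n f) | n in [set n | (1 <= n)%N]]
       <= C%:E * UMD_constant X p ^+ 4 * Lp_norm mu p f)%E.
Proof.
exists (12 * 8320) => X _ m m2 mu hmu f hf.
apply: ge_ereal_sup => _ [n n1 <-].
exact: Lp_norm_partial_sum.
Qed.
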